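(* Let $\mu$ be an arbitrary probability measure on $\mathbb{C}$, and let $X_1, X_2, \ldots$ be iid complex random variables with distribution $\mu$. For each $n \geq 1$ let $k_n$ be a deterministic integer with $0 \le k_n \le n$ and $k_n = o(n)$ as $n\to\infty$, and let $\xi_1^{(n)}, \ldots, \xi_{k_n}^{(n)}$ be a deterministic triangular array of complex numbers. Define \[ p_n(z) := \prod_{j=1}^{n-k_n} (z - X_j) \prod_{l=1}^{k_n} (z - \xi_l^{(n)}). \] Then $\mu'_{p_n}$ converges weakly to $\mu$ in probability as $n \to \infty$; that is, for every bounded continuous $f:\mathbb{C}\to\mathbb{R}$ and every $\varepsilon>0$, $\lim_{n\to\infty}\mathbb{P}\left(\left|\int f\,d\mu'_{p_n} - \int f\,d\mu\right|>\varepsilon\right)=0$.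
   Context: For a polynomial $f$ of degree $n$, $\mu_f := \frac{1}{n}\sum_{z: f(z)=0}\delta_z$ (roots counted with multiplicity) is the empirical measure of its roots, and $\mu'_f := \mu_{f'}$ is the empirical measure of its critical points (zeros of $f'$, counted with multiplicity, normalized by $\deg f' $). *)

(* Defs.v *)
From HB Require Import structures.
From mathcomp Require Import all_boot all_order all_algebra.
From mathcomp Require Import all_classical all_reals all_analysis.
From mathcomp.real_closed Require Import complex.

Set Implicit Arguments.
Unset Strict Implicit.
Unset Printing Implicit Defensive.

Import Order.TTheory GRing.Theory Num.Theory numFieldNormedType.Exports.
Local Open Scope classical_set_scope.
Local Open Scope ring_scope.

(* The complex plane C is modelled measure-theoretically/topologically as
   R * R (product Borel sigma-algebra = Borel sigma-algebra of C, product
   topology = usual topology), and algebraically as R[i] (an algebraically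
   closed field).  The two are identified via (x, y) <-> x +i* y. *)

Definition cplx_of_pair (R : realType) (z : R * R) : R[i] := Complex z.1 z.2.
Definition pair_of_cplx (R : realType) (z : R[i]) : R * R := (complex.Re z, complex.Im z).

Definition roots_mult (R : realType) (q : {poly R[i]}) : seq R[i] :=
  sval (closed_field_poly_normal q).

Definition crit_emp_integral (R : realType) (p : {poly R[i]}) (f : R * R -> R) : R :=
  (\sum_(z <- roots_mult p^`()) f (pair_of_cplx z)) / ((size p^`()).-1)%:R.

Definition mutually_independent d d' (T : measurableType d) (T' : measurableType d')
  (R : realType) (P : probability T R) (X : nat -> T -> T') : Prop :=
  forall (I : seq nat) (A : nat -> set T'), uniq I ->
    (forall i, i \in I -> measurable (A i)) ->
    P (\big[setI/setT]_(i <- I) (X i @^-1` A i)) =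
    (\prod_(i <- I) P (X i @^-1` A i))%E.

(* Main.v *)
(* Let [x_j] be the roots of [p] and [z_k] those of [p'].  Since [p'(u)/p(u) = L(u)], where
   [L(u) = \sum_j 1/(u - x_j)], the logarithm of [|L(u)|] is, up to [ln n], the difference of the
   logarithmic potentials of critical points and roots.  Averaging over the points [c + r y], where
   [y] runs through the [N]-th roots of some [w] close to the unit circle, replaces
   [ln |u - x|] by [ln max(r, |x - c|)] (Jensen's formula) with error [O(1/N)], except for points
   whose image is very close to [w]; a pigeonhole argument on a grid of [[1, 2]] gives a [w] for
   which these contribute little.  The bound [|L| <= e^(e n)] holds for such [w]; the bound
   [|L(u)| >= e^(- e n)] holds with high probability, uniformly in [u], by anticoncentration of a
   sum of independent variables, as soon as the support of [mu] has two points.  Hence the sums of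
   [ln max(r, |. - c|)] over critical points and over roots differ by [o(n)] in probability.

   The differences [ln max(2 r, |. - c|) - ln max(r, |. - c|)] are bumps around [c] whose sums
   over lattices of centres approximate constants, so that their combinations approximate
   every compactly supported continuous function; with the law of large numbers for the roots this
   gives vague, hence weak, convergence.  If [mu] is a Dirac mass at [a], almost surely
   [('X - a)^(n - k_n)] divides [p], and [a] is a critical point of multiplicity at least
   [n - k_n - 1]. *)

Require Import Defs.
From HB Require Import structures.
From mathcomp Require Import all_boot all_order all_algebra.
From mathcomp Require Import all_classical all_reals all_analysis.
From mathcomp.real_closed Require Import complex.
From mathcomp Require Import measurable_realfun ring lra zify.

Set Implicit Arguments.
Unset Strict Implicit.
Unset Printing Implicit Defensive.

Import Order.TTheory GRing.Theory Num.Theory numFieldNormedType.Exports.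
Local Open Scope classical_set_scope.
Local Open Scope ring_scope.

Import HBNNSimple ComplexField.Normc.

(** * Bounded measurable functions *)

(** As [mu] is arbitrary, the probability that [|L(u)|] is small is only known to tend to 0, without
    a rate. Yet the candidates [u] number about [8 n N], with [N] fixed, and the grid point finally
    used depends on the sample through the critical points, so a union bound is out of reach.
    Instead the expected number of bad candidates is bounded by linearity; Markov's inequality
    leaves less than a quarter of the grid bad, and the pigeonhole may then look at the sample
    freely. This requires anticoncentration uniform in [u], whence [u] is kept away from two fixed
    points of the support, at the cost of a small deterministic part of the grid.

    [mu] need not have a logarithmic moment, so the potential of [mu] never appears: sums over
    critical points and over roots are compared directly, and the law of large numbers is applied to
    bounded functions only. *)

Section BoundedMeasurable.
Context d (T : measurableType d) (R : realType).

(** Boundedness instead of integrability: the class is closed under products, so integrability under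
    a probability is automatic for every integrand built from it. *)
Definition bmeas (F : T -> R) : Prop :=
  measurable_fun setT F /\ exists M : R, forall w, `|F w| <= M.

Lemma bmeas_cst (a : R) : bmeas (fun=> a).
Proof. by split=> //; exists `|a|. Qed.

Lemma bmeasD (F G : T -> R) : bmeas F -> bmeas G -> bmeas (fun w => F w + G w).
Proof.
move=> [mF [M hM]] [mG [N hN]]; split; first exact: measurable_funD.
by exists (M + N) => w; rewrite (le_trans (ler_normD _ _))// lerD.
Qed.

Lemma bmeasM (F G : T -> R) : bmeas F -> bmeas G -> bmeas (fun w => F w * G w).
Proof.
move=> [mF [M hM]] [mG [N hN]]; split; first exact: measurable_funM.
by exists (M * N) => w; rewrite normrM ler_pM.
Qed.

Lemma bmeasN (F : T -> R) : bmeas F -> bmeas (fun w => - F w).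
Proof.
move=> [mF [M hM]]; split; first exact: measurableT_comp.
by exists M => w; rewrite normrN.
Qed.

Lemma bmeasB (F G : T -> R) : bmeas F -> bmeas G -> bmeas (fun w => F w - G w).
Proof. by move=> bF bG; apply: bmeasD => //; exact: bmeasN. Qed.

Lemma bmeasZ a (F : T -> R) : bmeas F -> bmeas (fun w => a * F w).
Proof. exact/bmeasM/bmeas_cst. Qed.

Lemma bmeasX k (F : T -> R) : bmeas F -> bmeas (fun w => F w ^+ k).
Proof.
move=> bF; elim: k => [|k IH].
  by under eq_fun do rewrite expr0; exact: bmeas_cst.
by under eq_fun do rewrite exprS; exact: bmeasM.
Qed.

Lemma bmeas_sum (I : Type) (r : seq I) (Q : pred I) (F : I -> T -> R) :
  (forall i, bmeas (F i)) -> bmeas (fun w => \sum_(i <- r | Q i) F i w).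
Proof.
move=> bF; elim: r => [|i r IH].
  by under eq_fun do rewrite big_nil; exact: bmeas_cst.
under eq_fun do rewrite big_cons.
by case: (Q i) => //; exact: bmeasD.
Qed.

Lemma bmeas_prod (I : Type) (r : seq I) (F : I -> T -> R) :
  (forall i, bmeas (F i)) -> bmeas (fun w => \prod_(i <- r) F i w).
Proof.
move=> bF; elim: r => [|i r IH].
  by under eq_fun do rewrite big_nil; exact: bmeas_cst.
by under eq_fun do rewrite big_cons; exact: bmeasM.
Qed.

Lemma bmeas_indic (A : set T) : measurable A -> bmeas (\1_A : T -> R).
Proof.
move=> mA; split; first exact: measurable_indic.
by exists 1 => w; rewrite indicE; case: (_ \in _); rewrite ?normr1 ?normr0 ?ler01.
Qed.

Lemma bmeas_cos (F : T -> R) : measurable_fun setT F ->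
  bmeas (fun w => cos (F w)).
Proof.
move=> mF; split; first exact: measurableT_comp (continuous_measurable_fun (@continuous_cos R)) mF.
by exists 1 => w; rewrite ler_norml cos_geN1 cos_le1.
Qed.

Lemma bmeas_sin (F : T -> R) : measurable_fun setT F ->
  bmeas (fun w => sin (F w)).
Proof.
move=> mF; split; first exact: measurableT_comp (continuous_measurable_fun (@continuous_sin R)) mF.
by exists 1 => w; rewrite ler_norml sin_geN1 sin_le1.
Qed.

End BoundedMeasurable.

Lemma bmeas_comp d d' (T : measurableType d) (T' : measurableType d')
  (R : realType) (g : T' -> R) (X : T -> T') :
  bmeas g -> measurable_fun setT X -> bmeas (fun w => g (X w)).
Proof.
move=> [mg [M hM]] mX; split; first exact: measurableT_comp mg mX.
by exists M => w.
Qed.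

Lemma measurable_set_ler d (T : measurableType d) (R : realType) (F G : T -> R) :
  measurable_fun setT F -> measurable_fun setT G ->
  measurable [set w | F w <= G w].
Proof.
move=> mF mG; have := measurable_fun_ler mF mG measurableT (Y := [set true]) I.
by rewrite setTI.
Qed.

Section BoundedExpectation.
Context d (T : measurableType d) (R : realType) (P : probability T R).
Notation bm := (@bmeas _ T R).
Local Notation "''Ex' F" := (Rintegral P setT F) (at level 10, F at level 8).

Lemma bmeas_integrable (F : T -> R) : bm F -> P.-integrable setT (EFin \o F).
Proof.
move=> [mF [M hM]]; apply: (@le_integrable _ _ _ P _ _ _ (cst M%:E)) => //.
- exact/measurable_EFinP.
- move=> w _ /=; rewrite lee_fin (le_trans (hM w))// ler_norm //.
- exact: finite_measure_integrable_cst.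
Qed.

Lemma Ex_cst (a : R) : 'Ex (fun=> a) = a.
Proof.
rewrite Rintegral_cst// -[RHS]mulr1; congr (_ * _).
by transitivity (fine (1%E : \bar R)) => //; congr fine; exact: probability_setT.
Qed.

Lemma ExD (F G : T -> R) : bm F -> bm G ->
  'Ex (fun w => F w + G w) = 'Ex F + 'Ex G.
Proof. by move=> bF bG; rewrite RintegralD//; exact: bmeas_integrable. Qed.

Lemma ExB (F G : T -> R) : bm F -> bm G ->
  'Ex (fun w => F w - G w) = 'Ex F - 'Ex G.
Proof. by move=> bF bG; rewrite RintegralB//; exact: bmeas_integrable. Qed.

Lemma ExZ a (F : T -> R) : bm F -> 'Ex (fun w => a * F w) = a * 'Ex F.
Proof. by move=> bF; rewrite RintegralZl//; exact: bmeas_integrable. Qed.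

Lemma Ex_le (F G : T -> R) : bm F -> bm G -> (forall w, F w <= G w) ->
  'Ex F <= 'Ex G.
Proof. by move=> bF bG FG; apply: le_Rintegral => //; exact: bmeas_integrable. Qed.

Lemma Ex_sum (I : Type) (r : seq I) (Q : pred I) (F : I -> T -> R) :
  (forall i, bm (F i)) ->
  'Ex (fun w => \sum_(i <- r | Q i) F i w) = \sum_(i <- r | Q i) 'Ex (F i).
Proof.
move=> bF; elim: r => [|i r IH].
  by under eq_Rintegral do rewrite big_nil; rewrite Ex_cst big_nil.
under eq_Rintegral do rewrite big_cons.
rewrite big_cons; case: (Q i) => //.
by rewrite ExD ?IH//; exact: bmeas_sum.
Qed.

Lemma Ex_indic (A : set T) : measurable A -> 'Ex (\1_A) = fine (P A).
Proof. by move=> mA; rewrite /Rintegral integral_indic// setIT. Qed.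

Lemma Ex_cvg (F_ : nat -> T -> R) (F : T -> R) (M : R) :
  (forall k, measurable_fun setT (F_ k)) -> (forall k w, `|F_ k w| <= M) ->
  (forall w, F_ ^~ w @ \oo --> F w) ->
  'Ex (F_ k) @[k --> \oo] --> 'Ex F.
Proof.
move=> mF hM cF.
have mFl : measurable_fun setT F.
  by apply: (measurable_fun_cvg (h := F_)) => // w _; exact: cF.
have [|||||bF _] := @dominated_convergence _ T R P setT measurableT
    (fun k => EFin \o F_ k) (EFin \o F) (cst M%:E).
- by move=> k; exact/measurable_EFinP.
- exact/measurable_EFinP.
- by apply: aeW => w _ /=; apply: cvg_EFin; [exact: nearW|exact: cF].
- exact: finite_measure_integrable_cst.
- by apply: aeW => w k _ /=; rewrite lee_fin.
move=> cI; apply: fine_cvg; rewrite fineK; last first.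
  exact: integrable_fin_num.
exact: cI.
Qed.

End BoundedExpectation.

(** * Independence *)

Section Independence.
Context d (T : measurableType d) (R : realType) (P : probability T R).
Context d' (T' : measurableType d').
Variable X : nat -> T -> T'.
Hypothesis mX : forall i, measurable_fun setT (X i).
Hypothesis indepX : mutually_independent P X.
Notation bm := (@bmeas _ T R).
Notation bm' := (@bmeas _ T' R).
Local Notation "''Ex' F" := (Rintegral P setT F) (at level 10, F at level 8).

(** Independence from the variables of index at least [m], tested on products of indicators only.
    The condition is linear in [F] and stable under bounded pointwise limits, so the sigma-algebra
    generated by the earlier variables is never formed. *)
Definition indep_from (m : nat) (F : T -> R) : Prop :=
  bm F /\ forall (I : seq nat) (A : nat -> set T'), uniq I ->
    (forall i, i \in I -> (m <= i)%N) -> (forall i, measurable (A i)) ->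
    'Ex (fun w => F w * \prod_(i <- I) \1_(A i) (X i w)) =
    'Ex F * \prod_(i <- I) fine (P (X i @^-1` A i)).

Let bm_indX i A : measurable A -> bm (fun w => \1_A (X i w)).
Proof. by move=> mA; apply: (bmeas_comp (g := \1_A)) => //; exact: bmeas_indic. Qed.

Let bm_prod I (A : nat -> set T') : (forall i, measurable (A i)) ->
  bm (fun w => \prod_(i <- I) \1_(A i) (X i w)).
Proof. by move=> mA; apply: bmeas_prod => i; exact: bm_indX. Qed.

(** Mutual independence is consumed here; the other closure properties merely propagate it. *)
Lemma indep_from_cst m a : indep_from m (fun=> a).
Proof.
split; first exact: bmeas_cst.
move=> I A uI _ mA; rewrite ExZ ?Ex_cst; last exact: bm_prod.
congr (_ * _).
have mB : measurable (\big[setI/setT]_(i <- I) (X i @^-1` A i)).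
  by apply: bigsetI_measurable => i _; rewrite -[X in measurable X]setTI; exact: mX.
transitivity ('Ex (\1_(\big[setI/setT]_(i <- I) (X i @^-1` A i)))).
  apply: eq_Rintegral => w _; elim: I {uI mB} => [|i I IH].
    by rewrite !big_nil in_setT.
  by rewrite !big_cons IH in_setI -mulnb natrM.
rewrite Ex_indic// indepX//.
elim: I {uI mB} => [|i I IH]; first by rewrite !big_nil.
have fP j : P (X j @^-1` A j) \is a fin_num.
  by apply: fin_num_measure; rewrite -[X in measurable X]setTI; exact: mX.
rewrite !big_cons fineM// ?IH//.
by elim: I {IH} => [|j I IH]; rewrite ?big_nil// big_cons fin_numM.
Qed.

Lemma indep_fromW m F : indep_from m F -> indep_from m.+1 F.
Proof.
by move=> [bF hF]; split=> // I A uI hI mA; apply: hF => // i /hI /ltnW.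
Qed.

Lemma indep_fromD m F G : indep_from m F -> indep_from m G ->
  indep_from m (fun w => F w + G w).
Proof.
move=> [bF hF] [bG hG]; split; first exact: bmeasD.
move=> I A uI hI mA; under eq_Rintegral do rewrite mulrDl.
have bp := bm_prod I mA.
by rewrite !ExD ?hF ?hG ?mulrDl//; apply: bmeasM.
Qed.

Lemma indep_fromZ m a F : indep_from m F -> indep_from m (fun w => a * F w).
Proof.
move=> [bF hF]; split; first exact: bmeasZ.
move=> I A uI hI mA; under eq_Rintegral do rewrite -mulrA.
have bp := bm_prod I mA.
by rewrite !ExZ ?hF ?mulrA//; apply: bmeasM.
Qed.

Lemma indep_from_sum m (I : Type) (r : seq I) (F : I -> T -> R) :
  (forall i, indep_from m (F i)) ->
  indep_from m (fun w => \sum_(i <- r) F i w).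
Proof.
move=> hF; elim: r => [|i r IH].
  by under eq_fun do rewrite big_nil; exact: indep_from_cst.
by under eq_fun do rewrite big_cons; exact: indep_fromD.
Qed.

Lemma indep_from_cvg m (F_ : nat -> T -> R) F M :
  (forall k, indep_from m (F_ k)) -> (forall k w, `|F_ k w| <= M) ->
  (forall w, F_ ^~ w @ \oo --> F w) -> indep_from m F.
Proof.
move=> hF hM cF.
have mF : measurable_fun setT F.
  by apply: (measurable_fun_cvg (h := F_)) => [k|w _]; [case: (hF k) => -[]|exact: cF].
have bF : bm F.
  split=> //; exists M => w; have /cvg_norm cn := cF w.
  have <- := cvg_lim (@Rhausdorff R) cn.
  apply: limr_le; first by apply/cvg_ex; eexists; exact: cn.
  by apply: nearW => k; exact: hM.
split=> // I A uI hI mA.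
have [mp [N hN]] := bm_prod I mA.
have cL : 'Ex (F_ k) @[k --> \oo] --> 'Ex F.
  by apply: (Ex_cvg (M := M)) => // k; case: (hF k) => -[].
have cR : 'Ex (fun w => F_ k w * \prod_(i <- I) \1_(A i) (X i w)) @[k --> \oo]
    --> 'Ex (fun w => F w * \prod_(i <- I) \1_(A i) (X i w)).
  apply: (Ex_cvg (M := M * N)) => [k|k w|w].
  - by apply: measurable_funM => //; case: (hF k) => -[].
  - by rewrite normrM ler_pM.
  - by apply: cvgMr_tmp; exact: cF.
have cR' : 'Ex (fun w => F_ k w * \prod_(i <- I) \1_(A i) (X i w)) @[k --> \oo]
    --> 'Ex F * \prod_(i <- I) fine (P (X i @^-1` A i)).
  have -> : (fun k => 'Ex (fun w => F_ k w * \prod_(i <- I) \1_(A i) (X i w)))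
     = (fun k => 'Ex (F_ k) * \prod_(i <- I) fine (P (X i @^-1` A i))).
    by apply/funext => k; case: (hF k) => _; apply.
  by apply: cvgMr_tmp.
by rewrite -(cvg_lim (@Rhausdorff R) cR) -(cvg_lim (@Rhausdorff R) cR').
Qed.

(** The family [m :: I], with [A] placed at index [m], is again an admissible test family for [F],
    so the factor of index [m] can be moved into [F]. *)
Let indep_from_indic m F A : measurable A -> indep_from m F ->
  indep_from m.+1 (fun w => F w * \1_A (X m w)) /\
  'Ex (fun w => F w * \1_A (X m w)) = 'Ex F * fine (P (X m @^-1` A)).
Proof.
move=> mA [bF hF].
have e1 : 'Ex (fun w => F w * \1_A (X m w)) = 'Ex F * fine (P (X m @^-1` A)).
  have := hF [:: m] (fun=> A) isT.
  rewrite big_seq1 => <- //; last by move=> i; rewrite inE => /eqP->.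
  by apply: eq_Rintegral => w _; rewrite big_seq1.
split=> //; split; first by apply: bmeasM => //; exact: bm_indX.
move=> I B uI hI mB.
have := hF (m :: I) (fun i => if i == m then A else B i).
have mI : m \notin I by apply/negP => /hI; rewrite ltnn.
have e (U : Type) (f : nat -> set T' -> R) : \prod_(i <- m :: I) f i (if i == m then A else B i) =
    f m A * \prod_(i <- I) f i (B i).
  rewrite big_cons eqxx; congr (_ * _); apply: eq_big_seq => i iI.
  by rewrite (negbTE (memPn mI i iI)).
under eq_Rintegral do rewrite (e T (fun i A => \1_A (X i _))).
rewrite (e T (fun i A => fine (P (X i @^-1` A)))) mulrA -e1 => <-.
- by apply: eq_Rintegral => w _; rewrite mulrA.
- by rewrite /= mI.
- by move=> i; rewrite inE => /predU1P[->//|/hI /ltnW].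
- by move=> i; case: eqP.
Qed.


(** Indicators give simple functions by linearity, simple functions give bounded nonnegative ones by
    dominated convergence, and adding the bound [M] reduces the general case to those. Iteration
    builds functions of the first [m] variables while expectations factor. *)
Lemma indep_from_mul m F (g : T' -> R) : bm' g -> indep_from m F ->
  indep_from m.+1 (fun w => F w * g (X m w)) /\
  'Ex (fun w => F w * g (X m w)) = 'Ex F * 'Ex (fun w => g (X m w)).
Proof.
move=> bg hF; have [bF _] := hF.
suff H h : bm' h -> (forall x, 0 <= h x) ->
    indep_from m.+1 (fun w => F w * h (X m w)) /\
    'Ex (fun w => F w * h (X m w)) = 'Ex F * 'Ex (fun w => h (X m w)).
  have [mg [M hM]] := bg.
  have bgM : bm' (fun x => g x + M) by apply: bmeasD => //; exact: bmeas_cst.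
  have [|i e] := H _ bgM.
    by move=> x; have := hM x; rewrite ler_norml => /andP[]; lra.
  have bgX : bm (fun w => g (X m w)) by exact: bmeas_comp.
  have eF : (fun w => F w * g (X m w)) =
      (fun w => F w * (g (X m w) + M) + (- M) * F w).
    by apply/funext => w; ring.
  have bFg : bm (fun w => F w * (g (X m w) + M)) by case: i.
  split; rewrite eF.
    by apply: indep_fromD => //; apply: indep_fromZ; exact: indep_fromW.
  rewrite ExD ?e ?ExZ ?ExD ?Ex_cst//; [by ring|exact: bmeas_cst|exact: bmeasZ].
move=> [mh [M hM]] h0.
have mh' : measurable_fun setT (EFin \o h) by exact/measurable_EFinP.
pose h_ := nnsfun_approx measurableT mh'.
have h_le k x : 0 <= h_ k x <= h x.
  apply/andP; split; first exact: fun_ge0.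
  rewrite -lee_fin nnsfun_approxE.
  by apply: (le_approx (f := EFin \o h)) => // y _ /=; rewrite lee_fin.
have h_cvg x : h_ ^~ x @ \oo --> h x.
  under eq_fun do rewrite nnsfun_approxE.
  apply: (cvg_approx (f := EFin \o h)) => //; last by rewrite /= ltry.
  by move=> y _ /=; rewrite lee_fin.
have hk k : indep_from m.+1 (fun w => F w * h_ k (X m w)) /\
    'Ex (fun w => F w * h_ k (X m w)) = 'Ex F * 'Ex (fun w => h_ k (X m w)).
  have mA y : measurable (h_ k @^-1` [set y]) by [].
  have [s e] : exists s : seq R, forall w,
      h_ k (X m w) = \sum_(y <- s) (y * \1_(h_ k @^-1` [set y]) (X m w)).
    by eexists => w; rewrite fimfunE fsbig_finite.
  have eF : (fun w => F w * h_ k (X m w)) =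
     (fun w => \sum_(y <- s) (y * (F w * \1_(h_ k @^-1` [set y]) (X m w)))).
    apply/funext => w; rewrite e mulr_sumr; apply: eq_bigr => y _; ring.
  have ii y := indep_from_indic (mA y) hF.
  split; rewrite eF.
    by apply: indep_from_sum => i; apply: indep_fromZ; case: (ii i).
  under [X in _ = _ * X]eq_Rintegral do rewrite e.
  rewrite !Ex_sum; first last.
  - by move=> i; apply: bmeasZ; case: (ii i) => -[].
  - by move=> i; apply: bmeasZ; exact: bm_indX.
  rewrite mulr_sumr; apply: eq_bigr => i _.
  rewrite !ExZ; first last.
  - by case: (ii i) => -[].
  - exact: bm_indX.
  case: (ii i) => _ ->; rewrite mulrCA; congr (_ * (_ * _)).
  rewrite -Ex_indic; last by rewrite -[X in measurable X]setTI; exact: mX.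
  by apply: eq_Rintegral.
have [mF [N hN]] := bF.
have h_nrm k x : `|h_ k x| <= M.
  case/andP: (h_le k x) => a b; rewrite (ger0_norm a) (le_trans b)//.
  by rewrite -(ger0_norm (h0 x)).
have hk_bd k w : `|F w * h_ k (X m w)| <= N * M.
  by rewrite normrM ler_pM.
split.
  apply: (indep_from_cvg (F_ := fun k w => F w * h_ k (X m w)) (M := N * M)); [by move=> k; case: (hk k)|exact: hk_bd|].
  by move=> w; apply: cvgMl_tmp; exact: h_cvg.
have c1 : 'Ex (fun w => F w * h_ k (X m w)) @[k --> \oo] --> 'Ex (fun w => F w * h (X m w)).
  apply: (Ex_cvg (M := N * M)) => // [k|w].
    by case: (hk k) => -[[]].
  by apply: cvgMl_tmp; exact: h_cvg.
have c2 : 'Ex (fun w => F w * h_ k (X m w)) @[k --> \oo] --> 'Ex F * 'Ex (fun w => h (X m w)).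
  have -> : (fun k => 'Ex (fun w => F w * h_ k (X m w))) =
     (fun k => 'Ex F * 'Ex (fun w => h_ k (X m w))).
    by apply/funext => k; case: (hk k).
  apply: cvgMl_tmp; apply: (Ex_cvg (M := M)) => [k|k w|w].
  - exact: measurableT_comp.
  - exact: h_nrm.
  - exact: h_cvg.
by rewrite -(cvg_lim (@Rhausdorff R) c1) -(cvg_lim (@Rhausdorff R) c2).
Qed.

End Independence.

Lemma Ex_markov d (T : measurableType d) (R : realType) (P : probability T R)
    (F : T -> R) (a : R) : bmeas F -> (forall w, 0 <= F w) -> 0 < a ->
  (P [set w | (a <= F w)%R] <= (Rintegral P setT F / a)%:E)%E.
Proof.
move=> bF F0 a0.
have mA : measurable [set w | a <= F w].
  rewrite -[X in measurable X]setTI; have [mF _] := bF.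
  have -> : [set w | a <= F w] = F @^-1` [set` `[a, +oo[ ].
    by apply/seteqP; split => w /=; rewrite in_itv /= andbT.
  exact: mF.
have fP : P [set w | a <= F w] \is a fin_num by exact: fin_num_measure.
rewrite -(fineK fP) lee_fin ler_pdivlMr// mulrC -(Ex_indic P mA) -ExZ; last exact: bmeas_indic.
apply: Ex_le => // [|w]; first by apply: bmeasZ; exact: bmeas_indic.
rewrite indicE; have [|_] := boolP (w \in _); last by rewrite mulr0.
by rewrite inE /= mulr1.
Qed.

(** * A weak law of large numbers *)

Section LawOfLargeNumbers.
Context d (T : measurableType d) (R : realType) (P : probability T R).
Context d' (T' : measurableType d') (mu : probability T' R).
Variable X : nat -> T -> T'.
Hypothesis mX : forall i, measurable_fun setT (X i).
Hypothesis distX : forall i A, measurable A -> P (X i @^-1` A) = mu A.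
Hypothesis indepX : mutually_independent P X.
Notation bm' := (@bmeas _ T' R).

Lemma Ex_dist i (g : T' -> R) : bm' g ->
  Rintegral P setT (fun w => g (X i w)) = Rintegral mu setT g.
Proof.
move=> bg; rewrite /Rintegral; congr fine.
have bgX : bmeas (fun w => g (X i w)) by exact: bmeas_comp.
transitivity (\int[pushforward P (X i)]_y (g y)%:E)%E.
  rewrite integral_pushforward//; first by apply/measurable_EFinP; case: bg.
  exact: bmeas_integrable.
by apply: eq_measure_integral => A mA _; exact: distX.
Qed.

(** Chebyshev's inequality. The variance is additive because in [S m.+1 ^+ 2] the cross term factors
    and the centred variable has mean 0. *)
Lemma sum_deviation (g : T' -> R) : bm' g -> exists2 K : R, 0 <= K &
  forall m a, 0 < a ->
  (P [set w | (a <= `|\sum_(j < m) g (X j w) - m%:R * Rintegral mu setT g|)%R]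
    <= (K * m%:R / a ^+ 2)%:E)%E.
Proof.
move=> bg; set c := Rintegral mu setT g.
have bh : bm' (fun x => g x - c) by apply: bmeasB => //; exact: bmeas_cst.
have [mh [B hB]] := bh.
have Eh : Rintegral mu setT (fun x => g x - c) = 0.
  by rewrite ExB ?Ex_cst ?subrr//; exact: bmeas_cst.
pose S m w := \sum_(j < m) (g (X j w) - c).
have iS m : indep_from P X m (S m).
  elim: m => [|m IH].
    rewrite /S; under eq_fun do rewrite big_ord0; exact: indep_from_cst.
  rewrite /S; under eq_fun do rewrite big_ord_recr /=.
  apply: indep_fromD => //; first exact: indep_fromW.
  have [+ _] := indep_from_mul mX indepX bh (indep_from_cst mX indepX m 1).
  by under eq_fun do rewrite mul1r.
have bS m : bmeas (S m) by case: (iS m).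
have ES m : Rintegral P setT (fun w => S m w ^+ 2) <= B ^+ 2 * m%:R.
  elim: m => [|m IH].
    rewrite mulr0 /S; under eq_Rintegral do rewrite big_ord0 expr0n /=.
    by rewrite Ex_cst.
  have -> : (fun w => S m.+1 w ^+ 2) =
     (fun w => S m w ^+ 2 + (2 * (S m w * (g (X m w) - c)) + (g (X m w) - c) ^+ 2)).
    by apply/funext => w; rewrite /S big_ord_recr /=; ring.
  have b1 : bmeas (fun w => g (X m w) - c) by exact: (bmeas_comp bh).
  have b2 : bmeas (fun w => S m w * (g (X m w) - c)) by exact: bmeasM.
  rewrite ExD; [|exact: bmeasX|by apply: bmeasD; [exact: bmeasZ|exact: bmeasX]].
  rewrite ExD; [|exact: bmeasZ|exact: bmeasX].
  rewrite ExZ//.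
  have [_ ->] := indep_from_mul mX indepX bh (iS m).
  rewrite (Ex_dist m bh) Eh !mulr0 add0r -natr1 mulrDr mulr1 lerD//.
  rewrite -[leRHS](Ex_cst P).
  apply: Ex_le => //; [exact: bmeasX|exact: bmeas_cst|] => w.
  rewrite -[leLHS]real_normK ?num_real// lerXn2r// ?nnegrE//.
  exact: le_trans (hB (X m w)).
exists (B ^+ 2); first exact: sqr_ge0.
move=> m a a0.
have -> : [set w | a <= `|\sum_(j < m) g (X j w) - m%:R * c|] =
   [set w | a ^+ 2 <= S m w ^+ 2].
  apply/seteqP; split => w /=; rewrite /S sumrB sumr_const card_ord -[c *+ m]mulr_natl.
    by move=> h; rewrite -[leRHS]real_normK ?num_real//; rewrite lerXn2r ?nnegrE ?(ltW a0)//; exact: h.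
  by move=> h; rewrite -(@ler_pXn2r _ 2) ?nnegrE ?(ltW a0)// real_normK// num_real.
apply: (le_trans (Ex_markov P (bmeasX 2 (bS m)) (fun w => sqr_ge0 _) _)).
  exact: exprn_gt0.
by rewrite lee_fin ler_wpM2r// invr_ge0 sqr_ge0.
Qed.

End LawOfLargeNumbers.

(** * Anticoncentration *)

Section CharacteristicFunction.
Context d (T : measurableType d) (R : realType) (P : probability T R).
Context d' (T' : measurableType d') (mu : probability T' R).
Variable X : nat -> T -> T'.
Hypothesis mX : forall i, measurable_fun setT (X i).
Hypothesis distX : forall i A, measurable A -> P (X i @^-1` A) = mu A.
Hypothesis indepX : mutually_independent P X.
Notation bm' := (@bmeas _ T' R).
Local Notation "''Ex' F" := (Rintegral P setT F) (at level 10, F at level 8).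
Local Notation "''Em' F" := (Rintegral mu setT F) (at level 10, F at level 8).

(** Multiplicativity of [|E exp(i U)|^2], written with cosine and sine. The shift [c] disappears
    from the modulus; it will carry the deterministic zeros. *)
Lemma char_sum_sq (V : T' -> R) (c : R) m : measurable_fun setT V ->
  ('Ex (fun w => cos (c + \sum_(j < m) V (X j w)))) ^+ 2 +
  ('Ex (fun w => sin (c + \sum_(j < m) V (X j w)))) ^+ 2 =
  ((('Em (fun x => cos (V x))) ^+ 2) + ('Em (fun x => sin (V x))) ^+ 2) ^+ m.
Proof.
move=> mV.
have bC := bmeas_cos mV; have bS := bmeas_sin mV.
have IM m0 F g := @indep_from_mul _ _ _ P _ _ X mX indepX m0 F g.
suff [_ [_ ->]] : indep_from P X m (fun w => cos (c + \sum_(j < m) V (X j w))) /\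
  indep_from P X m (fun w => sin (c + \sum_(j < m) V (X j w))) /\
  ('Ex (fun w => cos (c + \sum_(j < m) V (X j w)))) ^+ 2 +
  ('Ex (fun w => sin (c + \sum_(j < m) V (X j w)))) ^+ 2 =
  ((('Em (fun x => cos (V x))) ^+ 2) + ('Em (fun x => sin (V x))) ^+ 2) ^+ m by [].
elim: m => [|m [iC [iS IH]]].
  have -> : (fun w => cos (c + \sum_(j < 0) V (X j w))) = (fun=> cos c).
    by apply/funext => w; rewrite big_ord0 addr0.
  have -> : (fun w => sin (c + \sum_(j < 0) V (X j w))) = (fun=> sin c).
    by apply/funext => w; rewrite big_ord0 addr0.
  split; first exact: indep_from_cst.
  split; first exact: indep_from_cst.
  by rewrite !Ex_cst cos2Dsin2.
have [iCC eCC] := IM m _ _ bC iC.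
have [iCS eCS] := IM m _ _ bS iC.
have [iSC eSC] := IM m _ _ bC iS.
have [iSS eSS] := IM m _ _ bS iS.
have -> : (fun w => cos (c + \sum_(j < m.+1) V (X j w))) =
   (fun w => cos (c + \sum_(j < m) V (X j w)) * cos (V (X m w)) +
      (-1) * (sin (c + \sum_(j < m) V (X j w)) * sin (V (X m w)))).
  by apply/funext => w; rewrite big_ord_recr /= addrA [LHS]cosD; ring.
have -> : (fun w => sin (c + \sum_(j < m.+1) V (X j w))) =
   (fun w => sin (c + \sum_(j < m) V (X j w)) * cos (V (X m w)) +
      cos (c + \sum_(j < m) V (X j w)) * sin (V (X m w))).
  by apply/funext => w; rewrite big_ord_recr /= addrA [LHS]sinD; ring.
split; first exact: (indep_fromD mX iCC (indep_fromZ mX (-1) iSS)).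
split; first exact: (indep_fromD mX iSC iCS).
rewrite !ExD ?ExZ ?eCC ?eCS ?eSC ?eSS;
  try by [case: iSS | case: iCC | case: iSC | case: iCS | apply: bmeasZ; case: iSS].
rewrite !(Ex_dist mX distX m bC) !(Ex_dist mX distX m bS).
by rewrite [RHS]exprSr -IH; ring.
Qed.

Lemma sum_cos_sq (I : finType) (th : I -> R) :
  (\sum_i cos (th i)) ^+ 2 + (\sum_i sin (th i)) ^+ 2 =
  \sum_i \sum_j cos (th i - th j).
Proof.
rewrite !expr2 !big_distrlr /= -big_split /=; apply: eq_bigr => i _.
by rewrite -big_split /=; apply: eq_bigr => j _; rewrite cosB.
Qed.

Lemma cos_ge_cos (x y : R) : `|x| <= y -> y <= 1 -> cos y <= cos x.
Proof.
move=> xy y1; rewrite -(cos_norm x).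
have p2 := pi_ge2 R.
have x0 := normr_ge0 x.
move: xy; rewrite le_eqVlt => /predU1P[->//|xy]; apply: ltW.
by rewrite ltr_cos// in_itv /=; apply/andP; split; lra.
Qed.

(* Average over an arithmetic progression of frequencies: on [|U| <= t] the squared modulus
   of [\sum_(j < J) exp (i j s U)] is of order [J ^ 2], whereas in mean it is of order [J]. *)
Lemma small_ball_char (V : T' -> R) (J : nat) (s t q c : R) m :
  measurable_fun setT V -> (0 < J)%N -> 0 < s -> 0 <= t -> 0 <= q -> J%:R * s * t <= 1 ->
  (forall a, s <= `|a| -> `|a| <= J%:R * s ->
    ('Em (fun x => cos (a * V x))) ^+ 2 + ('Em (fun x => sin (a * V x))) ^+ 2 <= q ^+ 2) ->
  (P [set w | (`|c + \sum_(j < m) V (X j w)| <= t)%R] <=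
    ((J%:R^-1 + q ^+ m) / cos 1 ^+ 2)%:E)%E.
Proof.
move=> mV J0 s0 t0 q0 Jst hq.
set U := fun w => c + \sum_(j < m) V (X j w).
have mU : measurable_fun setT U.
  apply: measurable_funD => //; apply: measurable_sum => j.
  exact: measurableT_comp mV (mX j).
have mZU a : measurable_fun setT (fun w => a * U w) by exact: measurable_funM.
pose g w := (\sum_(j < J) cos ((j%:R * s) * U w)) ^+ 2 + (\sum_(j < J) sin ((j%:R * s) * U w)) ^+ 2.
have gE : g = fun w => \sum_(j < J) \sum_(k < J) cos (((j%:R - k%:R) * s) * U w).
  apply/funext => w; rewrite /g sum_cos_sq; apply: eq_bigr => j _; apply: eq_bigr => k _.
  by congr cos; ring.
have bg : bmeas g.
  rewrite gE; apply: bmeas_sum => j; apply: bmeas_sum => k; exact: bmeas_cos.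
have g0 w : 0 <= g w by rewrite addr_ge0 ?sqr_ge0.
have cos1 := @cos1_gt0 R.
have J0' : 0 < J%:R :> R by rewrite ltr0n.
(* The diagonal contributes [J]; off the diagonal the frequency [(j - k) s] has modulus between [s]
   and [J s], where the characteristic function of the sum is at most [q ^ m]. *)
have Eg : 'Ex g <= J%:R + J%:R ^+ 2 * q ^+ m.
  rewrite gE Ex_sum; last by move=> j; apply: bmeas_sum => k; exact: bmeas_cos.
  apply: (@le_trans _ _ (\sum_(j < J) (1 + J%:R * q ^+ m))); last first.
    by rewrite sumr_const card_ord -[leLHS]mulr_natl mulrDr mulr1 expr2 !mulrA.
  apply: ler_sum => j _; rewrite Ex_sum; last by move=> k; exact: bmeas_cos.
  rewrite (bigD1 j)//= lerD//.
    rewrite subrr mul0r; under eq_Rintegral do rewrite mul0r cos0.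
    by rewrite Ex_cst.
  apply: (@le_trans _ _ (\sum_(k < J | k != j) q ^+ m)); last first.
    rewrite sumr_const -[leLHS]mulr_natl ler_wpM2r ?exprn_ge0// ler_nat.
    by rewrite (leq_trans (max_card _))// card_ord.
  apply: ler_sum => k kj; set a := (_ * s).
  have eU : (fun w => cos (a * U w)) = (fun w => cos (a * c + \sum_(j < m) (a * V (X j w)))).
    by apply/funext => w; rewrite /U mulrDr mulr_sumr.
  have := char_sum_sq (a * c) m (measurable_funM (measurable_cst a) mV).
  have [jk1 jk2] : 1 <= `|j%:R - k%:R : R| /\ `|j%:R - k%:R : R| <= J%:R.
    have hj := ltn_ord j; have hk := ltn_ord k.
    have jk : (j != k :> nat) by rewrite eq_sym.
    case: ltngtP jk => // jk _.
      rewrite distrC -natrB ?(ltnW jk)// normr_nat ler1n ler_nat subn_gt0 jk.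
      by split=> //; rewrite (leq_trans (leq_subr _ _))// ltnW.
    rewrite -natrB ?(ltnW jk)// normr_nat ler1n ler_nat subn_gt0 jk.
    by split=> //; rewrite (leq_trans (leq_subr _ _))// ltnW.
  have aE : `|a| = `|j%:R - k%:R| * s by rewrite /a normrM (gtr0_norm s0).
  have := hq a; rewrite aE ler_peMl ?(ltW s0)//.
  rewrite ler_pM2r// jk2 => /(_ isT isT) h2 e1.
  rewrite eU; set EC := 'Ex _ in e1 *; apply: (le_trans (ler_norm _)).
  rewrite -(@ler_pXn2r _ 2) ?nnegrE ?exprn_ge0// real_normK ?num_real//.
  rewrite -exprM mulnC exprM.
  apply: (@le_trans _ _ (EC ^+ 2 + ('Ex (fun w => sin (a * c + \sum_(j < m) (a * V (X j w))))) ^+ 2)).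
    by rewrite lerDl sqr_ge0.
  rewrite e1 lerXn2r ?nnegrE ?sqr_ge0//.
  by rewrite addr_ge0 ?sqr_ge0.
(* On this event every phase [j s U] lies in [[-1, 1]], so each cosine is at least [cos 1]. *)
have sub : [set w | `|U w| <= t] `<=` [set w | (J%:R * cos 1) ^+ 2 <= g w].
  move=> w /= Ut; rewrite /g.
  have cos_ge (j : 'I_J) : cos 1 <= cos ((j%:R * s) * U w).
    apply: cos_ge_cos => //; apply: le_trans Jst.
    rewrite normrM ler_pM ?normr_ge0// ger0_norm; last by rewrite mulr_ge0 ?(ltW s0).
    by rewrite ler_pM2r// ler_nat ltnW.
  have le_sum : J%:R * cos 1 <= \sum_(j < J) cos ((j%:R * s) * U w).
    rewrite mulr_natl -[X in _ *+ X](card_ord J) -sumr_const.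
    by apply: ler_sum.
  apply: (@le_trans _ _ ((\sum_(j < J) cos ((j%:R * s) * U w)) ^+ 2)); last by rewrite lerDl sqr_ge0.
  have h0 : 0 <= J%:R * cos (1 : R) by rewrite mulr_ge0// ltW.
  by rewrite lerXn2r ?nnegrE// (le_trans h0).
have mS : measurable [set w | `|U w| <= t].
  by apply: measurable_set_ler => //; exact: measurableT_comp.
have mS' : measurable [set w | (J%:R * cos 1) ^+ 2 <= g w].
  by apply: measurable_set_ler => //; case: bg.
apply: (@le_trans _ _ (P [set w | ((J%:R * cos 1) ^+ 2 <= g w)%R])).
  by apply: le_measure; rewrite ?inE.
apply: (le_trans (Ex_markov P bg g0 _)).
  by rewrite exprn_gt0// mulr_gt0.
rewrite lee_fin ler_pdivrMr ?exprn_gt0 ?mulr_gt0//.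
apply: (le_trans Eg).
rewrite le_eqVlt; apply/orP; left; apply/eqP; field.
by rewrite !gt_eqF.
Qed.

End CharacteristicFunction.

Section AntiConcentration.
Context d (T : measurableType d) (R : realType) (P : probability T R).
Context d' (T' : measurableType d') (mu : probability T' R).
Variable X : nat -> T -> T'.
Hypothesis mX : forall i, measurable_fun setT (X i).
Hypothesis distX : forall i A, measurable A -> P (X i @^-1` A) = mu A.
Hypothesis indepX : mutually_independent P X.
Local Notation "''Em' F" := (Rintegral mu setT F) (at level 10, F at level 8).

(* [1 - |E e^(iaV)|^2] is the variance of [e^(iaV)], and the values of [e^(iaV)] on [A] and
   on [B] cannot both be close to its mean. *)
Lemma char_sq_le (V : T' -> R) (A B : set T') (al s k1 k2 a : R) :
  measurable_fun setT V -> measurable A -> measurable B ->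
  (al%:E <= mu A)%E -> (al%:E <= mu B)%E -> 0 <= al -> 0 < s -> 0 < k1 ->
  (forall x y, A x -> B y -> k1 <= V x - V y <= k2) ->
  s <= `|a| -> `|a| * k2 <= 1 ->
  ('Em (fun x => cos (a * V x))) ^+ 2 + ('Em (fun x => sin (a * V x))) ^+ 2
    <= 1 - (1 - cos (s * k1)) / 2 * al.
Proof.
move=> mV mA mB alA alB al0 s0 k10 hV sa ak2.
have maV : measurable_fun setT (fun x => a * V x) by exact: measurable_funM.
have bC := bmeas_cos maV; have bS := bmeas_sin maV.
set C := 'Em _; set D := ('Em (fun x => sin (a * V x))).
pose h x := (cos (a * V x) - C) ^+ 2 + (sin (a * V x) - D) ^+ 2.
have h0 x : 0 <= h x by rewrite addr_ge0 ?sqr_ge0.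
have bh : bmeas h.
  by apply: bmeasD; apply: bmeasX; apply: bmeasB => //; exact: bmeas_cst.
have Eh : 'Em h = 1 - (C ^+ 2 + D ^+ 2).
  have -> : h = fun x => (1 + (C ^+ 2 + D ^+ 2)) + ((- (2 * C)) * cos (a * V x) + (- (2 * D)) * sin (a * V x)).
    apply/funext => x; rewrite /h; have := cos2Dsin2 (a * V x); lra.
  rewrite ExD; [|exact: bmeas_cst|by apply: bmeasD; exact: bmeasZ].
  rewrite Ex_cst ExD; [|exact: bmeasZ|exact: bmeasZ].
  rewrite !ExZ// -/C -/D; ring.
set ga := (1 - cos (s * k1)) / 2.
suff : ga * al <= 'Em h by rewrite Eh; lra.
have ga0 : 0 <= ga by rewrite divr_ge0// subr_ge0 cos_le1.
have hAB x y : A x -> B y -> ga * 2 <= h x + h y.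
  move=> Ax By; have /andP[V1 V2] := hV x y Ax By.
  have e : cos (s * k1) >= cos (a * V x - a * V y).
    rewrite -mulrBr -cos_norm normrM (ger0_norm (le_trans (ltW k10) V1)).
    apply: cos_ge_cos.
      rewrite (gtr0_norm (mulr_gt0 s0 k10)).
      by apply: ler_pM => //; apply: ltW.
    by apply: le_trans ak2; rewrite ler_wpM2l.
  rewrite cosB in e; rewrite /ga /h.
  have cx := cos2Dsin2 (a * V x); have cy := cos2Dsin2 (a * V y).
  move: (cos (a * V x)) (sin (a * V x)) (cos (a * V y)) (sin (a * V y)) e cx cy => c1 s1 c2 s2 e cx cy.
  (* Parallelogram law: [h x + h y] is at least half the squared distance of the two unit vectors,
     that is [1 - cos (a (V x - V y))]. *)
  have q1 := sqr_ge0 (c1 + c2 - 2 * C); have q2 := sqr_ge0 (s1 + s2 - 2 * D).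
  nra.
have key E : measurable E -> (al%:E <= mu E)%E -> (forall x, E x -> ga <= h x) -> ga * al <= 'Em h.
  move=> mE alE hE.
  apply: (@le_trans _ _ (ga * fine (mu E))).
    by rewrite ler_wpM2l// -lee_fin fineK// fin_num_measure.
  rewrite -(Ex_indic mu mE) -ExZ; last exact: bmeas_indic.
  apply: Ex_le => // [|x]; first by apply: bmeasZ; exact: bmeas_indic.
  rewrite indicE; have [|_] := boolP (x \in _); last by rewrite mulr0.
  by rewrite inE mulr1 => /hE.
have [hA|] := pselect (forall x, A x -> ga <= h x); first exact: (key A).
move=> /existsNP[x /not_implyP[Ax /negP]]; rewrite -ltNge => hx.
by apply: (key B) => // y By; have := hAB x y Ax By; lra.
Qed.

(** The point is uniformity: the frequencies and the decay rate [q] depend only on [al], [k1], [k2]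
    and [eta], so that one [m0] serves all [V], [A], [B] and [c]. *)
Lemma sum_anticoncentration (al k1 k2 eta : R) :
  0 < al -> 0 < k1 -> k1 <= k2 -> 0 < eta ->
  exists m0 : nat, forall m (V : T' -> R) (A B : set T') (c : R),
    (m0 <= m)%N -> measurable_fun setT V -> measurable A -> measurable B ->
    (al%:E <= mu A)%E -> (al%:E <= mu B)%E ->
    (forall x y, A x -> B y -> k1 <= V x - V y <= k2) ->
    (P [set w | (`|c + \sum_(j < m) V (X j w)| <= k2)%R] <= eta%:E)%E.
Proof.
move=> al0 k10 k12 eta0; have k20 := lt_le_trans k10 k12.
have cos1 := @cos1_gt0 R.
set e := eta * cos 1 ^+ 2 / 2.
have e0 : 0 < e by rewrite divr_gt0// mulr_gt0// exprn_gt0.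
(* [J] makes the diagonal part [1 / J] at most [e], and [m0] will do the same for [q ^ m]; [2 e] is
   [eta * cos 1 ^ 2]. *)
pose J := (Num.truncn e^-1).+1.
have J0 : 0 < J%:R :> R by rewrite ltr0n.
have Je : J%:R^-1 <= e.
  by rewrite -[leRHS]invrK lef_pV2 ?posrE ?invr_gt0// ltW// truncnS_gt.
(* With [J s k2 = 1], frequencies up to [J s] keep both the phases on [|U| <= k2] and the increments
   of [a V] between [A] and [B] within 1. *)
pose s := (J%:R * k2)^-1.
have s0 : 0 < s by rewrite invr_gt0 mulr_gt0.
set ga := (1 - cos (s * k1)) / 2 * al.
pose q := Num.sqrt (Num.max 0 (1 - ga)).
have q0 : 0 <= q by rewrite sqrtr_ge0.
have cosk1 : cos (s * k1) < 1.
  have p2 := pi_ge2 R.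
  have h1 : 0 < s * k1 by rewrite mulr_gt0.
  have h2 : s * k1 <= 1.
    rewrite /s mulrC ler_pdivrMr ?mulr_gt0// mul1r (le_trans k12)//.
    by rewrite ler_peMl ?(ltW k20)// ler1n.
  by rewrite -cos0 ltr_cos// in_itv /=; apply/andP; split; lra.
have ga0 : 0 < ga by rewrite mulr_gt0// divr_gt0// subr_gt0.
have q1 : `|q| < 1.
  rewrite ger0_norm// -(@ltr_pXn2r _ 2) ?nnegrE// expr1n sqr_sqrtr ?le_max ?lexx//.
  by rewrite gt_max ltr01 /=; lra.
have [m0 _ hm0] : \forall m \near \oo, `|q ^+ m| < e.
  have := cvg_expr q1 => /cvgr0Pnorm_lt; exact.
exists m0 => m V A B c mm mV mA mB alA alB hV.
apply: (@le_trans _ _ ((J%:R^-1 + q ^+ m) / cos 1 ^+ 2)%:E).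
  apply: (small_ball_char mX distX indepX _ _ (s := s) (q := q)) => //.
  - exact: ltW.
  - by rewrite /s; rewrite le_eqVlt; apply/orP; left; apply/eqP; field; rewrite !gt_eqF.
  - move=> a sa aJ; have -> : q ^+ 2 = Num.max 0 (1 - ga).
      by rewrite sqr_sqrtr// le_max lexx.
    apply: (le_trans (char_sq_le mV mA mB alA alB (ltW al0) s0 k10 hV sa _)).
      rewrite -(@ler_pM2r _ k2)// in aJ; apply: (le_trans aJ).
      by rewrite /s; rewrite le_eqVlt; apply/orP; left; apply/eqP; field; rewrite !gt_eqF.
    by rewrite le_max lexx orbT.
rewrite lee_fin ler_pdivrMr ?exprn_gt0//.
have := hm0 m mm; rewrite /= ger0_norm ?exprn_ge0// => h1.
rewrite /e in Je h1; lra.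
Qed.

End AntiConcentration.

(** * Roots, critical points and logarithmic averages *)

Section ComplexModulus.
Variable R : realType.
Implicit Types (x y z : R[i]).

Lemma normc_ge0 z : 0 <= normc z.
Proof. by case: z => a b; exact: sqrtr_ge0. Qed.

Lemma normcD_le x y : normc (x + y) <= normc x + normc y.
Proof. exact: le_normcD. Qed.

Lemma normc_opp x : normc (- x) = normc x.
Proof. exact: normcN. Qed.

Lemma normc_distC x y : normc (x - y) = normc (y - x).
Proof. by rewrite -normc_opp opprB. Qed.

Lemma normc_eq0 x : (normc x == 0) = (x == 0).
Proof.
by apply/eqP/eqP => [|->]; [exact: eq0_normc|exact: normc0].
Qed.

Lemma normc_gt0 x : (0 < normc x) = (x != 0).
Proof. by rewrite lt_def normc_ge0 andbT normc_eq0. Qed.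

Lemma normc_prod (I : Type) (r : seq I) (F : I -> R[i]) :
  normc (\prod_(i <- r) F i) = \prod_(i <- r) normc (F i).
Proof.
elim: r => [|i r IH]; first by rewrite !big_nil normc1.
by rewrite !big_cons normcM IH.
Qed.

Lemma normcX x n : normc (x ^+ n) = normc x ^+ n.
Proof.
elim: n => [|n IH]; first by rewrite !expr0 normc1.
by rewrite !exprS normcM IH.
Qed.

Lemma normc_sum (I : Type) (r : seq I) (F : I -> R[i]) :
  normc (\sum_(i <- r) F i) <= \sum_(i <- r) normc (F i).
Proof.
elim: r => [|i r IH]; first by rewrite !big_nil normc0.
by rewrite !big_cons (le_trans (normcD_le _ _))// lerD2l.
Qed.

Lemma normc_real (a : R) : normc a%:C%C = `|a|.
Proof. by rewrite /= expr0n addr0 sqrtr_sqr. Qed.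

Lemma normc_nat n : normc (n%:R : R[i]) = n%:R.
Proof. by rewrite -(rmorph_nat (real_complex R)) normc_real normr_nat. Qed.

Lemma normc_Re z : `|complex.Re z| <= normc z.
Proof.
case: z => a b /=; rewrite -sqrtr_sqr ler_wsqrtr// lerDl sqr_ge0 //.
Qed.

Lemma normc_Im z : `|complex.Im z| <= normc z.
Proof.
case: z => a b /=; rewrite -sqrtr_sqr ler_wsqrtr// lerDr sqr_ge0 //.
Qed.

Lemma normc_le_ReIm z : normc z <= `|complex.Re z| + `|complex.Im z|.
Proof.
case: z => a b /=; rewrite -(@ler_pXn2r _ 2) ?nnegrE ?sqrtr_ge0 ?addr_ge0//.
rewrite sqr_sqrtr ?addr_ge0 ?sqr_ge0// sqrrD !real_normK ?num_real//.
by rewrite -addrA lerD2l lerDr mulrn_wge0// mulr_ge0.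
Qed.

Lemma lerB_normc x y : normc x - normc y <= normc (x - y).
Proof. by rewrite lerBlDr (le_trans _ (normcD_le _ _))// subrK. Qed.

Lemma normc_triangle x y z : normc (x - z) <= normc (x - y) + normc (y - z).
Proof. by rewrite (le_trans _ (normcD_le _ _))// addrA subrK. Qed.

End ComplexModulus.

Section Roots.
Variable R : realType.
Implicit Types (x y z : R[i]) (xs zs : seq R[i]).

Lemma roots_mult_prod (q : {poly R[i]}) :
  q = lead_coef q *: \prod_(z <- roots_mult q) ('X - z%:P).
Proof. by rewrite /roots_mult; case: closed_field_poly_normal. Qed.

Lemma size_roots_mult (q : {poly R[i]}) : q != 0 -> size (roots_mult q) = (size q).-1.
Proof.
move=> q0; rewrite [in RHS](roots_mult_prod q) size_scale ?lead_coef_eq0//.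
by rewrite size_prod_XsubC.
Qed.

Lemma size_deriv_prod xs :
  size (\prod_(x <- xs) ('X - x%:P))^`() = size xs.
Proof.
have [->|xs0] := eqVneq xs [::].
  by rewrite big_nil -polyC1 derivC size_poly0.
case: xs xs0 => [//|x xs] _; set p := \prod_(_ <- _) _.
have sp : size p = (size xs).+2 by rewrite size_prod_XsubC.
have p0 : p != 0 by rewrite -size_poly_gt0 sp.
apply/anti_leq; rewrite -ltnS -sp lt_size_deriv//=.
rewrite ltnNge; apply/negP => /leq_sizeP/(_ (size xs) (leqnn _))/eqP.
rewrite coef_deriv mulrn_eq0 /=.
have := monic_prod_XsubC (x :: xs) xpredT id; rewrite monicE lead_coefE sp /= => /eqP ->.
by rewrite oner_eq0.
Qed.

Lemma lead_coef_deriv_prod xs :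
  lead_coef (\prod_(x <- xs) ('X - x%:P))^`() = (size xs)%:R.
Proof.
rewrite lead_coefE size_deriv_prod.
case: xs => [|x xs]; first by rewrite big_nil -polyC1 derivC coef0.
rewrite coef_deriv /=; set p := \prod_(_ <- _) _.
have sp : size p = (size xs).+2 by rewrite size_prod_XsubC.
have := monic_prod_XsubC (x :: xs) xpredT id; rewrite monicE lead_coefE sp /= => /eqP ->.
by [].
Qed.

Lemma deriv_prod_roots xs : (\prod_(x <- xs) ('X - x%:P))^`() =
  (size xs)%:R *: \prod_(z <- roots_mult (\prod_(x <- xs) ('X - x%:P))^`()) ('X - z%:P).
Proof. by rewrite {1}(roots_mult_prod (_^`())) lead_coef_deriv_prod. Qed.

Lemma size_roots_deriv xs : (0 < size xs)%N ->
  size (roots_mult (\prod_(x <- xs) ('X - x%:P))^`()) = (size xs).-1.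
Proof.
move=> xs0; rewrite size_roots_mult ?size_deriv_prod//.
by rewrite -size_poly_gt0 size_deriv_prod.
Qed.

Lemma horner_deriv_prod xs z : z \notin xs ->
  (\prod_(x <- xs) ('X - x%:P))^`().[z] =
  (\prod_(x <- xs) ('X - x%:P)).[z] * \sum_(x <- xs) (z - x)^-1.
Proof.
elim: xs => [|x xs IH]; first by rewrite !big_nil -polyC1 derivC !hornerE.
rewrite inE negb_or => /andP[zx zxs]; rewrite !big_cons derivM derivXsubC mul1r.
rewrite !hornerE IH// mulrDr mulrAC divff ?subr_eq0//; ring.
Qed.

Definition lmax (c : R[i]) (r : R) (x : R[i]) : R := ln (Num.max r (normc (x - c))).

(** The circle of centre [c] and radius [r] is sent to the unit circle and then raised to the power
    [N], so that all points [c + r y] with [y ^ N = w] have the same image [w]. *)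
Definition rescale (c : R[i]) (r : R) (N : nat) (x : R[i]) : R[i] :=
  ((x - c) / r%:C%C) ^+ N.

(** The defect in Jensen's formula on the unit circle, for a zero at [b], when the circle is
    replaced by the single point [w]. *)
Definition tau (w : R) (b : R[i]) : R :=
  ln (normc (w%:C%C - b)) - ln (Num.max 1 (normc b)).

Definition Nroots (N : nat) (w : R) : seq R[i] := roots_mult ('X^N - (w%:C%C)%:P).

Lemma NrootsE N w : (0 < N)%N ->
  'X^N - (w%:C%C)%:P = \prod_(y <- Nroots N w) ('X - y%:P).
Proof.
move=> N0; rewrite {1}(roots_mult_prod ('X^N - (w%:C%C)%:P)).
by rewrite lead_coefXnsubC ?scale1r.
Qed.

Lemma size_Nroots N w : (0 < N)%N -> size (Nroots N w) = N.
Proof.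
move=> N0; rewrite size_roots_mult ?size_XnsubC//.
by rewrite -size_poly_gt0 size_XnsubC.
Qed.

Lemma Nroots_exp N w y : (0 < N)%N -> y \in Nroots N w -> y ^+ N = w%:C%C.
Proof.
move=> N0 yN; have := root_prod_XsubC (Nroots N w) y.
by rewrite yN -NrootsE// => /rootP; rewrite !hornerE => /eqP; rewrite subr_eq0 => /eqP.
Qed.

(** The factorization [\prod_y (u - y) = u ^ N - w], evaluated at [u = (x - c) / r]. *)
Lemma prod_Nroots c r N w x : (0 < N)%N -> 0 < r ->
  \prod_(y <- Nroots N w) normc (c + r%:C%C * y - x) =
  r ^+ N * normc (w%:C%C - rescale c r N x).
Proof.
move=> N0 r0; have rC : r%:C%C != 0 :> R[i] by rewrite fmorph_eq0 gt_eqF.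
set u := (x - c) / r%:C%C.
have e : \prod_(y <- Nroots N w) (u - y) = u ^+ N - w%:C%C.
  have /(congr1 (horner^~ u)) := NrootsE w N0.
  rewrite horner_prod !hornerE => ->; apply: eq_bigr => y _; by rewrite !hornerE.
rewrite /rescale -/u normc_distC -e normc_prod -{2}(size_Nroots w N0).
elim: (Nroots N w) => [|y s IH]; first by rewrite !big_nil expr0 mul1r.
rewrite !big_cons IH /= exprS.
suff -> : normc (c + r%:C%C * y - x) = normc r%:C%C * normc (u - y).
  by rewrite normc_real (gtr0_norm r0); ring.
rewrite -normcM -normc_opp; congr normc.
by rewrite /u; field.
Qed.

Lemma sumr_cst_seq (I : Type) (s : seq I) (a : R) :
  \sum_(i <- s) a = (size s)%:R * a.
Proof.
elim: s => [|i s IH]; first by rewrite big_nil mul0r.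
by rewrite big_cons IH /= -natr1; ring.
Qed.

Lemma ln_prod (I : eqType) (s : seq I) (F : I -> R) :
  (forall i, i \in s -> 0 < F i) ->
  ln (\prod_(i <- s) F i) = \sum_(i <- s) ln (F i).
Proof.
elim: s => [|i s IH] h; first by rewrite !big_nil ln1.
rewrite !big_cons lnM ?IH//.
- by move=> j js; apply: h; rewrite inE js orbT.
- by rewrite posrE h// mem_head.
- rewrite posrE big_seq; apply: prodr_gt0 => j js.
  by apply: h; rewrite inE js orbT.
Qed.

Lemma lmax_rescale c r N x w : (0 < N)%N -> 0 < r ->
  N%:R * ln r + ln (normc (w%:C%C - rescale c r N x)) = N%:R * lmax c r x + tau w (rescale c r N x).
Proof.
move=> N0 r0; rewrite /tau /lmax.
have rC : normc (r%:C%C) = r by rewrite normc_real gtr0_norm.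
have -> : Num.max r (normc (x - c)) = r * Num.max 1 (normc (x - c) / r).
  by rewrite maxr_pMr ?(ltW r0)// mulr1 mulrC divfK// gt_eqF.
have -> : Num.max 1 (normc (rescale c r N x)) = (Num.max 1 (normc (x - c) / r)) ^+ N.
  rewrite normcX normcM normcV rC.
  set u := _ / r; have u0 : 0 <= u by rewrite divr_ge0 ?normc_ge0// ltW.
  have [u1|u1] := ltP 1 u.
    by rewrite max_r// exprn_ege1// ltW.
  by rewrite expr1n max_l// exprn_ile1.
have m0 : 0 < Num.max 1 (normc (x - c) / r) by rewrite lt_max ltr01.
rewrite lnM ?posrE// lnXn//; ring.
Qed.

(* Jensen's formula for [p'/p], with the circle replaced by the [N]-th roots of a point [w]. *)
Lemma lmax_deriv_roots xs c r N w K E :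
  let p := \prod_(x <- xs) ('X - x%:P) in
  let zs := roots_mult p^`() in
  (0 < size xs)%N -> (0 < N)%N -> 0 < r ->
  (forall x, x \in xs ++ zs -> w%:C%C != rescale c r N x) ->
  \sum_(x <- xs ++ zs) `|tau w (rescale c r N x)| <= E ->
  (forall y, y \in Nroots N w ->
     `|ln (normc (\sum_(x <- xs) (c + r%:C%C * y - x)^-1))| <= K) ->
  `|\sum_(z <- zs) lmax c r z - \sum_(x <- xs) lmax c r x|
    <= K + ln (size xs)%:R + E / N%:R.
Proof.
move=> p zs xs0 N0 r0 hw hE hK.
have N0' : 0 < N%:R :> R by rewrite ltr0n.
have n0' : 0 < (size xs)%:R :> R by rewrite ltr0n.
have np x y : x \in xs ++ zs -> y \in Nroots N w -> c + r%:C%C * y != x.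
  move=> xin yin.
  have /eqP e : r ^+ N * normc (w%:C%C - rescale c r N x) != 0.
    by rewrite mulf_neq0 ?expf_neq0 ?gt_eqF// normc_gt0 subr_eq0 hw.
  apply/eqP => yx; apply: e; rewrite -(prod_Nroots c w x N0 r0).
  by rewrite (big_rem y)//= yx subrr normc0 mul0r.
have sumL s : {subset s <= xs ++ zs} ->
   \sum_(y <- Nroots N w) ln (normc (\prod_(x <- s) ('X - x%:P)).[c + r%:C%C * y]) =
   \sum_(x <- s) (N%:R * lmax c r x + tau w (rescale c r N x)).
  move=> sub.
  transitivity (\sum_(y <- Nroots N w) \sum_(x <- s) ln (normc (c + r%:C%C * y - x))).
    apply: eq_big_seq => y yin.
    rewrite horner_prod normc_prod -ln_prod.
      by congr ln; apply: eq_bigr => x _; rewrite !hornerE.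
    by move=> x xin; rewrite normc_gt0 subr_eq0 np// sub.
  rewrite exchange_big /=; apply: eq_big_seq => x xin.
  rewrite -lmax_rescale// -ln_prod; last first.
    by move=> y yin; rewrite normc_gt0 subr_eq0 np// sub.
  rewrite prod_Nroots// lnM ?posrE ?exprn_gt0// ?lnXn ?mulr_natl//.
  by rewrite normc_gt0 subr_eq0 hw// sub.
have sx : {subset xs <= xs ++ zs} by move=> x h; rewrite mem_cat h.
have sz : {subset zs <= xs ++ zs} by move=> x h; rewrite mem_cat h orbT.
pose L y := \sum_(x <- xs) (c + r%:C%C * y - x)^-1.
(* The logarithm of [n |\prod_z (u - z)| = |p(u)| |L(u)|], summed over the [N] points
   [u = c + r y]. *)
have key : N%:R * (\sum_(z <- zs) lmax c r z - \sum_(x <- xs) lmax c r x) =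
   \sum_(y <- Nroots N w) ln (normc (L y)) - N%:R * ln (size xs)%:R
   - \sum_(z <- zs) tau w (rescale c r N z) + \sum_(x <- xs) tau w (rescale c r N x).
  have e1 := sumL _ sx; have e2 := sumL _ sz.
  rewrite [RHS](big_split _ _ _ (fun x => N%:R * lmax c r x)) /= -mulr_sumr in e1.
  rewrite [RHS](big_split _ _ _ (fun x => N%:R * lmax c r x)) /= -mulr_sumr in e2.
  suff : \sum_(y <- Nroots N w) ln (normc (\prod_(x <- zs) ('X - x%:P)).[c + r%:C%C * y]) =
     \sum_(y <- Nroots N w) ln (normc (L y)) - N%:R * ln (size xs)%:R +
     \sum_(y <- Nroots N w) ln (normc (\prod_(x <- xs) ('X - x%:P)).[c + r%:C%C * y]).
    by rewrite e1 e2 => e3; lra.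
  rewrite -[in N%:R * _](size_Nroots w N0) -sumr_cst_seq -sumrB -big_split /=.
  apply: eq_big_seq => y yin.
  have yxs : c + r%:C%C * y \notin xs.
    by apply/negP => h; have := np _ y (sx _ h) yin; rewrite eqxx.
  have yzs : c + r%:C%C * y \notin zs.
    by apply/negP => h; have := np _ y (sz _ h) yin; rewrite eqxx.
  have := horner_deriv_prod yxs; rewrite -/p {1}deriv_prod_roots -/p -/zs hornerZ.
  move=> /(congr1 (fun z => ln (normc z))); rewrite !normcM normc_nat -/(L y).
  set Z := normc _.[_] => e.
  have Z0 : 0 < Z.
    rewrite normc_gt0; have := root_prod_XsubC zs (c + r%:C%C * y).
    by rewrite (negbTE yzs) rootE => ->.
  have p0 : 0 < normc p.[c + r%:C%C * y].
    rewrite normc_gt0; have := root_prod_XsubC xs (c + r%:C%C * y).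
    by rewrite (negbTE yxs) rootE => ->.
  have L0 : 0 < normc (L y).
    rewrite normc_gt0; apply/eqP => L0; have := horner_deriv_prod yxs.
    rewrite -/(L y) L0 mulr0 -/p {1}deriv_prod_roots -/p -/zs hornerZ.
    move=> /(congr1 (@normc R)); rewrite normcM normc_nat normc0 -/Z => /eqP.
    by rewrite mulf_eq0 !gt_eqF.
  rewrite !lnM ?posrE// in e; lra.
have NK : `|\sum_(y <- Nroots N w) ln (normc (L y))| <= N%:R * K.
  rewrite -[in N%:R * _](size_Nroots w N0) -sumr_cst_seq (le_trans (ler_norm_sum _ _ _))//.
  by rewrite big_seq [leRHS]big_seq ler_sum.
have tE : `|\sum_(z <- zs) tau w (rescale c r N z)| + `|\sum_(x <- xs) tau w (rescale c r N x)| <= E.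
  by apply: le_trans hE; rewrite big_cat /= addrC lerD// ler_norm_sum.
have ln0 : 0 <= ln (size xs)%:R :> R by rewrite ln_ge0// ler1n.
rewrite -(@ler_pM2l _ N%:R)// -{1}(gtr0_norm N0') -normrM key.
have -> : N%:R * (K + ln (size xs)%:R + E / N%:R) = N%:R * K + N%:R * ln (size xs)%:R + E.
  by field; rewrite gt_eqF.
have NL : 0 <= N%:R * ln (size xs)%:R :> R by rewrite mulr_ge0// ltW.
move: NK tE NL; rewrite !ler_norml.
move: (\sum_(y <- _) _) (N%:R * ln _) => A B.
move: (\sum_(z <- zs) _) (\sum_(z <- xs) _) => C D.
move: (ler_norm C) (ler_norm (- C)) (ler_norm D) (ler_norm (- D)); rewrite !normrN.
move=> ? ? ? ? /andP[? ?] ? ?; apply/andP; split; lra.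
Qed.

End Roots.

(** * Choosing a good point of a grid *)

Section Grid.
Variable R : realType.
Implicit Types (b : R[i]).

(** Real points between 1 and 2 suffice: the singularity of [tau] is integrable along a line, and
    the [N]-th roots of such points have modulus at most 2. *)
Definition grid (M : nat) (j : nat) : R := 1 + j%:R / M%:R.

Lemma grid_bounds M j : (j < M)%N -> 1 <= grid M j <= 2.
Proof.
move=> jM; have M0 : 0 < M%:R :> R by rewrite ltr0n (leq_trans _ jM).
rewrite /grid lerDl divr_ge0//= (_ : 2 = 1 + 1)// lerD2l ler_pdivrMr// mul1r.
by rewrite ler_nat ltnW.
Qed.

(** [j0] minimizes the distance to [b], so the triangle inequality through [b] costs only a factor
    2. Distances to the complex number [b] are thereby bounded below by index distances. *)
Lemma grid_nearest M b : (0 < M)%N -> exists j0 : 'I_M, forall j : 'I_M,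
  `|j%:R - j0%:R| <= 2 * M%:R * normc ((grid M j)%:C%C - b).
Proof.
case: M => // M _; have M0 : 0 < M.+1%:R :> R by rewrite ltr0n.
pose F (j : 'I_M.+1) := normc ((grid M.+1 j)%:C%C - b).
have [j0 _ hj0] := @Order.TotalTheory.arg_minP _ R _ ord0 xpredT F isT.
exists j0 => j; have := hj0 j isT; rewrite /F => h.
have e : `|j%:R - j0%:R| = M.+1%:R * normc ((grid M.+1 j)%:C%C - (grid M.+1 j0)%:C%C).
  rewrite -rmorphB normc_real /grid.
  rewrite -{1}(gtr0_norm M0) -normrM; congr `| _ |; field.
  by rewrite ?nat1r ?natr1 (gt_eqF M0).
rewrite e [2 * _]mulrC -mulrA ler_wpM2l//.
rewrite (le_trans (normc_triangle _ b _))// [normc (b - _)]normc_distC.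
by rewrite mulr_natl mulr2n lerD2l.
Qed.

(** The weight that replaces the logarithmic singularity: [ln (1 + u) <= 2 sqrt u], and sums of
    [k^(-1/2)] are controlled by telescoping [2 sqrt k]. *)
Definition isq (k : nat) : R := (Num.sqrt k%:R)^-1.

Lemma isq_step k : 2 * Num.sqrt k%:R + isq k.+1 <= 2 * Num.sqrt k.+1%:R :> R.
Proof.
rewrite /isq; set a : R := Num.sqrt k%:R; set b : R := Num.sqrt k.+1%:R.
have b0 : 0 < b by rewrite sqrtr_gt0 ltr0n.
have a0 : 0 <= a by rewrite sqrtr_ge0.
have ab : b ^+ 2 = a ^+ 2 + 1 by rewrite !sqr_sqrtr// natr1.
rewrite -(@ler_pM2r _ b)// mulrDl mulVf ?gt_eqF//.
have := sqr_ge0 (a - b); nra.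
Qed.

Lemma sum_isq_below m : \sum_(j < m) isq (m - j) <= 2 * Num.sqrt m%:R.
Proof.
elim: m => [|m IH]; first by rewrite big_ord0 mulr_ge0// sqrtr_ge0.
rewrite big_ord_recl subn0 addrC /=.
under eq_bigr do rewrite /bump /= add1n subSS.
by apply: le_trans (isq_step m); rewrite lerD2r.
Qed.

Lemma sum_isq_above m j0 :
  \sum_(j < m | (j0 < j)%N) isq (j - j0) <= 2 * Num.sqrt (m - j0).-1%:R.
Proof.
elim: m => [|m IH]; first by rewrite big_ord0 mulr_ge0// sqrtr_ge0.
rewrite big_mkcond big_ord_recr -big_mkcond /=.
have [jm|mj] := ltnP j0 m; last first.
  rewrite addr0 (le_trans IH)// ler_wpM2l// ler_wsqrtr// ler_nat.
  by rewrite -!subn1 leq_sub2r// leq_sub2r.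
have -> : (m.+1 - j0).-1 = (m - j0).-1.+1.
  by rewrite subSn ?(ltnW jm)//= prednK// subn_gt0.
have -> : isq (m - j0) = isq (m - j0).-1.+1 by rewrite prednK// subn_gt0.
by apply: le_trans (isq_step _); rewrite lerD2r.
Qed.

Definition absd (j k : nat) : nat := (j - k) + (k - j).

Lemma absdE (j k : nat) : `|j%:R - k%:R| = (absd j k)%:R :> R.
Proof.
rewrite /absd; have [jk|kj] := leqP j k.
  by rewrite distrC -natrB// normr_nat (eqP jk).
by rewrite -natrB ?(ltnW kj)// normr_nat (eqP (ltnW kj)) addn0.
Qed.

Lemma sum_isq M (j0 : 'I_M) :
  \sum_(j < M | j != j0) isq (absd j j0) <= 4 * Num.sqrt M%:R.
Proof.
have le_s k : (k <= M)%N -> 2 * Num.sqrt k%:R <= 2 * Num.sqrt M%:R :> R.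
  by move=> kM; rewrite ler_wpM2l// ler_wsqrtr// ler_nat.
rewrite (bigID (fun j : 'I_M => (j < j0)%N)) /=.
have -> : 4 * Num.sqrt M%:R = 2 * Num.sqrt M%:R + 2 * Num.sqrt M%:R :> R by ring.
apply: lerD.
  apply: le_trans (le_s j0 (ltnW (ltn_ord j0))).
  apply: le_trans (sum_isq_below j0).
  rewrite (big_ord_widen M (fun j => isq (j0 - j)))/=; last exact: ltnW.
  rewrite le_eqVlt; apply/orP; left; apply/eqP; apply: eq_big => j.
    by rewrite -(inj_eq val_inj) /=; case: ltngtP.
  by move=> /andP[_ h]; rewrite /absd (eqP (ltnW h)).
apply: le_trans (le_s (M - j0).-1 _); last by rewrite (leq_trans (leq_pred _))// leq_subr.
apply: le_trans (sum_isq_above M j0).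
rewrite le_eqVlt; apply/orP; left; apply/eqP; apply: eq_big => j.
  by rewrite -(inj_eq val_inj) /=; case: ltngtP.
by rewrite -leqNgt => /andP[_ h]; rewrite /absd (eqP h) addn0.
Qed.

Lemma ln1D_le_sqrt (u : R) : 0 <= u -> ln (1 + u) <= 2 * Num.sqrt u.
Proof.
move=> u0; have s0 := sqrtr_ge0 u.
have h : 1 + u <= (1 + Num.sqrt u) ^+ 2.
  by rewrite sqrrD sqr_sqrtr// expr1n mul1r -addrA lerD2l lerDr mulrn_wge0.
apply: (@le_trans _ _ (ln ((1 + Num.sqrt u) ^+ 2))).
  by rewrite ler_ln// posrE; [lra|apply: exprn_gt0; lra].
rewrite lnXn; last lra.
have : ln (1 + Num.sqrt u) <= Num.sqrt u by apply: le_ln1Dx; lra.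
by rewrite mulr2n; lra.
Qed.

(** With [v = |w - b|] and [m = max 1 |b|], the bound [v <= 3 m] limits [tau = ln (v / m)] from
    above, and [m <= v + 2] gives [- tau <= ln (1 + 2 / v) <= ln (1 + 4 M / k)]. *)
Lemma tau_le (w : R) b (k M : nat) : (0 < k)%N -> (0 < M)%N -> 1 <= w <= 2 ->
  k%:R <= 2 * M%:R * normc (w%:C%C - b) ->
  `|tau w b| <= 3 + 4 * Num.sqrt M%:R * isq k.
Proof.
move=> k0 M0 /andP[w1 w2] h.
have k0' : 0 < k%:R :> R by rewrite ltr0n.
have M0' : 0 < M%:R :> R by rewrite ltr0n.
set v := normc _ in h *.
have v0 : 0 < v.
  by have := lt_le_trans k0' h; rewrite pmulr_rgt0 ?mulr_gt0.
have wn : normc (w%:C%C) <= 2 by rewrite normc_real ger0_norm//; lra.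
set m := Num.max 1 (normc b).
have m1 : 1 <= m by rewrite le_max lexx.
have mb : normc b <= m by rewrite le_max lexx orbT.
have vm : v <= 3 * m.
  rewrite (le_trans (normcD_le _ _))// normc_opp; lra.
have mv : m <= v + 2.
  rewrite ge_max; apply/andP; split; first lra.
  have := lerB_normc b w%:C%C; rewrite normc_distC -/v; lra.
have m0 : 0 < m by lra.
have tauE : tau w b = ln (v / m) by rewrite /tau -/v -/m ln_div.
have up : tau w b <= 3.
  rewrite tauE ltW// (le_lt_trans _ (ln_sublinear _))// ler_ln ?posrE ?divr_gt0//.
  by rewrite ler_pdivrMr.
have isq0 : 0 <= 4 * Num.sqrt M%:R * isq k by rewrite !mulr_ge0 ?invr_ge0 ?sqrtr_ge0.
have lo : - tau w b <= 4 * Num.sqrt M%:R * isq k.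
  rewrite tauE -lnV ?posrE ?divr_gt0// invf_div.
  have u0 : 0 <= 4 * M%:R / k%:R :> R by rewrite divr_ge0// mulr_ge0.
  apply: (@le_trans _ _ (ln (1 + 4 * M%:R / k%:R))).
    have p1 : 0 < 1 + 4 * M%:R / k%:R :> R by rewrite (ltr_pwDl ltr01 u0).
    rewrite ler_ln ?posrE ?divr_gt0//.
    apply: (@le_trans _ _ ((v + 2) / v)); first by rewrite ler_pM2r// invr_gt0.
    rewrite mulrDl divff ?gt_eqF// lerD2l.
    by rewrite ler_pdivrMr// mulrAC ler_pdivlMr//; lra.
  apply: (le_trans (ln1D_le_sqrt _)) => //.
  rewrite /isq sqrtrM ?mulr_ge0// sqrtrM// sqrtrV//.
  have -> : Num.sqrt 4 = 2 :> R by rewrite (_ : 4 = 2 ^+ 2) ?sqrtr_sqr ?ger0_norm//; ring.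
  by rewrite !mulrA (_ : 2 * 2 = 4 :> R)//; ring.
rewrite ler_norml; apply/andP; split; lra.
Qed.

(** [19 = 3 + 4 * 4]: the weights [isq] sum to at most [4 sqrt M] and carry the factor [4 sqrt M].
    The nearest point is left out, since [tau] has no uniform bound there. *)
Lemma tau_grid M b : (0 < M)%N -> exists j0 : 'I_M,
  (forall j : 'I_M, `|j%:R - j0%:R| <= 2 * M%:R * normc ((grid M j)%:C%C - b)) /\
  \sum_(j < M | j != j0) `|tau (grid M j) b| <= 19 * M%:R.
Proof.
move=> M0; have [j0 hj0] := grid_nearest b M0; exists j0; split=> //.
apply: (@le_trans _ _ (\sum_(j < M | j != j0) (3 + 4 * Num.sqrt M%:R * isq (absd j j0)))).
  apply: ler_sum => j jj; apply: tau_le => //.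
  - rewrite /absd lt0n addn_eq0 !subn_eq0 -eqn_leq; exact: jj.
  - exact: grid_bounds.
  - by rewrite -absdE.
rewrite big_split /= -mulr_sumr sumr_const -[3 *+ _]mulr_natl.
have h1 : (#|[pred j : 'I_M | j != j0]|)%:R <= M%:R :> R.
  by rewrite ler_nat (leq_trans (max_card _))// card_ord.
have h2 := sum_isq j0.
have h3 : Num.sqrt M%:R * Num.sqrt M%:R = M%:R :> R by rewrite -expr2 sqr_sqrtr.
have h4 : 0 <= Num.sqrt M%:R :> R by rewrite sqrtr_ge0.
have h5 : Num.sqrt M%:R * (\sum_(j < M | j != j0) isq (absd j j0)) <= 4 * M%:R.
  by rewrite -[X in 4 * X]h3 mulrCA ler_wpM2l.
rewrite /= in h1 *; move: h1 h5; set Z := \sum_(_ < _ | _) _.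
rewrite -mulrA; set Y := _ * Z; set W := _%:R; lra.
Qed.

(** Apart from the nearest point, such [j] have index distance below [M / K ^ 2], hence weight [isq]
    at least [K / sqrt M]; the total weight [4 sqrt M] bounds their number. *)
Lemma card_grid_near M b (K : R) : (0 < M)%N -> 0 < K ->
  K * #|[set j : 'I_M | normc ((grid M j)%:C%C - b) < (2 * K ^+ 2)^-1]%SET|%:R
    <= 4 * M%:R + K.
Proof.
move=> M0 K0; have [j0 hj0] := grid_nearest b M0.
set S := [set j | _]%SET.
have M0' : 0 < M%:R :> R by rewrite ltr0n.
have s0 : 0 < Num.sqrt M%:R :> R by rewrite sqrtr_gt0.
have h : \sum_(j in S :\ j0) (K / Num.sqrt M%:R) <= 4 * Num.sqrt M%:R :> R.
  apply: le_trans (sum_isq j0).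
  apply: (@le_trans _ _ (\sum_(j in S :\ j0) isq (absd j j0))).
    apply: ler_sum => j; rewrite !inE => /andP[jj hj].
    have k0 : (0 < absd j j0)%N by rewrite /absd lt0n addn_eq0 !subn_eq0 -eqn_leq; exact: jj.
    have := hj0 j; rewrite absdE => hk.
    have k0' : 0 < (absd j j0)%:R :> R by rewrite ltr0n.
    rewrite /isq -[X in _ <= X]mul1r ler_pdivlMr ?sqrtr_gt0// mulrAC ler_pdivrMr// mul1r.
    rewrite -(@ler_pXn2r _ 2) ?nnegrE ?mulr_ge0 ?sqrtr_ge0 ?(ltW K0)//.
    rewrite exprMn !sqr_sqrtr//.
    have K2 : 0 < 2 * K ^+ 2 by rewrite mulr_gt0// exprn_gt0.
    move: hj; rewrite -[_^-1]mul1r ltr_pdivlMr// => hj.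
    have := ler_wpM2l (ltW K2) hk; have := ltr_pM2l M0' (normc ((grid M j)%:C%C - b) * (2 * K ^+ 2)) 1.
    rewrite hj mulr1 => h1 h2.
    have : 0 < K ^+ 2 by rewrite exprn_gt0.
    move: h1 h2; set n1 := normc _; set k2 := K ^+ 2; set a := _%:R; nra.
  rewrite big_mkcond [leRHS]big_mkcond; apply: ler_sum => j _.
  rewrite !inE; case: eqP => //= _; case: ifP => // _.
  by rewrite invr_ge0 sqrtr_ge0.
move: h; rewrite sumr_const -[_ *+ #|_|]mulr_natl mulrA ler_pdivrMr// -mulrA -expr2 sqr_sqrtr//.
have : (#|S| <= 1 + #|S :\ j0|)%N by rewrite (cardsD1 j0 S) leq_add2r; case: (_ \in _).
rewrite -(ler_nat R) natrD -(ler_pM2l K0); lra.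
Qed.

(** Besides [bad], the nearest grid point of every [b] is discarded, and more than [M / 4] points
    remain. Each [b] contributes at most [19 M] in total, so some remaining point gets at most
    [4 * 19 = 76] per [b]. Index distance at least 1 from each nearest point yields the separation
    from the [b]. *)
Lemma exists_good_grid M (bs : seq R[i]) (bad : {set 'I_M}) :
  4 * ((size bs)%:R + #|bad|%:R) < 3 * M%:R :> R ->
  exists2 j : 'I_M, j \notin bad &
    (forall b, b \in bs -> 1 <= 2 * M%:R * normc ((grid M j)%:C%C - b)) /\
    \sum_(b <- bs) `|tau (grid M j) b| <= 76 * (size bs)%:R.
Proof.
move=> hM.
have M0 : (0 < M)%N.
  by rewrite -(ltr0n R); have : 0 <= (size bs)%:R + #|bad|%:R :> R; [rewrite addr_ge0|lra].
pose nearest b := projT1 (cid (tau_grid b M0)).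
have hn b : (forall j : 'I_M, `|j%:R - (nearest b)%:R| <= 2 * M%:R * normc ((grid M j)%:C%C - b)) /\
  \sum_(j < M | j != nearest b) `|tau (grid M j) b| <= 19 * M%:R.
  by rewrite /nearest; case: cid.
pose kill : {set 'I_M} := [set j | j \in map nearest bs]%SET.
have ck : (#|kill| <= size bs)%N.
  by rewrite cardsE (leq_trans (card_size _))// size_map.
apply: contrapT => hno.
pose S (j : 'I_M) := \sum_(b <- bs) (if j != nearest b then `|tau (grid M j) b| else 0).
have S0 j : 0 <= S j by apply: sumr_ge0 => b _; case: ifP.
have hS j : j \in ~: (bad :|: kill) -> 76 * (size bs)%:R < S j.
  rewrite !inE negb_or => /andP[jb jk]; rewrite ltNge; apply/negP => hle.
  have nb b : b \in bs -> j != nearest b.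
    by move=> bb; apply: contra jk => /eqP ->; exact: map_f.
  apply: hno; exists j => //; split.
    move=> b bb; apply: le_trans ((hn b).1 j); rewrite absdE ler1n.
    by rewrite /absd lt0n addn_eq0 !subn_eq0 -eqn_leq; exact: (nb b bb).
  apply: le_trans hle; rewrite /S big_seq [leRHS]big_seq.
  by apply: ler_sum => b bb; rewrite nb.
have tot : \sum_(j < M) S j <= 19 * M%:R * (size bs)%:R.
  rewrite /S exchange_big /= [leRHS]mulrC -sumr_cst_seq; apply: ler_sum => b _.
  by rewrite -big_mkcond; exact: (hn b).2.
have cnt : M%:R - #|bad|%:R - (size bs)%:R <= #|~: (bad :|: kill)|%:R :> R.
  have := cardsC (bad :|: kill); rewrite card_ord => /(congr1 (fun n => n%:R : R)).
  rewrite natrD => <-.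
  have : (#|bad :|: kill| <= #|bad| + size bs)%N.
    by rewrite (leq_trans (leq_card_setU _ _))// leq_add2l.
  rewrite -(ler_nat R) natrD; lra.
have h0 : 0 < #|~: (bad :|: kill)|%:R :> R by have : 0 < M%:R :> R; [rewrite ltr0n|lra].
have [j0 hj0] : exists j, j \in ~: (bad :|: kill).
  by apply/set0Pn; rewrite -card_gt0 -(ltr0n R).
have low : #|~: (bad :|: kill)|%:R * (76 * (size bs)%:R) < \sum_(j < M) S j.
  rewrite mulr_natl -sumr_const.
  apply: (@lt_le_trans _ _ (\sum_(j in ~: (bad :|: kill)) S j)).
    apply: ltr_sum => [|j /hS //]; apply/hasP; exists j0 => //.
  rewrite [leRHS](bigID (fun j => j \in ~: (bad :|: kill)))/= lerDl.
  exact: sumr_ge0.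
have b0 : 0 <= (size bs)%:R :> R by [].
have M0' : 0 < M%:R :> R by rewrite ltr0n.
nra.
Qed.

End Grid.

(** * Anticoncentration of [\sum_j 1/(z - X_j)], uniformly in [z] *)

Section Resolvent.
Variable R : realType.
Implicit Types (z : R[i]) (x : R * R).
Local Notation cpl := (@cplx_of_pair R).

Lemma measurable_invr : measurable_fun [set: R] (fun x : R => x^-1).
Proof.
(* These continuous approximants vanish at 0, in accordance with the convention [0^-1 = 0], so they
   converge everywhere. *)
apply: (@measurable_fun_cvg _ _ _ setT (fun k (x : R) => x * (x ^+ 2 + k.+1%:R^-1)^-1)).
  move=> k; apply: measurable_funM => //.
  apply: continuous_measurable_fun => x.
  have h : x ^+ 2 + k.+1%:R^-1 != 0.
    by rewrite gt_eqF// ltr_wpDl ?sqr_ge0// invr_gt0.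
  apply: cvgV => //; apply: cvgD; last exact: cvg_cst.
  exact: exprn_continuous.
move=> x _; have [->|x0] := eqVneq x 0.
  by under eq_fun do rewrite mul0r; rewrite invr0; exact: cvg_cst.
have -> : x^-1 = x * (x ^+ 2 + 0)^-1 by field.
apply: cvgMl_tmp; apply: cvgV; first by rewrite addr0 expf_neq0.
by apply: cvgD; [exact: cvg_cst|exact: cvg_harmonic].
Qed.

Lemma ReV z : complex.Re z^-1 = complex.Re z / (complex.Re z ^+ 2 + complex.Im z ^+ 2).
Proof. by case: z. Qed.

Lemma ImV z : complex.Im z^-1 = - (complex.Im z / (complex.Re z ^+ 2 + complex.Im z ^+ 2)).
Proof. by case: z. Qed.

Lemma Re_sub z1 z2 : complex.Re (z1 - z2) = complex.Re z1 - complex.Re z2.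
Proof. by case: z1 z2 => a b [c d]. Qed.

Lemma Im_sub z1 z2 : complex.Im (z1 - z2) = complex.Im z1 - complex.Im z2.
Proof. by case: z1 z2 => a b [c d]. Qed.

Lemma Re_add z1 z2 : complex.Re (z1 + z2) = complex.Re z1 + complex.Re z2.
Proof. by case: z1 z2 => a b [c d]. Qed.

Lemma Im_add z1 z2 : complex.Im (z1 + z2) = complex.Im z1 + complex.Im z2.
Proof. by case: z1 z2 => a b [c d]. Qed.

Lemma Re_mul z1 z2 : complex.Re (z1 * z2) =
  complex.Re z1 * complex.Re z2 - complex.Im z1 * complex.Im z2.
Proof. by case: z1 z2 => a b [c d]. Qed.

Lemma Im_mul z1 z2 : complex.Im (z1 * z2) =
  complex.Re z1 * complex.Im z2 + complex.Im z1 * complex.Re z2.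
Proof. by case: z1 z2 => a b [c d]. Qed.

Lemma Re_sum (I : Type) (r : seq I) (F : I -> R[i]) :
  complex.Re (\sum_(i <- r) F i) = \sum_(i <- r) complex.Re (F i).
Proof. by elim: r => [|i r IH]; rewrite ?big_nil// !big_cons Re_add IH. Qed.

Lemma Im_sum (I : Type) (r : seq I) (F : I -> R[i]) :
  complex.Im (\sum_(i <- r) F i) = \sum_(i <- r) complex.Im (F i).
Proof. by elim: r => [|i r IH]; rewrite ?big_nil// !big_cons Im_add IH. Qed.

Lemma normcE (z : R[i]) : normc z = Num.sqrt (complex.Re z ^+ 2 + complex.Im z ^+ 2).
Proof. by case: z. Qed.

Lemma measurable_resolvent z :
  measurable_fun setT (fun x => complex.Re (z - cpl x)^-1) /\
  measurable_fun setT (fun x => complex.Im (z - cpl x)^-1).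
Proof.
have mR : measurable_fun setT (fun x => complex.Re z - x.1).
  by apply: measurable_funB => //; exact: measurable_fst.
have mI : measurable_fun setT (fun x => complex.Im z - x.2).
  by apply: measurable_funB => //; exact: measurable_snd.
have mN : measurable_fun setT (fun x => ((complex.Re z - x.1) ^+ 2 + (complex.Im z - x.2) ^+ 2)^-1).
  apply: (measurableT_comp measurable_invr).
  by apply: measurable_funD; exact: measurable_funX.
split.
  have -> : (fun x => complex.Re (z - cpl x)^-1) =
     (fun x => (complex.Re z - x.1) * ((complex.Re z - x.1) ^+ 2 + (complex.Im z - x.2) ^+ 2)^-1).
    by apply/funext => x; rewrite ReV Re_sub Im_sub.
  exact: measurable_funM.
have -> : (fun x => complex.Im (z - cpl x)^-1) =
   (fun x => - ((complex.Im z - x.2) * ((complex.Re z - x.1) ^+ 2 + (complex.Im z - x.2) ^+ 2)^-1)).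
  by apply/funext => x; rewrite ImV Re_sub Im_sub.
by apply: measurableT_comp => //; exact: measurable_funM.
Qed.

Lemma measurable_normc_sub (a : R[i]) :
  measurable_fun setT (fun x => normc (cpl x - a) ^+ 2).
Proof.
have -> : (fun x => normc (cpl x - a) ^+ 2) =
   (fun x => (x.1 - complex.Re a) ^+ 2 + (x.2 - complex.Im a) ^+ 2).
  apply/funext => x; rewrite normcE sqr_sqrtr ?addr_ge0 ?sqr_ge0//.
  by rewrite Re_sub Im_sub.
by apply: measurable_funD; apply: measurable_funX; exact: measurable_funB.
Qed.

Lemma measurable_disc (a : R[i]) (r : R) : 0 <= r ->
  measurable [set x | normc (cpl x - a) <= r].
Proof.
move=> r0; have -> : [set x | normc (cpl x - a) <= r] = [set x | normc (cpl x - a) ^+ 2 <= r ^+ 2].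
  by apply/seteqP; split => x /=; rewrite ler_pXn2r ?nnegrE ?normc_ge0.
by apply: measurable_set_ler => //; exact: measurable_normc_sub.
Qed.

Lemma measurable_disc_far (a : R[i]) (r : R) : 0 <= r ->
  measurable [set x | r < normc (cpl x - a)].
Proof.
move=> r0; have -> : [set x | r < normc (cpl x - a)] = ~` [set x | normc (cpl x - a) <= r].
  by apply/seteqP; split => x /=; [move=> h; apply/negP; rewrite -ltNge|move/negP; rewrite -ltNge].
by apply: measurableC; exact: measurable_disc.
Qed.

Lemma normc_conj z : normc (z^*)%C = normc z.
Proof. by case: z => a b /=; rewrite sqrrN. Qed.

Lemma exists_rotation z : z != 0 -> exists2 u : R[i], normc u = 1 & u * z = (normc z)%:C%C.
Proof.
move=> z0; exists ((z^*)%C / (normc z)%:C%C).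
  by rewrite normcM normcV normc_real normc_conj ger0_norm ?normc_ge0// divff// normc_eq0.
have e : (z^*)%C * z = ((normc z)%:C ^+ 2)%C.
  case: z {z0} => a b; rewrite -rmorphXn normcE sqr_sqrtr ?addr_ge0 ?sqr_ge0//.
  by apply/eqP; rewrite eq_complex /=; apply/andP; split; apply/eqP; ring.
by rewrite mulrAC e expr2 mulfK// fmorph_eq0 normc_eq0.
Qed.

Lemma resolvent_diff z (a b : R[i]) : z != a -> z != b ->
  (z - a)^-1 - (z - b)^-1 = (a - b) / ((z - a) * (z - b)).
Proof.
by move=> za zb; field; rewrite !subr_eq0 za zb.
Qed.

Section AntiConcentrationResolvent.
Context d (T : measurableType d) (P : probability T R) (mu : probability (R * R)%type R).
Variable X : nat -> T -> R * R.
Hypothesis mX : forall i, measurable_fun setT (X i).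
Hypothesis distX : forall i A, measurable A -> P (X i @^-1` A) = mu A.
Hypothesis indepX : mutually_independent P X.

Definition in_support (a : R[i]) : Prop :=
  forall r, 0 < r -> (0 < mu [set x | (normc (cpl x - a) <= r)%R])%E.

Lemma measurable_small_sum m z v (t : R) : 0 <= t ->
  measurable [set w | normc (\sum_(j < m) (z - cpl (X j w))^-1 + v) <= t].
Proof.
move=> t0; have [mR mI] := measurable_resolvent z.
pose F w := complex.Re (\sum_(j < m) (z - cpl (X j w))^-1 + v).
pose G w := complex.Im (\sum_(j < m) (z - cpl (X j w))^-1 + v).
have -> : [set w | normc (\sum_(j < m) (z - cpl (X j w))^-1 + v) <= t] =
    [set w | F w ^+ 2 + G w ^+ 2 <= t ^+ 2].
  apply/seteqP; split => w /=;
  by rewrite -(@ler_pXn2r _ 2 _ (normc _) t) ?nnegrE ?normc_ge0// normcE sqr_sqrtr// addr_ge0 ?sqr_ge0.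
apply: measurable_set_ler => //.
apply: measurable_funD; apply: measurable_funX.
  rewrite /F; under eq_fun do rewrite Re_add Re_sum.
  apply: measurable_funD => //; apply: measurable_sum => j.
  exact: measurableT_comp mR (mX j).
rewrite /G; under eq_fun do rewrite Im_add Im_sum.
apply: measurable_funD => //; apply: measurable_sum => j.
exact: measurableT_comp mI (mX j).
Qed.

(** A complex sum dominates the real part of any of its rotations. The rotation [u] is chosen for
    each [z] so that [u / (z - x)] differs by a positive real number between [a0] and [b0]; small
    discs around these points then play the roles of [A] and [B], and neither their radius nor their
    mass depends on [z]. *)
Lemma resolvent_anticoncentration (a0 b0 : R[i]) (rho D : R) :
  a0 != b0 -> in_support a0 -> in_support b0 -> 0 < rho -> 0 < D ->
  exists2 t : R, 0 < t & forall eta, 0 < eta -> exists m0 : nat,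
    forall m z v, (m0 <= m)%N -> rho <= normc (z - a0) -> rho <= normc (z - b0) ->
    normc z <= D ->
    (P [set w | (normc (\sum_(j < m) (z - cpl (X j w))^-1 + v) <= t)%R] <= eta%:E)%E.
Proof.
move=> ab sa sb rho0 D0.
set dl := normc (a0 - b0).
have dl0 : 0 < dl by rewrite normc_gt0 subr_eq0.
set B := D + normc a0 + normc b0.
have B0 : 0 < B by rewrite !ltr_pwDl ?normc_ge0.
set k := dl / (B * B).
have k0 : 0 < k by rewrite divr_gt0// mulr_gt0.
(* [rho / 2] keeps [z] away from the discs, and [k rho^2 / 8] limits the variation of [V] from the
   centre of a disc to [k / 4], so that a gap of at least [k] between the centres leaves at least
   [k / 2] between the discs. *)
set r0 := Num.min (rho / 2) (k * rho ^+ 2 / 8).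
have r00 : 0 < r0 by rewrite lt_min !divr_gt0// mulr_gt0// exprn_gt0.
pose A := [set x | normc (cpl x - a0) <= r0].
pose A' := [set x | normc (cpl x - b0) <= r0].
have mA : measurable A by apply: measurable_disc; exact: ltW.
have mA' : measurable A' by apply: measurable_disc; exact: ltW.
pose al := Num.min (fine (mu A)) (fine (mu A')).
have fA E : measurable E -> mu E \is a fin_num by move=> mE; exact: fin_num_measure.
have al0 : 0 < al.
  by rewrite lt_min !fine_gt0 ?sa ?sb// ltey_eq fA.
have alA : (al%:E <= mu A)%E by rewrite -[leRHS]fineK ?fA// lee_fin ge_min lexx.
have alA' : (al%:E <= mu A')%E by rewrite -[leRHS]fineK ?fA// lee_fin ge_min lexx orbT.
set k2 := k + 2 / rho.
have k20 : 0 < k2 by rewrite addr_gt0// divr_gt0.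
exists k2 => // eta eta0.
have [||m0 hm0] := sum_anticoncentration mX distX indepX al0 (k1 := k / 2) (k2 := k2) _ _ eta0.
- by rewrite divr_gt0.
- have : 0 < 2 / rho by rewrite divr_gt0.
  by rewrite /k2; lra.
exists m0 => m z v mm za zb zD.
have za0 : z != a0 by rewrite -subr_eq0 -normc_gt0 (lt_le_trans rho0).
have zb0 : z != b0 by rewrite -subr_eq0 -normc_gt0 (lt_le_trans rho0).
set Dl := (z - a0)^-1 - (z - b0)^-1.
have DlE : normc Dl = dl / (normc (z - a0) * normc (z - b0)).
  by rewrite /Dl resolvent_diff// normcM normcV normcM.
have za1 : 0 < normc (z - a0) by exact: lt_le_trans za.
have zb1 : 0 < normc (z - b0) by exact: lt_le_trans zb.
have Dl1 : k <= normc Dl.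
  rewrite DlE ler_wpM2l ?(ltW dl0)// lef_pV2 ?posrE ?mulr_gt0//.
  have a00 := normc_ge0 a0; have b00 := normc_ge0 b0.
  by apply: ler_pM; rewrite ?normc_ge0// (le_trans (normcD_le _ _))// normc_opp /B; lra.
have Dl2 : normc Dl <= 2 / rho.
  rewrite /Dl (le_trans (normcD_le _ _))// normc_opp !normcV.
  have h1 : (normc (z - a0))^-1 <= rho^-1 by rewrite lef_pV2 ?posrE// (lt_le_trans rho0).
  have h2 : (normc (z - b0))^-1 <= rho^-1 by rewrite lef_pV2 ?posrE// (lt_le_trans rho0).
  by lra.
have Dl0 : Dl != 0 by rewrite -normc_gt0 (lt_le_trans k0).
have [u u1 uDl] := exists_rotation Dl0.
pose V x := complex.Re (u * (z - cpl x)^-1).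
have mV : measurable_fun setT V.
  have [mR mI] := measurable_resolvent z.
  rewrite (_ : V = fun x => complex.Re u * complex.Re (z - cpl x)^-1 -
     complex.Im u * complex.Im (z - cpl x)^-1); last by apply/funext => x; rewrite /V Re_mul.
  by apply: measurable_funB; exact: measurable_funM.
have close c x : rho <= normc (z - c) -> normc (cpl x - c) <= r0 ->
    `|V x - complex.Re (u * (z - c)^-1)| <= k / 4.
  move=> zc xc; rewrite /V -Re_sub -mulrBr.
  apply: (le_trans (normc_Re _)); rewrite normcM u1 mul1r.
  have zx : rho / 2 <= normc (z - cpl x).
    have := normc_triangle z (cpl x) c.
    have : r0 <= rho / 2 by rewrite ge_min lexx.
    lra.
  have zx0 : z != cpl x by rewrite -subr_eq0 -normc_gt0 (lt_le_trans _ zx)// divr_gt0.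
  have zc0 : z != c by rewrite -subr_eq0 -normc_gt0 (lt_le_trans rho0).
  rewrite resolvent_diff// normcM normcV normcM.
  have h1 : rho ^+ 2 / 2 <= normc (z - cpl x) * normc (z - c).
    rewrite expr2 -mulrAC; apply: ler_pM => //; last exact: ltW.
    by rewrite ltW// divr_gt0.
  have r2 : 0 < rho ^+ 2 / 2 by rewrite divr_gt0// exprn_gt0.
  rewrite ler_pdivrMr ?(lt_le_trans r2)//.
  apply: (@le_trans _ _ (k / 4 * (rho ^+ 2 / 2))).
    by rewrite (le_trans xc)// /r0 ge_min; apply/orP; right; lra.
  by rewrite ler_wpM2l// divr_ge0// ltW.
have hV x y : A x -> A' y -> k / 2 <= V x - V y <= k2.
  move=> /(close _ _ za); rewrite ler_norml => /andP[h1 h2].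
  move=> /(close _ _ zb); rewrite ler_norml => /andP[h3 h4].
  have e : complex.Re (u * (z - a0)^-1) - complex.Re (u * (z - b0)^-1) = normc Dl.
    by rewrite -Re_sub -mulrBr -/Dl uDl.
  rewrite /k2; apply/andP; split; lra.
apply: le_trans (hm0 m V A A' (complex.Re (u * v)) mm mV mA mA' alA alA' hV).
apply: le_measure; rewrite ?inE.
- by apply: measurable_small_sum; exact: ltW.
- apply: measurable_set_ler => //; apply: measurableT_comp => //.
  apply: measurable_funD => //; apply: measurable_sum => j.
  exact: measurableT_comp mV (mX j).
- move=> w /= h; apply: le_trans h; rewrite -Re_sum -mulr_sumr -Re_add -mulrDr.
  by apply: (le_trans (normc_Re _)); rewrite normcM u1 mul1r addrC.
Qed.

End AntiConcentrationResolvent.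

End Resolvent.

(** * The potential estimate for random polynomials *)

Section Estimates.
Variable R : realType.
Implicit Types (y u z c : R[i]).

Lemma normc_subX_le y u (B : R) N : 1 <= B -> normc y <= B -> normc u <= B ->
  normc (y ^+ N - u ^+ N) <= N%:R * B ^+ N * normc (y - u).
Proof.
move=> B1 yB uB; have B0 : 0 <= B by lra.
elim: N => [|N IH]; first by rewrite !expr0 subrr normc0 !mul0r.
have -> : y ^+ N.+1 - u ^+ N.+1 = y * (y ^+ N - u ^+ N) + (y - u) * u ^+ N.
  by rewrite !exprS; ring.
rewrite (le_trans (normcD_le _ _))// !normcM normcX.
set dd := normc (y - u) in IH *; have d0 : 0 <= dd by rewrite normc_ge0.
have h1 : normc y * normc (y ^+ N - u ^+ N) <= B * (N%:R * B ^+ N * dd).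
  by apply: ler_pM; rewrite ?normc_ge0.
have h2 : dd * normc u ^+ N <= dd * B ^+ N.+1.
  rewrite ler_wpM2l//; apply: (@le_trans _ _ (B ^+ N)).
    by rewrite lerXn2r ?nnegrE ?normc_ge0.
  by rewrite exprS ler_peMl// exprn_ge0.
have -> : N.+1%:R * B ^+ N.+1 * dd = B * (N%:R * B ^+ N * dd) + dd * B ^+ N.+1.
  by rewrite -natr1 exprS; ring.
exact: lerD.
Qed.

Lemma Nroots_le2 N (w : R) y : (0 < N)%N -> 1 <= w <= 2 -> y \in Nroots N w -> normc y <= 2.
Proof.
move=> N0 /andP[w1 w2] /(Nroots_exp N0) /(congr1 (@normc R)).
rewrite normcX normc_real ger0_norm; last lra.
move=> e; rewrite leNgt; apply/negP => y2.
have : normc y <= normc y ^+ N by rewrite ler_eXnr//; lra.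
by rewrite e; lra.
Qed.

(* [|c + r y - x| >= r del / (N B ^ N)] when [w = y ^ N] is at distance [del] from [rescale x] *)
Lemma Nroots_far N (w r del : R) c x y : (0 < N)%N -> 0 < r -> 1 <= w <= 2 ->
  0 < del <= 1 ->
  y \in Nroots N w -> del <= normc (w%:C%C - rescale c r N x) ->
  r * (del / (N%:R * 3 ^+ N)) <= normc (c + r%:C%C * y - x).
Proof.
move=> N0 r0 hw /andP[d0 d1] yN; rewrite /rescale -(Nroots_exp N0 yN).
set u := (x - c) / r%:C%C => hd.
have rC : r%:C%C != 0 :> R[i] by rewrite fmorph_eq0 gt_eqF.
have -> : c + r%:C%C * y - x = r%:C%C * (y - u) by rewrite /u; field.
rewrite normcM normc_real gtr0_norm// ler_wpM2l ?(ltW r0)//.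
have N0' : 0 < N%:R :> R by rewrite ltr0n.
have P3 : 0 < 3 ^+ N :> R by rewrite exprn_gt0.
rewrite ler_pdivrMr ?mulr_gt0// [leRHS]mulrC.
have y2 := Nroots_le2 N0 hw yN.
(* In the first case [|u| <= 3], and the power map is Lipschitz on the disc of radius 3; in the
   second the bound is trivial because [del <= 1]. *)
have [yu|yu] := leP (normc (y - u)) 1.
  apply: (le_trans hd); apply: normc_subX_le; [lra|lra|].
  have := lerB_normc u y; rewrite normc_distC; lra.
apply: (le_trans d1); rewrite -[leLHS]mul1r.
apply: ler_pM => //; last exact: ltW.
rewrite -[leLHS]mul1r; apply: ler_pM => //; first by rewrite ler1n.
by rewrite exprn_ege1// ler1n.
Qed.

(** Absorbs the constants and the terms in [ln n], which [ln_nat_le] bounds by multiples of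
    [sqrt n], into [e n]. *)
Lemma eventually_sqrt_le (C e : R) : 0 < e -> 0 <= C ->
  exists n0 : nat, forall n, (n0 <= n)%N -> C + 8 * Num.sqrt n%:R <= e * n%:R.
Proof.
move=> e0 C0.
exists (Num.truncn ((16 / e) ^+ 2 + 2 * C / e)).+1 => n hn.
have : (16 / e) ^+ 2 + 2 * C / e <= n%:R.
  rewrite ltW// (lt_le_trans (truncnS_gt _))// ler_nat//.
set s := Num.sqrt n%:R; have s0 : 0 <= s by rewrite sqrtr_ge0.
have ns : n%:R = s ^+ 2 by rewrite sqr_sqrtr.
move=> h.
have q0 : 0 <= 16 / e by rewrite divr_ge0// ltW.
have q1 : 0 <= 2 * C / e by rewrite divr_ge0 ?mulr_ge0// ltW.
have h1 : 16 / e <= s.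
  by rewrite -(@ler_pXn2r _ 2) ?nnegrE// -ns; lra.
have h2 : 2 * C / e <= n%:R by have := sqr_ge0 (16 / e); lra.
rewrite ler_pdivrMr// in h1; rewrite ler_pdivrMr// in h2.
have h3 : 16 * s <= e * n%:R by rewrite ns expr2 mulrA ler_wpM2r// mulrC.
lra.
Qed.

Lemma ln_nat_le n : ln n%:R <= 2 * Num.sqrt n%:R :> R.
Proof.
case: n => [|n]; first by rewrite ln0// mulr_ge0// sqrtr_ge0.
have s0 : 0 < Num.sqrt n.+1%:R :> R by rewrite sqrtr_gt0.
rewrite -{1}[n.+1%:R](@sqr_sqrtr R)// lnXn// mulr2n.
have := ln_sublinear s0; lra.
Qed.

End Estimates.

Section RootsOfSample.
Variables (R : realType) (T : Type) (X : nat -> T -> R * R).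
Variables (k : nat -> nat) (xi : nat -> nat -> R[i]).
Local Notation cpl := (@cplx_of_pair R).

Definition sample_roots (n : nat) (w : T) : seq R[i] :=
  [seq cpl (X j w) | j <- iota 0 (n - k n)] ++ [seq xi n l | l <- iota 0 (k n)].

Lemma size_sample_roots n w : (k n <= n)%N -> size (sample_roots n w) = n.
Proof. by move=> kn; rewrite size_cat !size_map !size_iota subnK. Qed.

Lemma big_sample_roots (V : Type) (idx : V) (op : Monoid.law idx) n w (F : R[i] -> V) :
  \big[op/idx]_(x <- sample_roots n w) F x =
  op (\big[op/idx]_(j < n - k n) F (cpl (X j w))) (\big[op/idx]_(l < k n) F (xi n l)).
Proof.
rewrite big_cat !big_map; congr (op _ _).
  by rewrite -(big_mkord xpredT (fun j => F (cpl (X j w)))) /index_iota subn0.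
by rewrite -(big_mkord xpredT (fun j => F (xi n j))) /index_iota subn0.
Qed.

End RootsOfSample.

Section PotentialEvent.
Context (R : realType) d (T : measurableType d) (P : probability T R) (mu : probability (R * R)%type R).
Variables (X : nat -> T -> R * R) (k : nat -> nat) (xi : nat -> nat -> R[i]).
Hypothesis mX : forall i, measurable_fun setT (X i).
Hypothesis distX : forall i A, measurable A -> P (X i @^-1` A) = mu A.
Hypothesis indepX : mutually_independent P X.
Hypothesis hk : forall n, (k n <= n)%N.
Hypothesis hko : ((k n)%:R / n%:R : R) @[n --> \oo] --> 0.
Local Notation cpl := (@cplx_of_pair R).
Local Notation xs := (sample_roots X k xi).
Local Notation crit := (fun n w => roots_mult (\prod_(x <- xs n w) ('X - x%:P))^`()).

Lemma eventually_small_k (e : R) : 0 < e ->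
  exists n0, forall n, (n0 <= n)%N -> (k n)%:R <= e * n%:R.
Proof.
move=> e0; have /cvgr0Pnorm_lt/(_ e e0)[n0 _ h] := hko.
exists n0.+1 => n n0n; have n1 : 0 < n%:R :> R by rewrite ltr0n (leq_trans _ n0n).
have := h n (ltnW n0n); rewrite /= ger0_norm ?divr_ge0// ltr_pdivrMr// => /ltW; exact.
Qed.

Lemma eventually_large_sample (m0 : nat) : exists n0, forall n, (n0 <= n)%N -> (m0 <= n - k n)%N.
Proof.
have [|n0 h] := @eventually_small_k (2^-1); first by rewrite invr_gt0.
exists (n0 + 2 * m0)%N => n hn.
have := h n (leq_trans (leq_addr _ _) hn) => h1.
have : (2 * k n <= n)%N by rewrite -(ler_nat R) natrM; lra.
have := hk n; move: hn; lia.
Qed.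

(** By [Nroots_far], the roots of these points give [u] at a fixed distance from [a0] and [b0],
    where anticoncentration is uniform. The set does not depend on the sample. *)
Definition good_grid (a0 b0 c : R[i]) (r del : R) (N M : nat) : {set 'I_M} :=
  [set j : 'I_M | (del <= normc ((grid R M j)%:C%C - rescale c r N a0)) &&
               (del <= normc ((grid R M j)%:C%C - rescale c r N b0))]%SET.

(** Pairs of a grid point and a root are counted, so that the expectation is a plain sum of
    probabilities; the count dominates the number of grid points with at least one bad root. *)
Definition count_small (a0 b0 c : R[i]) (r del t : R) (N M n : nat) (w : T) : R :=
  \sum_(j in good_grid a0 b0 c r del N M) \sum_(y <- Nroots N (grid R M j))
    \1_[set w | normc (\sum_(x <- xs n w) (c + r%:C%C * y - x)^-1) <= t] w.

Lemma measurable_small_L n z t : 0 <= t ->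
  measurable [set w | normc (\sum_(x <- xs n w) (z - x)^-1) <= t].
Proof.
move=> t0; have := measurable_small_sum mX (n - k n) z (\sum_(l < k n) (z - xi n l)^-1) t0.
congr measurable; apply/seteqP; split => w /=; by rewrite big_sample_roots.
Qed.

(** For a fixed sample, the grid point is chosen outside [rb], which bounds [|L|] below by [t], and
    at distance at least [1 / (2 M)] from all images of roots, which bounds [|L|] above. *)
Lemma lmax_deterministic a0 b0 c r t e (N n : nat) w :
  let M := (8 * n + 8)%N in
  let del := (2 * 40 ^+ 2)^-1 in
  (0 < n)%N -> (0 < N)%N -> 0 < r -> 0 <= e ->
  expR (- (e * n%:R)) <= t ->
  ln (n%:R * (2 * M%:R * (N%:R * 3 ^+ N)) / r) <= e * n%:R ->
  count_small a0 b0 c r del t N M n w < M%:R / 4 ->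
  `|\sum_(z <- crit n w) lmax c r z - \sum_(x <- xs n w) lmax c r x|
    <= e * n%:R + ln n%:R + 76 * (2 * n%:R) / N%:R.
Proof.
move=> M del n0 N0 r0 e0 et lnu hcount.
have M0 : (0 < M)%N by rewrite /M addnS.
have M0' : 0 < M%:R :> R by rewrite ltr0n.
have N0' : 0 < N%:R :> R by rewrite ltr0n.
have sx : size (xs n w) = n by exact: size_sample_roots.
set zs := crit n w.
have sz : size zs = n.-1 by rewrite size_roots_deriv sx.
pose bs := map (rescale c r N) (xs n w ++ zs).
have sbs : (size bs)%:R <= 2 * n%:R :> R.
  rewrite size_map size_cat sx sz -natrM ler_nat; lia.
pose nr (a : R[i]) := [set j : 'I_M | normc ((grid R M j)%:C%C - rescale c r N a) < del]%SET.
pose rb := [set j in good_grid a0 b0 c r del N M | has (fun y =>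
   normc (\sum_(x <- xs n w) (c + r%:C%C * y - x)^-1) <= t) (Nroots N (grid R M j))]%SET.
have c40 a : 10 * #|nr a|%:R <= M%:R + 10 :> R.
  have := @card_grid_near R M (rescale c r N a) 40 M0; rewrite -/del -/(nr a) ltr0n => /(_ isT).
  set q := _%:R; lra.
have crb : #|rb|%:R <= count_small a0 b0 c r del t N M n w.
  rewrite -[X in X%:R]sum1_card natr_sum /count_small /rb.
  rewrite [leLHS]big_mkcond [leRHS]big_mkcond; apply: ler_sum => j _.
  rewrite inE; case: (j \in good_grid _ _ _ _ _ _ _) => //=.
  have h0 y : 0 <= \1_[set w | normc (\sum_(x <- xs n w) (c + r%:C%C * y - x)^-1) <= t] w :> R.
    by rewrite indicE.
  case: hasP => [[y yN hy]|_]; last by apply: sumr_ge0.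
  rewrite (big_rem y)//= -[leLHS]addr0 lerD//; last by apply: sumr_ge0.
  by rewrite indicE mem_set.
have cbad : #|nr a0 :|: nr b0 :|: rb|%:R <= #|nr a0|%:R + #|nr b0|%:R + #|rb|%:R :> R.
  rewrite -!natrD ler_nat (leq_trans (leq_card_setU _ _))// leq_add2r.
  exact: leq_card_setU.
have Mn : M%:R = 8 * n%:R + 8 :> R by rewrite /M natrD natrM.
(* There are at most [2 n] images, at most [M / 10 + 1] points near each of the images of [a0] and
   [b0], and fewer than [M / 4] in [rb]. Since [8 n = M - 8], four times the total is below
   [2.8 M]. *)
have [|j jbad [jfar jtau]] := @exists_good_grid R M bs (nr a0 :|: nr b0 :|: rb).
  have := c40 a0; have := c40 b0.
  move: cbad crb hcount sbs Mn.
  set A1 := #|nr a0|%:R; set A2 := #|nr b0|%:R; set A3 := #|rb|%:R; set A4 := #|_|%:R.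
  lra.
move: jbad; rewrite !inE !negb_or -!leNgt => /andP[/andP[ja jb] jr].
have hw := grid_bounds R (ltn_ord j).
set wj := grid R M j in hw jtau jfar jr ja jb.
have far x : x \in xs n w ++ zs -> (2 * M%:R)^-1 <= normc (wj%:C%C - rescale c r N x).
  move=> xin; have := jfar _ (map_f (rescale c r N) xin).
  by rewrite -[_^-1]mulr1 ler_pdivrMl ?mulr_gt0.
rewrite -[X in ln X%:R](sx).
apply: (@lmax_deriv_roots R (xs n w) c r N wj) => //.
- by rewrite sx.
- move=> x /far h; rewrite -subr_eq0 -normc_gt0 (lt_le_trans _ h)// invr_gt0 mulr_gt0//.
- by rewrite -(big_map (rescale c r N) xpredT (fun b => `|tau wj b|)) (le_trans jtau)// ler_wpM2l.
move=> y yN.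
set L := normc _.
have Lt : t < L.
  rewrite ltNge; apply/negP => hL.
  move/negP: jr; apply; apply/andP; split; first by rewrite ?inE ?ja ?jb.
  by apply/hasP; exists y.
have L0 : 0 < L by rewrite (lt_trans _ Lt)// (lt_le_trans (expR_gt0 _) et).
have Lup : L <= n%:R * (2 * M%:R * (N%:R * 3 ^+ N)) / r.
  rewrite /L (le_trans (normc_sum _ _))//.
  apply: (@le_trans _ _ (\sum_(x <- xs n w) (2 * M%:R * (N%:R * 3 ^+ N) / r))); last first.
    by rewrite sumr_cst_seq sx [leLHS]mulrA.
  rewrite big_seq [leRHS]big_seq; apply: ler_sum => x xin.
  have M2 : 0 < 2 * M%:R :> R by rewrite mulr_gt0.
  have d1 : 0 < ((2 * M%:R)^-1 : R) <= 1.
    rewrite invr_gt0 M2 /= invf_le1//.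
    have : 1 <= M%:R :> R by rewrite ler1n.
    lra.
  have xin' : x \in xs n w ++ zs by rewrite mem_cat xin.
  have := Nroots_far N0 r0 hw d1 yN (far x xin').
  set q := r * _ => hq.
  have q0 : 0 < q by rewrite mulr_gt0// divr_gt0 ?mulr_gt0 ?exprn_gt0//; case/andP: d1.
  rewrite normcV; apply: (@le_trans _ _ q^-1).
    by rewrite lef_pV2 ?posrE// (lt_le_trans q0).
  rewrite /q le_eqVlt; apply/orP; left; apply/eqP; field.
  by rewrite !gt_eqF ?exprn_gt0.
rewrite ler_norml; apply/andP; split; last first.
  by apply: le_trans lnu; rewrite ler_ln// posrE (lt_le_trans L0).
rewrite -[leLHS]expRK ler_ln ?posrE ?expR_gt0//.
by rewrite (le_trans et)// ltW.
Qed.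

Lemma bmeas_count_small a0 b0 c r del t N M n : 0 <= t ->
  bmeas (count_small a0 b0 c r del t N M n).
Proof.
move=> t0; apply: bmeas_sum => j; apply: bmeas_sum => y.
by apply: bmeas_indic; exact: measurable_small_L.
Qed.

Lemma lmax_event a0 b0 c r e eta : a0 != b0 ->
  in_support mu a0 -> in_support mu b0 -> 0 < r -> 0 < e -> 0 < eta ->
  exists n0 : nat, forall n, (n0 <= n)%N -> exists E : set T,
    [/\ measurable E, (P E <= eta%:E)%E & forall w, ~ E w ->
    `|\sum_(z <- crit n w) lmax c r z - \sum_(x <- xs n w) lmax c r x| <= e * n%:R].
Proof.
move=> ab sa sb r0 e0 eta0.
(* The grid error is [76 * 2 n / N], and [16 * 38 = 4 * 152] makes it at most [e n / 4]. *)
pose N := (Num.truncn (16 * 38 / e)).+1.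
have N0 : (0 < N)%N by [].
have N0' : 0 < N%:R :> R by rewrite ltr0n.
have Ne : 16 * 38 / e < N%:R by exact: truncnS_gt.
pose del : R := (2 * 40 ^+ 2)^-1.
have d0 : 0 < del by rewrite invr_gt0 mulr_gt0// exprn_gt0.
have d1 : del <= 1 by rewrite invf_le1 ?mulr_gt0 ?exprn_gt0//; lra.
pose rho := r * (del / (N%:R * 3 ^+ N)).
have rho0 : 0 < rho by rewrite mulr_gt0// divr_gt0// mulr_gt0// exprn_gt0.
pose D := normc c + r * 2.
have D0 : 0 < D by rewrite ltr_wpDl ?normc_ge0// mulr_gt0.
have [t t0 ht] := resolvent_anticoncentration mX distX indepX ab sa sb rho0 D0.
(* The [N] roots over one grid point then contribute at most [eta / 4] to the expected count, so
   Markov's inequality at level [M / 4] yields [eta]. *)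
have [|m0 hm0] := ht (eta / (4 * N%:R)); first by rewrite divr_gt0// mulr_gt0.
have [n1 hn1] := eventually_large_sample m0.
have e4 : 0 < e / 4 by rewrite divr_gt0.
pose Cc : R := N%:R * 3 ^+ N / r.
have Cc0 : 0 < Cc by rewrite divr_gt0// mulr_gt0// exprn_gt0.
have [n2 hn2] := eventually_sqrt_le e4 (normr_ge0 (ln (2 * 16 * Cc))).
have [n3 hn3] := eventually_sqrt_le e4 (normr_ge0 (ln t)).
exists (maxn (maxn n1 n2) (maxn n3 1)) => n.
rewrite !geq_max => /andP[/andP[/hn1 {}hn1 /hn2 {}hn2] /andP[/hn3 {}hn3 n0]].
have sn0 : 0 <= Num.sqrt n%:R :> R by rewrite sqrtr_ge0.
have n0' : 0 < n%:R :> R by rewrite ltr0n.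
pose M := (8 * n + 8)%N.
have M0' : 0 < M%:R :> R by rewrite ltr0n /M addnS.
pose F := count_small a0 b0 c r del t N M n.
have bF : bmeas F by apply: bmeas_count_small; exact: ltW.
have F0 w : 0 <= F w.
  by apply: sumr_ge0 => j _; apply: sumr_ge0 => y _; rewrite indicE.
exists [set w | M%:R / 4 <= F w]; split.
- by apply: measurable_set_ler => //; case: bF.
- apply: (le_trans (Ex_markov P bF F0 _)); first by rewrite divr_gt0.
  rewrite lee_fin ler_pdivrMr ?divr_gt0//.
  rewrite /F /count_small Ex_sum; last first.
    move=> j; apply: bmeas_sum => y; apply: bmeas_indic.
    by apply: measurable_small_L; exact: ltW.
  apply: (@le_trans _ _ (\sum_(j in good_grid a0 b0 c r del N M) (N%:R * (eta / (4 * N%:R))))); last first.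
    rewrite sumr_const -[leLHS]mulr_natl.
    have : #|good_grid a0 b0 c r del N M|%:R <= M%:R :> R.
      by rewrite ler_nat (leq_trans (max_card _))// card_ord.
    have -> : N%:R * (eta / (4 * N%:R)) = eta / 4 by field; rewrite gt_eqF.
    set q := _%:R => qM.
    rewrite (_ : eta * (M%:R / 4) = M%:R * (eta / 4)); last by ring.
    by rewrite ler_wpM2r// divr_ge0// ltW.
  apply: ler_sum => j; rewrite inE => /andP[ja jb].
  have hw := grid_bounds R (ltn_ord j).
  rewrite Ex_sum; last first.
    by move=> y; apply: bmeas_indic; apply: measurable_small_L; exact: ltW.
  have -> : N%:R * (eta / (4 * N%:R)) = \sum_(y <- Nroots N (grid R M j)) (eta / (4 * N%:R)).
    by rewrite sumr_cst_seq size_Nroots.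
  rewrite big_seq [leRHS]big_seq; apply: ler_sum => y yN.
  have mS := measurable_small_L n (c + r%:C%C * y) (ltW t0).
  rewrite (Ex_indic P mS) -lee_fin fineK ?fin_num_measure//.
  have := hm0 (n - k n)%N (c + r%:C%C * y) (\sum_(l < k n) (c + r%:C%C * y - xi n l)^-1) hn1.
  have dd : 0 < del <= 1 by rewrite d0 d1.
  have h1 := Nroots_far N0 r0 hw dd yN ja.
  have h2 := Nroots_far N0 r0 hw dd yN jb.
  have h3 : normc (c + r%:C%C * y) <= D.
    rewrite (le_trans (normcD_le _ _))// lerD2l normcM normc_real gtr0_norm//.
    by rewrite ler_pM2l// (Nroots_le2 N0 hw yN).
  move=> /(_ h1 h2 h3) h4; apply: (le_trans _ h4).
  rewrite le_eqVlt; apply/orP; left; apply/eqP; congr (P _).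
  by apply/seteqP; split => w /=; rewrite big_sample_roots.
- move=> w /= /negP; rewrite -ltNge => hF.
  have := @lmax_deterministic a0 b0 c r t (e / 4) N n w n0 N0 r0 (ltW e4).
  have s8 : 0 <= 8 * Num.sqrt n%:R :> R by rewrite mulr_ge0.
  have et : expR (- (e / 4 * n%:R)) <= t.
    rewrite -[leRHS]lnK ?posrE// ler_expR lerNl.
    have := ler_norm (- ln t); rewrite normrN; lra.
  have lnn := @ln_nat_le R n.
  have up : ln (n%:R * (2 * M%:R * (N%:R * 3 ^+ N)) / r) <= e / 4 * n%:R.
    apply: (@le_trans _ _ (ln (2 * 16 * Cc * n%:R ^+ 2))).
      have nn : 1 <= n%:R :> R by rewrite ler1n.
      have Mn : M%:R = 8 * n%:R + 8 :> R by rewrite /M natrD natrM.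
      rewrite (_ : n%:R * (2 * M%:R * (N%:R * 3 ^+ N)) / r = 2 * Cc * n%:R * M%:R); last first.
        by rewrite /Cc; ring.
      have p2 : 0 < 2 * Cc * n%:R by apply: mulr_gt0 => //; exact: mulr_gt0.
      have p3 : 0 < 2 * 16 * Cc * n%:R ^+ 2.
        by apply: mulr_gt0; [exact: mulr_gt0|exact: exprn_gt0].
      rewrite ler_ln ?posrE//; last exact: mulr_gt0.
      rewrite (_ : 2 * 16 * Cc * n%:R ^+ 2 = 2 * Cc * n%:R * (16 * n%:R)); last by ring.
      by rewrite ler_wpM2l ?(ltW p2)//; lra.
    have p4 : 0 < 2 * 16 * Cc by exact: mulr_gt0.
    rewrite lnM ?posrE ?exprn_gt0// lnXn// mulr2n.
    have := ler_norm (ln (2 * 16 * Cc)); lra.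
  move=> /(_ et up hF) /le_trans; apply.
  have : 76 * (2 * n%:R) / N%:R <= e / 4 * n%:R.
    rewrite ler_pdivrMr//; rewrite ltr_pdivrMr// in Ne.
    rewrite (_ : e / 4 * n%:R * N%:R = N%:R * e * (n%:R / 4)); last by ring.
    apply: (@le_trans _ _ (16 * 38 * (n%:R / 4))); first by lra.
    by rewrite ler_wpM2r ?ltW// divr_gt0.
  have := normr_ge0 (ln (2 * 16 * Cc)).
  have := mulr_gt0 e0 n0'.
  lra.
Qed.

End PotentialEvent.

(** * Approximation by logarithmic bumps *)

Section UniformContinuity.
Variable R : realType.

(** Only [u] is confined to the box: [v] will be a lattice point, possibly outside it. *)
Lemma unif_continuous_box (f : R * R -> R) (A om : R) : continuous f -> 0 < om ->
  exists2 e : R, 0 < e & forall u v : R * R, `|u.1| <= A -> `|u.2| <= A ->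
    `|u.1 - v.1| < e -> `|u.2 - v.2| < e -> `|f u - f v| < om.
Proof.
move=> cf om0.
have cK : compact (`[-A, A]%classic `*` `[-A, A]%classic : set (R * R)).
  by apply: compact_setX; exact: segment_compact.
pose Q (e : R) (u : R * R) := forall v : R * R, `|u.1 - v.1| < e -> `|u.2 - v.2| < e -> `|f u - f v| < om.
have /compact_near_coveringP/(_ R (0^'+) Q _) := cK.
have h : forall x, (`[-A, A]%classic `*` `[-A, A]%classic) x -> \forall x' \near x & i \near 0^'+, Q i x'.
  move=> x _; have om2 : 0 < om / 2 by rewrite divr_gt0.
  have /cvgrPdist_lt/(_ _ om2) := cf x.
  move=> /nbhs_ballP hb.
  have [e e0 he] : exists2 e : R, 0 < e &
      forall y : R * R, `|x.1 - y.1| < e -> `|x.2 - y.2| < e -> `|f x - f y| < om / 2.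
    by case: hb => e /= e0 he; exists e => // y h1 h2; apply: he; split.
  have e2 : 0 < e / 2 by rewrite divr_gt0.
  near=> u i => v /= uv1 uv2.
  have [bu1 bu2] : ball x (e / 2) u by near: u; exact: nbhsx_ballx.
  have {}bu1 : `|x.1 - u.1| < e / 2 := bu1.
  have {}bu2 : `|x.2 - u.2| < e / 2 := bu2.
  have ie : i < e / 2 by near: i; exact: nbhs_right_lt.
  have h1 : `|f x - f u| < om / 2 by apply: he; lra.
  have h2 : `|f x - f v| < om / 2.
    apply: he.
      by rewrite -(subrKA u.1) (le_lt_trans (ler_normD _ _))//; lra.
    by rewrite -(subrKA u.2) (le_lt_trans (ler_normD _ _))//; lra.
  rewrite -(subrKA (f x)) (le_lt_trans (ler_normD _ _))// distrC; lra.
move=> /(_ h) hn.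
near (0 : R)^'+ => e.
exists e; first by near: e; exact: nbhs_right_gt.
move=> u v u1 u2; have hQ : (`[-A, A]%classic `*` `[-A, A]%classic) `<=` Q e by near: e.
by apply: hQ; split; rewrite /= in_itv /= -ler_norml.
Unshelve. all: by end_near. Qed.

End UniformContinuity.

Section Bump.
Variable R : realType.
Implicit Types (a b x y r : R).
Local Notation cpl := (@cplx_of_pair R).

Lemma normc_pair_ge1 a b : `|a| <= normc (cpl (a, b)).
Proof. exact: (normc_Re (cpl (a, b))). Qed.

Lemma normc_pair_ge2 a b : `|b| <= normc (cpl (a, b)).
Proof. exact: (normc_Im (cpl (a, b))). Qed.

Lemma normc_pair_le a b : normc (cpl (a, b)) <= `|a| + `|b|.
Proof. exact: (normc_le_ReIm (cpl (a, b))). Qed.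

Lemma ln_lip (r s t : R) : 0 < r -> r <= s -> r <= t -> `|ln s - ln t| <= `|s - t| / r.
Proof.
move=> r0; have h : forall s t, r <= s -> r <= t -> ln s - ln t <= `|s - t| / r.
  move=> {}s {}t rs rt; have t0 : 0 < t by lra.
  have s0 : 0 < s by lra.
  rewrite -ln_div ?posrE//.
  have -> : s / t = 1 + (s - t) / t by field; rewrite gt_eqF.
  apply: (@le_trans _ _ ((s - t) / t)).
    by apply: le_ln1Dx; rewrite ltr_pdivlMr// mulN1r; lra.
  apply: (@le_trans _ _ (`|s - t| / t)); first by rewrite ler_pM2r ?invr_gt0// ler_norm.
  by rewrite ler_wpM2l// lef_pV2 ?posrE.
move=> rs rt; rewrite ler_norml; apply/andP; split; last exact: h.
by have := h t s rt rs; rewrite distrC; lra.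
Qed.

Lemma max_lip (r s t : R) : `|Num.max r s - Num.max r t| <= `|s - t|.
Proof.
have := ler_norm (s - t); have := ler_norm (t - s); rewrite (distrC t s) => h1 h2.
by rewrite /Num.max ler_norml; case: ifPn; rewrite -?leNgt => ?; case: ifPn; rewrite -?leNgt => ?;
  apply/andP; split; lra.
Qed.

(** Constant [ln 2] up to radius [r] and zero from [2 r] on; taking the difference cancels the
    growth of [lmax] at infinity. *)
Definition bump r a b : R :=
  ln (Num.max (2 * r) (normc (cpl (a, b)))) - ln (Num.max r (normc (cpl (a, b)))).

Lemma bump_lmax r (c z : R * R) :
  bump r (z.1 - c.1) (z.2 - c.2) = lmax (cpl c) (2 * r) (cpl z) - lmax (cpl c) r (cpl z).
Proof. by []. Qed.

Lemma bump_ge0 r a b : 0 < r -> 0 <= bump r a b.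
Proof.
move=> r0; rewrite /bump subr_ge0 ler_ln ?posrE ?lt_max ?mulr_gt0 ?r0//.
by rewrite ge_max !le_max lexx orbT andbT; apply/orP; left; lra.
Qed.

Lemma bump_le r a b : 0 < r -> bump r a b <= ln 2.
Proof.
move=> r0; rewrite /bump; set s := normc _.
have h1 : r <= Num.max r s by rewrite le_max lexx.
have h2 : s <= Num.max r s by rewrite le_max lexx orbT.
have m0 : 0 < Num.max r s by lra.
have p1 : 0 < Num.max (2 * r) s by rewrite lt_max mulr_gt0.
have p2 : 0 < 2 * Num.max r s by rewrite mulr_gt0.
have p3 : 0 < 2 :> R by [].
rewrite lerBlDr -lnM ?posrE// ler_ln ?posrE//.
by rewrite ge_max; apply/andP; split; lra.
Qed.

Lemma bump_eq0 r a b : 0 < r -> 2 * r <= `|a| \/ 2 * r <= `|b| -> bump r a b = 0.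
Proof.
move=> r0 h; have h2 : 2 * r <= normc (cpl (a, b)).
  by case: h => h; apply: (le_trans h); [exact: normc_pair_ge1|exact: normc_pair_ge2].
by rewrite /bump !max_r ?subrr//; lra.
Qed.

Lemma bump_plateau r a b : 0 < r -> `|a| + `|b| <= r -> bump r a b = ln 2.
Proof.
move=> r0 h; have h2 := le_trans (normc_pair_le a b) h.
by rewrite /bump !max_l; [rewrite lnM ?posrE// addrK| |]; lra.
Qed.

Lemma bump_lip r a b a' b' : 0 < r ->
  `|bump r a b - bump r a' b'| <= 2 / r * (`|a - a'| + `|b - b'|).
Proof.
move=> r0; rewrite /bump.
set s := normc (cpl (a, b)); set t := normc (cpl (a', b')).
have st : `|s - t| <= `|a - a'| + `|b - b'|.
  apply: le_trans (normc_pair_le _ _).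
  rewrite (_ : cpl (a - a', b - b') = cpl (a, b) - cpl (a', b'))//.
  rewrite ler_norml lerNl opprB lerB_normc andbT normc_distC.
  exact: lerB_normc.
have r2 : 0 < 2 * r by rewrite mulr_gt0.
have h1 : `|ln (Num.max (2 * r) s) - ln (Num.max (2 * r) t)| <= `|s - t| / (2 * r).
  apply: (le_trans (ln_lip r2 _ _)); rewrite ?le_max ?lexx//.
  by rewrite ler_pM2r ?invr_gt0// max_lip.
have h2 : `|ln (Num.max r s) - ln (Num.max r t)| <= `|s - t| / r.
  apply: (le_trans (ln_lip r0 _ _)); rewrite ?le_max ?lexx//.
  by rewrite ler_pM2r ?invr_gt0// max_lip.
have h3 : `|s - t| / (2 * r) + `|s - t| / r <= 2 / r * `|s - t|.
  rewrite (_ : `|s - t| / (2 * r) = `|s - t| / r / 2); last by field; rewrite gt_eqF.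
  have : 0 <= `|s - t| / r by rewrite divr_ge0// ltW.
  by lra.
apply: (@le_trans _ _ (2 / r * `|s - t|)); last by rewrite ler_wpM2l// divr_ge0// ltW.
apply: le_trans h3; rewrite (_ : forall p q u v : R, p - q - (u - v) = (p - u) - (q - v)); last by move=> *; ring.
by rewrite (le_trans (ler_normB _ _))// lerD.
Qed.

(* The number of integers within distance [L] of [s] is at most [2 L + 1], by telescoping a clamp. *)
Lemma sum_window (n : nat) (s L : R) : 0 <= L ->
  \sum_(i < n) (if `|i%:R - s| < L then 1 else 0) <= 2 * L + 1.
Proof.
move=> L0; pose g (u : R) := Num.max (- L) (Num.min (u - s) (L + 1)).
have g1 u : g u <= L + 1.
  by rewrite /g ge_max; apply/andP; split; [lra|rewrite ge_min lexx orbT].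
have g2 u : - L <= g u by rewrite /g le_max lexx.
have step (i : nat) : (if `|i%:R - s| < L then 1 else 0) <= g i.+1%:R - g i%:R.
  rewrite -natr1 /g; set u : R := i%:R.
  case: ifPn => [|_].
    rewrite ltr_norml => /andP[h1 h2].
    by case: (leP (u + 1 - s) (L + 1)) => ?; case: (leP (u - s) (L + 1)) => ?; rewrite !max_r; lra.
  case: (leP (u + 1 - s) (L + 1)) => ?; case: (leP (u - s) (L + 1)) => ?;
  by rewrite subr_ge0 ge_max !le_max lexx /=; apply/orP; right; lra.
apply: (@le_trans _ _ (\sum_(i < n) (g i.+1%:R - g i%:R))); first by apply: ler_sum => i _.
rewrite -(big_mkord xpredT (fun i => g i.+1%:R - g i%:R)) telescope_sumr//.
by have := g1 n%:R; have := g2 0%:R; lra.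
Qed.

End Bump.

(** * Sums of bumps over square lattices *)

Section Lattice.
Variable R : realType.
Local Notation cpl := (@cplx_of_pair R).

Lemma sum_shift (G : nat -> R) (n p W : nat) : (W <= p)%N -> (p + W < n)%N ->
  (forall i, (i < p - W)%N || (p + W < i)%N -> G i = 0) ->
  \sum_(i < n) G i = \sum_(a < (2 * W).+1) G (p - W + a)%N.
Proof.
move=> Wp pWn G0.
rewrite -(big_mkord xpredT G) (@big_cat_nat _ _ _ (p - W)%N)//=; last first.
  by rewrite (leq_trans (leq_subr _ _))// (leq_trans _ (ltnW pWn))// leq_addr.
rewrite big_nat_cond big1 ?add0r; last by move=> i /andP[/andP[_ h] _]; rewrite G0// h.
rewrite (@big_cat_nat _ _ _ (p + W).+1)//=; last first.
  by rewrite (leq_trans (leq_subr _ _))// (leq_trans (leq_addr W p))// leqnSn.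
rewrite [X in _ + X]big_nat_cond [X in _ + X]big1 ?addr0; last first.
  by move=> i /andP[/andP[h _] _]; rewrite G0// h orbT.
rewrite -{1}[(p - W)%N]add0n big_addn.
have -> : ((p + W).+1 - (p - W) = (2 * W).+1)%N by lia.
by rewrite big_mkord; apply: eq_bigr => i _; rewrite addnC.
Qed.

Lemma sum_sub_le (G : nat -> R) (n u v : nat) : (u <= v)%N -> (v <= n)%N ->
  (forall i, 0 <= G i) -> \sum_(u <= i < v) G i <= \sum_(i < n) G i.
Proof.
move=> uv vn G0; rewrite -(big_mkord xpredT G).
rewrite [leRHS](@big_cat_nat _ _ _ u)//=; last exact: leq_trans vn.
rewrite [X in _ <= _ + X](@big_cat_nat _ _ _ v)//=.
have h1 : 0 <= \sum_(0 <= i < u) G i by apply: sumr_ge0.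
have h2 : 0 <= \sum_(v <= i < n) G i by apply: sumr_ge0.
lra.
Qed.

Variables (r : R) (q : nat).
Hypotheses (r0 : 0 < r) (q0 : (0 < q)%N).
Let del := r / (2 * q%:R).
Let W := (6 * q)%N.

Let q0' : 0 < q%:R :> R. Proof. by rewrite ltr0n. Qed.
Let del0 : 0 < del. Proof. by rewrite divr_gt0// mulr_gt0. Qed.
Let norm_del u : `|u * del| = `|u| * del. Proof. by rewrite normrM (gtr0_norm del0). Qed.

Definition lat_pt (K i : nat) : R := (i%:R - K%:R) * (r / (2 * q%:R)).

Definition lat_sum (K : nat) (x y : R) : R :=
  \sum_(i < (2 * K).+1) \sum_(j < (2 * K).+1) bump r (x - lat_pt K i) (y - lat_pt K j).

(** The lattice sum seen from a lattice point, which all interior values of [lat_sum] approximate.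
    The window of [6 q] steps has half-width [3 r], leaving room beyond the support radius [2 r] for
    a shift by one mesh. *)
Definition lat_norm : R :=
  \sum_(a < (2 * (6 * q)).+1) \sum_(b < (2 * (6 * q)).+1)
    bump r (- lat_pt (6 * q) a) (- lat_pt (6 * q) b).

Let ln20 : 0 < ln 2 :> R. Proof. by rewrite ln_gt0// ltr1n. Qed.

(** One quadrant of the plateau already contains [q * q] lattice points. The quadratic order
    matters: the error of [lat_sum] in the interior is only linear in [q]. *)
Lemma lat_norm_ge : q%:R ^+ 2 * ln 2 <= lat_norm.
Proof.
rewrite /lat_norm.
have Wq : (W + q <= (2 * W).+1)%N by rewrite /W; lia.
pose H a b := bump r (- lat_pt W a) (- lat_pt W b).
have inner a : (W <= a < W + q)%N -> q%:R * ln 2 <= \sum_(b < (2 * W).+1) H a b.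
  move=> /andP[a1 a2].
  apply: (le_trans _ (sum_sub_le (G := H a) (leq_addr q W) Wq (fun b => bump_ge0 _ _ r0))).
  apply: (@le_trans _ _ (\sum_(W <= b < W + q) ln 2)).
    by rewrite sumr_const_nat addKn mulr_natl.
  rewrite big_nat_cond [leRHS]big_nat_cond; apply: ler_sum => b /andP[/andP[b1 b2] _].
  rewrite /H bump_plateau// !normrN /lat_pt -/del !norm_del -mulrDl.
  rewrite -!natrB// !normr_nat.
  have -> : r = (q%:R + q%:R) * del by rewrite /del; field; rewrite gt_eqF.
  rewrite ler_wpM2r ?(ltW del0)//.
  by apply: lerD; rewrite ler_nat leq_subLR ltnW.
have S0 a : 0 <= \sum_(b < (2 * W).+1) H a b by apply: sumr_ge0 => b _; exact: bump_ge0.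
apply: (le_trans _ (sum_sub_le (leq_addr q W) Wq S0)).
apply: (@le_trans _ _ (\sum_(W <= a < W + q) (q%:R * ln 2))).
  by rewrite sumr_const_nat addKn -[leRHS]mulr_natl mulrA.
by rewrite big_nat_cond [leRHS]big_nat_cond; apply: ler_sum => a /andP[h _]; exact: inner.
Qed.

Lemma lat_norm_gt0 : 0 < lat_norm.
Proof. by apply: lt_le_trans lat_norm_ge; rewrite mulr_gt0// exprn_gt0. Qed.

(** In each coordinate at most [8 q + 1 <= 9 q] indices meet the support of a bump. The bound holds
    in the whole plane, which serves outside the box of approximation. *)
Lemma lat_sum_le K x y : lat_sum K x y <= (9 * 9) * lat_norm.
Proof.
apply: (@le_trans _ _ ((9 * q%:R) ^+ 2 * ln 2)); last first.
  rewrite (_ : (9 * q%:R) ^+ 2 * ln 2 = 9 * 9 * (q%:R ^+ 2 * ln 2)); last by ring.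
  by rewrite ler_wpM2l ?mulr_ge0//; exact: lat_norm_ge.
pose L : R := 4 * q%:R.
have Ldel : L * del = 2 * r by rewrite /L /del; field; rewrite gt_eqF.
pose cnt (s : R) (i : nat) : R := if `|i%:R - s| < L then 1 else 0.
have cnt0 s i : 0 <= cnt s i by rewrite /cnt; case: ifP.
have far (u : R) (i : nat) : cnt (u / del + K%:R) i = 0 -> 2 * r <= `|u - lat_pt K i|.
  rewrite /cnt; case: ifPn => [_ /eqP|]; first by rewrite oner_eq0.
  rewrite -leNgt => h _; rewrite -Ldel.
  have -> : u - lat_pt K i = - ((i%:R - (u / del + K%:R)) * del).
    by rewrite /lat_pt -/del; field; rewrite gt_eqF.
  by rewrite normrN norm_del ler_wpM2r// ltW.
have one (u : R) (i : nat) : cnt u i = 0 \/ cnt u i = 1 by rewrite /cnt; case: ifP; [right|left].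
have term i j : bump r (x - lat_pt K i) (y - lat_pt K j) <=
    cnt (x / del + K%:R) i * (cnt (y / del + K%:R) j * ln 2).
  have [e1|e1] := one (x / del + K%:R) i.
    by rewrite bump_eq0 ?e1 ?mul0r//; left; exact: far.
  have [e2|e2] := one (y / del + K%:R) j.
    by rewrite bump_eq0 ?e2 ?mul0r ?mulr0//; right; exact: far.
  by rewrite e1 e2 !mul1r bump_le.
have tot s : \sum_(i < (2 * K).+1) cnt s i <= 9 * q%:R.
  have := @sum_window R (2 * K).+1 s L; rewrite /cnt => h.
  have q1 : 1 <= q%:R :> R by rewrite ler1n.
  by apply: (le_trans (h _)); rewrite /L; lra.
apply: (@le_trans _ _ (\sum_(i < (2 * K).+1) \sum_(j < (2 * K).+1)
    (cnt (x / del + K%:R) i * (cnt (y / del + K%:R) j * ln 2)))).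
  by apply: ler_sum => i _; apply: ler_sum => j _.
under eq_bigr do rewrite -mulr_sumr -mulr_suml.
rewrite -mulr_suml mulrA expr2 ler_wpM2r ?(ltW ln20)//.
by apply: ler_pM => //; apply: sumr_ge0.
Qed.

Lemma lat_nearest K x Rad : `|x| <= Rad -> Rad / del + (6 * q).+1%:R <= K%:R ->
  exists p : nat, [/\ (6 * q <= p)%N, (p + 6 * q < (2 * K).+1)%N & `|x - lat_pt K p| <= del].
Proof.
move=> xR hK; have xR' : `|x / del| <= Rad / del.
  by rewrite normrM normfV (gtr0_norm del0) ler_pM2r// invr_gt0.
have [x1 x2] : - (Rad / del) <= x / del /\ x / del <= Rad / del by apply/andP; rewrite -ler_norml.
set s := x / del + K%:R.
have W0 : 0 <= (6 * q)%:R :> R by [].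
rewrite -natr1 in hK.
have s0 : 0 <= s by rewrite /s; lra.
have /andP[p1 p2] := truncn_itv s0.
exists (Num.truncn s); split.
- by rewrite -ltnS -(ltr_nat R); apply: le_lt_trans p2; rewrite /s; lra.
- rewrite -(ltr_nat R) natrD -natr1 natrM; rewrite /s in p1; lra.
- have -> : x - lat_pt K (Num.truncn s) = (s - (Num.truncn s)%:R) * del.
    by rewrite /lat_pt -/del /s; field; rewrite gt_eqF.
  rewrite norm_del -[leRHS]mul1r ler_wpM2r ?(ltW del0)//.
  by rewrite -natr1 in p2; rewrite ger0_norm; lra.
Qed.

(** Recentring at a lattice point within one mesh moves each coordinate by at most [del], hence each
    bump by at most [2 / q]; at most [(12 q + 1)^2 <= (13 q)^2] terms are involved. *)
Lemma lat_sum_interior K x y Rad : `|x| <= Rad -> `|y| <= Rad ->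
  Rad / del + (6 * q).+1%:R <= K%:R ->
  `|lat_sum K x y - lat_norm| <= 2 * (13 * 13) * q%:R.
Proof.
move=> xR yR hK.
have [p [p1 p2 p3]] := lat_nearest xR hK.
have [p' [p'1 p'2 p'3]] := lat_nearest yR hK.
have farpt (u : R) (c i : nat) : `|u - lat_pt K c| <= del -> (W <= c)%N ->
    (i < c - W)%N || (c + W < i)%N -> 2 * r <= `|u - lat_pt K i|.
  move=> uc Wc h.
  have h2 : (W.+1)%:R * del <= `|lat_pt K c - lat_pt K i|.
    rewrite /lat_pt -/del -mulrBl norm_del ler_wpM2r ?(ltW del0)//.
    rewrite (_ : c%:R - K%:R - (i%:R - K%:R) = c%:R - i%:R); last by ring.
    case/orP: h => h.
      rewrite -natrB; last by rewrite (leq_trans (ltnW h))// leq_subr.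
      by rewrite normr_nat ler_nat; move: h Wc; clear; lia.
    rewrite distrC -natrB; last by rewrite (leq_trans _ (ltnW h))// leq_addr.
    by rewrite normr_nat ler_nat; move: h; clear; lia.
  have h3 : W%:R * del = 3 * r.
    by rewrite /W /del natrM; field; rewrite gt_eqF.
  have h4 := ler_distD u (lat_pt K c) (lat_pt K i).
  rewrite (distrC _ u) in h4.
  rewrite -natr1 mulrDl mul1r h3 in h2.
  by move: h2 h4 uc r0; clear; move: (`|lat_pt K c - lat_pt K i|) (`|u - lat_pt K c|) (`|u - lat_pt K i|) del => *; lra.
have -> : lat_sum K x y = \sum_(a < (2 * W).+1) \sum_(b < (2 * W).+1)
    bump r (x - lat_pt K (p - W + a)%N) (y - lat_pt K (p' - W + b)%N).
  rewrite /lat_sum.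
  rewrite (sum_shift (G := fun i => \sum_(j < (2 * K).+1) bump r (x - lat_pt K i) (y - lat_pt K j)) p1 p2); last first.
    move=> i hi; apply: big1 => j _; apply: bump_eq0 => //; left.
    exact: farpt p3 p1 hi.
  apply: eq_bigr => a _.
  apply: (sum_shift (G := fun j => bump r _ (y - lat_pt K j)) p'1 p'2).
  by move=> j hj; apply: bump_eq0 => //; right; exact: farpt p'3 p'1 hj.
have shift c (a : nat) : (W <= c)%N -> lat_pt K (c - W + a)%N = lat_pt K c + lat_pt W a.
  by move=> Wc; rewrite /lat_pt natrD natrB//; ring.
rewrite /lat_norm -sumrB (le_trans (ler_norm_sum _ _ _))//.
have term a b : `|bump r (x - lat_pt K (p - W + a)%N) (y - lat_pt K (p' - W + b)%N) -
    bump r (- lat_pt W a) (- lat_pt W b)| <= 2 / q%:R.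
  apply: (le_trans (bump_lip _ _ _ _ r0)); rewrite !shift//.
  rewrite (_ : x - (lat_pt K p + lat_pt W a) - - lat_pt W a = x - lat_pt K p); last by ring.
  rewrite (_ : y - (lat_pt K p' + lat_pt W b) - - lat_pt W b = y - lat_pt K p'); last by ring.
  have -> : 2 / q%:R = 2 / r * (del + del) by rewrite /del; field; rewrite !gt_eqF.
  by apply: ler_wpM2l; [rewrite divr_ge0// ltW|exact: lerD].
apply: (@le_trans _ _ (\sum_(a < (2 * W).+1) \sum_(b < (2 * W).+1) (2 / q%:R))).
  apply: ler_sum => a _; rewrite -sumrB (le_trans (ler_norm_sum _ _ _))//.
  by apply: ler_sum => b _; exact: term.
rewrite !sumr_const !card_ord -mulrnA -[leLHS]mulr_natl.
have W13 : (2 * W).+1%:R <= 13 * q%:R :> R.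
  rewrite -natrM ler_nat /W; move: q0; clear; lia.
rewrite natrM mulrA ler_pdivrMr//.
have : (2 * W).+1%:R * (2 * W).+1%:R <= (13 * q%:R) * (13 * q%:R) :> R by apply: ler_pM.
by lra.
Qed.

End Lattice.

Section Approximation.
Variable R : realType.
Local Notation cpl := (@cplx_of_pair R).

Definition lcomb (s : seq (R * R[i] * R)) (z : R[i]) : R :=
  \sum_(t <- s) t.1.1 * lmax t.1.2 t.2 z.

(** The combination is the normalized sum of [f pt / S0] times the bump at [pt]. In the box, [q]
    controls the error [f z (1 - S / S0)] of the normalization, and [r] the oscillation of [f] on
    the support of a bump. Everywhere the total weight is at most [9 * 9], whence the global
    bound. *)
Lemma lmax_approx (f : R * R -> R) (B Rad eps : R) : continuous f ->
  (forall z, `|f z| <= B) -> 0 < eps ->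
  exists s : seq (R * R[i] * R), [/\ forall t, t \in s -> 0 < t.2,
    forall z, `|lcomb s (cpl z)| <= 9 * 9 * B &
    forall z : R * R, `|z.1| <= Rad -> `|z.2| <= Rad -> `|f z - lcomb s (cpl z)| <= eps].
Proof.
move=> cf fB eps0.
have B0 : 0 <= B by exact: le_trans (fB (0, 0)).
have om0 : 0 < eps / (2 * (9 * 9)) by rewrite divr_gt0.
have [e e0 he] := unif_continuous_box Rad cf om0.
(* The support radius [2 r] of a bump is then below the modulus of continuity [e]. *)
pose r := e / 3.
have r0 : 0 < r by rewrite divr_gt0.
have ln20 : 0 < ln 2 :> R by rewrite ln_gt0// ltr1n.
pose q := (Num.truncn (4 * (13 * 13) * B / (eps * ln 2))).+1.
have q0 : (0 < q)%N by [].
have q0' : 0 < q%:R :> R by rewrite ltr0n.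
have qB : 4 * (13 * 13) * B <= q%:R * (eps * ln 2).
  by rewrite -ler_pdivrMr ?mulr_gt0//; apply: ltW; exact: truncnS_gt.
pose del := r / (2 * q%:R).
pose K := (Num.truncn (Rad / del + (6 * q).+1%:R)).+1.
have hK : Rad / del + (6 * q).+1%:R <= K%:R by apply: ltW; exact: truncnS_gt.
pose S0 := lat_norm r q.
have S00 : 0 < S0 by exact: lat_norm_gt0.
have S0q : q%:R ^+ 2 * ln 2 <= S0 by exact: lat_norm_ge.
pose pt (ij : 'I_(2 * K).+1 * 'I_(2 * K).+1) : R * R := (lat_pt r q K ij.1, lat_pt r q K ij.2).
pose s := [seq (f (pt ij) / S0, cpl (pt ij), 2 * r) | ij <- index_enum _] ++
          [seq (- (f (pt ij) / S0), cpl (pt ij), r) | ij <- index_enum _].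
have sE z : lcomb s (cpl z) =
    \sum_ij f (pt ij) / S0 * bump r (z.1 - (pt ij).1) (z.2 - (pt ij).2).
  rewrite /lcomb /s big_cat !big_map /=. rewrite -big_split; apply: eq_bigr => ij _.
  rewrite -[bump _ _ _]/(bump r (z.1 - (pt ij).1) (z.2 - (pt ij).2)) bump_lmax /=; ring.
have SE x y : lat_sum r q K x y = \sum_ij bump r (x - (pt ij).1) (y - (pt ij).2).
  by rewrite /lat_sum pair_big.
have S81 z : \sum_ij bump r (z.1 - (pt ij).1) (z.2 - (pt ij).2) / S0 <= 9 * 9.
  rewrite -mulr_suml -SE ler_pdivrMr//; exact: lat_sum_le.
have b0 z ij : 0 <= bump r (z.1 - (pt ij).1) (z.2 - (pt ij).2) / S0.
  by rewrite divr_ge0 ?bump_ge0// ltW.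
exists s; split.
- move=> t; rewrite mem_cat => /orP[] /mapP[ij _ ->] //=.
  by rewrite mulr_gt0.
- move=> z; rewrite sE (le_trans (ler_norm_sum _ _ _))//.
  apply: (@le_trans _ _ (\sum_ij bump r (z.1 - (pt ij).1) (z.2 - (pt ij).2) / S0 * B)).
    apply: ler_sum => ij _; rewrite mulrAC -mulrA normrM mulrC (ger0_norm (b0 z ij)).
    exact: ler_wpM2l.
  by rewrite -mulr_suml ler_wpM2r.
move=> z z1 z2; rewrite sE.
have := lat_sum_interior r0 q0 z1 z2 hK; rewrite SE -/S0.
set S := \sum_ij _ => hS.
have -> : f z - \sum_ij f (pt ij) / S0 * bump r (z.1 - (pt ij).1) (z.2 - (pt ij).2) =
   f z * (1 - S / S0) +
   \sum_ij (f z - f (pt ij)) * (bump r (z.1 - (pt ij).1) (z.2 - (pt ij).2) / S0).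
  rewrite (_ : \sum_ij (f z - f (pt ij)) * _ = f z * (S / S0) -
     \sum_ij f (pt ij) / S0 * bump r (z.1 - (pt ij).1) (z.2 - (pt ij).2)); first by ring.
  by rewrite /S mulr_suml mulr_sumr -sumrB; apply: eq_bigr => ij _; ring.
rewrite (le_trans (ler_normD _ _))// [eps]splitr lerD//.
  have -> : 1 - S / S0 = (S0 - S) / S0 by field; rewrite gt_eqF.
  rewrite !normrM normfV (gtr0_norm S00) distrC mulrA ler_pdivrMr//.
  apply: (@le_trans _ _ (B * (2 * (13 * 13) * q%:R))); first exact: ler_pM.
  apply: (@le_trans _ _ (eps / 2 * (q%:R ^+ 2 * ln 2))); last first.
    by rewrite ler_wpM2l// divr_ge0// ltW.
  rewrite (_ : eps / 2 * (q%:R ^+ 2 * ln 2) = q%:R / 2 * (q%:R * (eps * ln 2))); last by ring.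
  apply: (@le_trans _ _ (q%:R / 2 * (4 * (13 * 13) * B))); first by lra.
  by rewrite ler_wpM2l// divr_ge0.
rewrite (le_trans (ler_norm_sum _ _ _))//.
apply: (@le_trans _ _ (\sum_ij eps / (2 * (9 * 9)) * (bump r (z.1 - (pt ij).1) (z.2 - (pt ij).2) / S0))).
  apply: ler_sum => ij _; rewrite normrM (ger0_norm (b0 z ij)).
  have [h1|h1] := ltP `|z.1 - (pt ij).1| (2 * r); last first.
    by rewrite bump_eq0 ?mul0r ?mulr0//; left.
  have [h2|h2] := ltP `|z.2 - (pt ij).2| (2 * r); last first.
    by rewrite bump_eq0 ?mul0r ?mulr0//; right.
  rewrite ler_wpM2r// ltW// he//; rewrite /r in h1 h2; lra.
rewrite -mulr_sumr.
apply: (@le_trans _ _ (eps / (2 * (9 * 9)) * (9 * 9))).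
  by rewrite ler_wpM2l// ltW.
by lra.
Qed.

End Approximation.

(** * Measurability of sums over critical points *)

Section SequentialMeasurability.
Context d (T : measurableType d) (R : realType).

(* The arguments are rounded to a countable grid, where every function is measurable;
   sequential continuity lets the mesh tend to [0]. *)
Lemma measurable_seq_continuous (I : finType) (Y : I -> T -> R) (Phi : (I -> R) -> R) :
  (forall i, measurable_fun setT (Y i)) ->
  (forall (v_ : nat -> I -> R) (v : I -> R),
     (forall i, v_ k i @[k --> \oo] --> v i) -> Phi (v_ k) @[k --> \oo] --> Phi v) ->
  measurable_fun setT (fun w => Phi (fun i => Y i w)).
Proof.
move=> mY cPhi.
pose fl (k : nat) (y : R) : int := Num.floor (k.+1%:R * y).
pose rnd (k : nat) (m : int) : R := m%:~R / k.+1%:R.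
have fl_cvg y : rnd k (fl k y) @[k --> \oo] --> y.
  apply/cvgrPdist_le => e e0.
  have /cvgrPdist_lt/(_ e e0) := @cvg_harmonic R.
  apply: filterS => k; rewrite sub0r normrN /harmonic /= => hk.
  apply: le_trans (ltW hk); rewrite [leRHS]ger0_norm ?invr_ge0//.
  have k0 : 0 < k.+1%:R :> R by rewrite ltr0n.
  have /andP[f1 f2] := floor_itv (k.+1%:R * y).
  rewrite intrD in f2.
  rewrite -[leRHS]mul1r ler_pdivlMr// -[X in _ * X](gtr0_norm k0) -normrM.
  have -> : (y - rnd k (fl k y)) * k.+1%:R = k.+1%:R * y - (fl k y)%:~R.
    by rewrite /rnd mulrBl divfK ?gt_eqF// mulrC.
  by rewrite /fl ger0_norm; lra.
apply: (measurable_fun_cvg (h := fun k w => Phi (fun i => rnd k (fl k (Y i w))))); last first.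
  by move=> w _; apply: cPhi => i; exact: fl_cvg.
move=> k _ B mB; rewrite setTI.
have mfl i (m : int) : measurable [set w | fl k (Y i w) = m].
  have -> : [set w | fl k (Y i w) = m] =
     [set w | m%:~R <= k.+1%:R * Y i w] `&` ~` [set w | (m + 1)%:~R <= k.+1%:R * Y i w].
    apply/seteqP; split => w /=.
      move=> <-; have /andP[f1 f2] := floor_itv (k.+1%:R * Y i w).
      by split=> //; apply/negP; rewrite -ltNge.
    by move=> [f1 /negP]; rewrite -ltNge => f2; apply: floor_def; rewrite f1 f2.
  have mk : measurable_fun setT (fun w => k.+1%:R * Y i w) by exact: measurable_funM.
  by apply: measurableI; [|apply: measurableC]; exact: measurable_set_ler.
have -> : (fun w => Phi (fun i => rnd k (fl k (Y i w)))) @^-1` B =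
   \bigcup_(v : {ffun I -> int}) (if `[< B (Phi (fun i => rnd k (v i))) >] then
     \big[setI/setT]_(i : I) [set w | fl k (Y i w) = v i] else set0).
  apply/seteqP; split => w /=.
    move=> hB; exists [ffun i => fl k (Y i w)] => //.
    rewrite asboolT; last first.
      by have -> : (fun i => rnd k ([ffun i => fl k (Y i w)] i)) = (fun i => rnd k (fl k (Y i w)))
        by apply/funext => i; rewrite ffunE.
    rewrite -bigcap_seq => i _ /=; by rewrite ffunE.
  move=> [v _]; case: asboolP => // hB; rewrite -bigcap_seq => h.
  have -> : (fun i => rnd k (fl k (Y i w))) = (fun i => rnd k (v i)); last exact: hB.
  by apply/funext => i; rewrite (h i)//= mem_index_enum.
apply: countable_bigcupT_measurable; first exact: countableP.
move=> v; case: asboolP => // _.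
by apply: bigsetI_measurable => i _; exact: mfl.
Qed.

End SequentialMeasurability.

Lemma continuous_seq2 (R : realType) (f : R * R -> R) (u v : nat -> R) (a b : R) :
  continuous f -> u k @[k --> \oo] --> a -> v k @[k --> \oo] --> b ->
  f (u k, v k) @[k --> \oo] --> f (a, b).
Proof.
move=> cf ua vb; have uv : (u k, v k) @[k --> \oo] --> (a, b) by exact: (cvg_pair ua vb).
exact: (cvg_comp _ _ uv (cf (a, b))).
Qed.

Lemma measurable_continuous2 (R : realType) (f : R * R -> R) :
  continuous f -> measurable_fun setT f.
Proof.
move=> cf.
have -> : f = (fun w => (fun v : bool -> R => f (v true, v false)) (fun i => (if i then fst else snd) w)).
  by apply/funext => -[x y].
apply: (measurable_seq_continuous (Y := fun (i : bool) => if i then fst else snd)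
  (Phi := fun v : bool -> R => f (v true, v false))) => [[]|v_ v h].
- exact: measurable_fst.
- exact: measurable_snd.
- by apply: continuous_seq2.
Qed.

(** * Continuity of the roots of a polynomial in its coefficients *)

Section RootContinuity.
Variable R : realType.
Local Notation C := R[i].
Implicit Types (u v : nat -> C) (a b : C) (p q : {poly C}).

Definition ccvg u a : Prop :=
  complex.Re (u k) @[k --> \oo] --> complex.Re a /\
  complex.Im (u k) @[k --> \oo] --> complex.Im a.

Lemma ccvg_cst a : ccvg (fun=> a) a.
Proof. by split; exact: cvg_cst. Qed.

Lemma ccvgD u v a b : ccvg u a -> ccvg v b -> ccvg (fun k => u k + v k) (a + b).
Proof.
by move=> [u1 u2] [v1 v2]; split; under eq_fun do rewrite ?Re_add ?Im_add;
  rewrite ?Re_add ?Im_add; exact: cvgD.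
Qed.

Lemma ccvgB u v a b : ccvg u a -> ccvg v b -> ccvg (fun k => u k - v k) (a - b).
Proof.
by move=> [u1 u2] [v1 v2]; split; under eq_fun do rewrite ?Re_sub ?Im_sub;
  rewrite ?Re_sub ?Im_sub; exact: cvgB.
Qed.

Lemma ccvgM u v a b : ccvg u a -> ccvg v b -> ccvg (fun k => u k * v k) (a * b).
Proof.
move=> [u1 u2] [v1 v2]; split; under eq_fun do rewrite ?Re_mul ?Im_mul;
  rewrite ?Re_mul ?Im_mul; [apply: cvgB|apply: cvgD]; exact: cvgM.
Qed.

Lemma ccvg_sum (I : Type) (r : seq I) (u_ : I -> nat -> C) (l : I -> C) :
  (forall i, ccvg (u_ i) (l i)) ->
  ccvg (fun k => \sum_(i <- r) u_ i k) (\sum_(i <- r) l i).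
Proof.
move=> h; elim: r => [|i r IH].
  by under eq_fun do rewrite big_nil; rewrite big_nil; exact: ccvg_cst.
by under eq_fun do rewrite big_cons; rewrite big_cons; exact: ccvgD.
Qed.

Lemma ccvg_normc u a : ccvg u a -> normc (u k - a) @[k --> \oo] --> (0 : R).
Proof.
move=> [u1 u2].
have h : `|complex.Re (u k) - complex.Re a| + `|complex.Im (u k) - complex.Im a| @[k --> \oo] --> (0 : R).
  rewrite -(addr0 0); apply: cvgD; rewrite -(normr0 R); apply: cvg_norm;
  [rewrite -(subrr (complex.Re a))|rewrite -(subrr (complex.Im a))];
  by apply: cvgB => //; exact: cvg_cst.
apply: (squeeze_cvgr _ (cvg_cst 0) h).
apply: nearW => k; rewrite normc_ge0/= (le_trans (normc_le_ReIm _))//.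
by rewrite Re_sub Im_sub.
Qed.

Lemma ccvg_of_normc u a : (forall e : R, 0 < e -> \forall k \near \oo, normc (u k - a) < e) -> ccvg u a.
Proof.
move=> h; split; apply/cvgrPdist_lt => e /h; apply: filterS => k hk; rewrite distrC.
  by rewrite -Re_sub (le_lt_trans (normc_Re _)).
by rewrite -Im_sub (le_lt_trans (normc_Im _)).
Qed.

Definition pcvg (p_ : nat -> {poly C}) (p : {poly C}) : Prop :=
  forall i, ccvg (fun k => (p_ k)`_i) p`_i.

Lemma pcvg_mulXsubC (p_ : nat -> {poly C}) p u a : pcvg p_ p -> ccvg u a ->
  pcvg (fun k => p_ k * ('X - (u k)%:P)) (p * ('X - a%:P)).
Proof.
move=> hp hu i; under eq_fun do rewrite mulrBr coefB coefMX coefMC.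
rewrite mulrBr coefB coefMX coefMC; apply: ccvgB; last exact: (ccvgM (hp i) hu).
by case: i => [|i] /=; [exact: ccvg_cst|exact: hp].
Qed.

Lemma pcvg_prod (I : Type) (r : seq I) (u_ : nat -> I -> C) (a : I -> C) :
  (forall j, ccvg (u_ ^~ j) (a j)) ->
  pcvg (fun k => \prod_(j <- r) ('X - (u_ k j)%:P)) (\prod_(j <- r) ('X - (a j)%:P)).
Proof.
move=> h; elim: r => [|j r IH].
  by under eq_fun do rewrite big_nil; rewrite big_nil => i; exact: ccvg_cst.
under eq_fun do rewrite big_cons mulrC; rewrite big_cons mulrC.
by apply: pcvg_mulXsubC => //; exact: h.
Qed.

Lemma pcvgM (p_ q_ : nat -> {poly C}) p q : pcvg p_ p -> pcvg q_ q ->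
  pcvg (fun k => p_ k * q_ k) (p * q).
Proof.
move=> hp hq i; under eq_fun do rewrite coefM; rewrite coefM.
by apply: ccvg_sum => j; exact: (ccvgM (hp _) (hq _)).
Qed.

Lemma pcvg_deriv (p_ : nat -> {poly C}) p : pcvg p_ p -> pcvg (fun k => (p_ k)^`()) p^`().
Proof.
move=> hp i; have e (q : {poly C}) : q^`()`_i = q`_i.+1 * i.+1%:R.
  by rewrite coef_deriv mulr_natr.
under eq_fun do rewrite e; rewrite e; exact: (ccvgM (hp _) (ccvg_cst _)).
Qed.

Lemma pcvg_horner (p_ : nat -> {poly C}) p (m : nat) z : pcvg p_ p ->
  (forall k, (size (p_ k) <= m)%N) -> (size p <= m)%N ->
  ccvg (fun k => (p_ k).[z]) p.[z].
Proof.
move=> hp sp_ sp; under eq_fun do rewrite (horner_coef_wide _ (sp_ _)).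
rewrite (horner_coef_wide _ sp); apply: ccvg_sum => i.
exact: (ccvgM (hp _) (ccvg_cst _)).
Qed.

(** The smallest factor [|z - y|], raised to the number of factors, is at most their product. *)
Lemma nearest_root (s : seq C) z : (0 < size s)%N ->
  exists2 y, y \in s & normc (z - y) ^+ size s <= normc (\prod_(x <- s) ('X - x%:P)).[z].
Proof.
elim: s => [//|x s IH] _.
have hE t : normc (\prod_(x <- t) ('X - x%:P)).[z] = \prod_(x <- t) normc (z - x).
  by rewrite horner_prod normc_prod; apply: eq_bigr => y _; rewrite !hornerE.
case: s IH => [_|y s IH].
  by exists x; rewrite ?mem_head// hE big_seq1 expr1.
have [//|y0 y0s hy0] := IH.
rewrite hE big_cons -hE; set Z := normc _.[z] in hy0 *.
have [h|h] := leP (normc (z - x)) (normc (z - y0)).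
  exists x; first exact: mem_head.
  rewrite [size _]/= exprS ler_wpM2l ?normc_ge0//; apply: le_trans hy0.
  by apply: lerXn2r; rewrite ?nnegrE ?normc_ge0.
exists y0; first by rewrite inE y0s orbT.
by rewrite [size _]/= exprS ler_pM ?exprn_ge0 ?normc_ge0// ltW.
Qed.

(** Coefficients of the quotient are recovered by descending recursion,
    [q_i = (('X - a) q)_(i+1) + a q_(i+1)], starting above the degree bound, where they vanish. *)
Lemma pcvg_divXsubC (q_ : nat -> {poly C}) q u a (m : nat) :
  (forall k, (size (q_ k) <= m)%N) -> (size q <= m)%N -> ccvg u a ->
  pcvg (fun k => ('X - (u k)%:P) * q_ k) (('X - a%:P) * q) -> pcvg q_ q.
Proof.
move=> sq_ sq hu hpq i.
have [j hj] : exists j, (m <= i + j)%N by exists m; rewrite leq_addl.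
elim: j i hj => [|j IH] i hj.
  rewrite addn0 in hj.
  have z0 (p : {poly C}) : (size p <= m)%N -> p`_i = 0.
    by move=> sp; rewrite nth_default// (leq_trans sp).
  have -> : (fun k => (q_ k)`_i) = (fun=> 0) by apply/funext => k; exact: z0.
  by rewrite z0//; exact: ccvg_cst.
have h1 : ccvg (fun k => (q_ k)`_i.+1) q`_i.+1 by apply: IH; rewrite addSnnS.
have e (p : {poly C}) (c : C) : (('X - c%:P) * p)`_i.+1 = p`_i - p`_i.+1 * c.
  by rewrite mulrC mulrBr coefB coefMX coefMC.
have := hpq i.+1; rewrite e; under eq_fun do rewrite e.
move=> h2; have := ccvgD h2 (ccvgM h1 hu).
by under eq_fun do rewrite subrK; rewrite subrK.
Qed.

(* Continuity of the roots, by splitting off a root of the perturbed polynomial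
   close to a given root of the limit. *)
Lemma cvg_sum_roots (f : R * R -> R) (n : nat) (zs_ : nat -> seq C) (zs : seq C) :
  continuous f -> (forall k, size (zs_ k) = n) -> size zs = n ->
  pcvg (fun k => \prod_(z <- zs_ k) ('X - z%:P)) (\prod_(z <- zs) ('X - z%:P)) ->
  \sum_(z <- zs_ k) f (pair_of_cplx z) @[k --> \oo] --> \sum_(z <- zs) f (pair_of_cplx z).
Proof.
move=> cf; elim: n zs_ zs => [|n IH] zs_ zs hs_ hs hp.
  have -> : (fun k => \sum_(z <- zs_ k) f (pair_of_cplx z)) = (fun=> 0).
    by apply/funext => k; rewrite (size0nil (hs_ k)) big_nil.
  by rewrite (size0nil hs) big_nil; exact: cvg_cst.
case: zs hs hp => [//|z zs] [hs] hp.
have /choice[y hy] : forall k, exists y, y \in zs_ k /\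
    normc (z - y) ^+ n.+1 <= normc (\prod_(x <- zs_ k) ('X - x%:P)).[z].
  move=> k; have [|y h1 h2] := @nearest_root (zs_ k) z; first by rewrite hs_.
  by exists y; rewrite -{1}(hs_ k).
have hor : ccvg (fun k => (\prod_(x <- zs_ k) ('X - x%:P)).[z]) 0.
  have -> : 0 = (\prod_(x <- z :: zs) ('X - x%:P)).[z].
    by rewrite big_cons !hornerE subrr mul0r.
  by apply: (pcvg_horner (m := n.+2)) => // [k|]; rewrite size_prod_XsubC ?hs_ ?hs //= hs.
have yz : ccvg y z.
  apply: ccvg_of_normc => e e0.
  have en : 0 < e ^+ n.+1 by exact: exprn_gt0.
  have /cvgrPdist_lt/(_ _ en) := ccvg_normc hor.
  apply: filterS => k; rewrite sub0r normrN subr0 ger0_norm ?normc_ge0// => hk.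
  rewrite normc_distC -(@ltr_pXn2r _ n.+1) ?nnegrE ?normc_ge0 ?(ltW e0)//.
  by apply: le_lt_trans hk; case: (hy k).
have pk k : \prod_(x <- zs_ k) ('X - x%:P) =
    ('X - (y k)%:P) * \prod_(x <- rem (y k) (zs_ k)) ('X - x%:P).
  by rewrite (big_rem (y k)) //=; case: (hy k).
have sr k : size (rem (y k) (zs_ k)) = n.
  by rewrite size_rem ?hs_//; case: (hy k).
have hq : pcvg (fun k => \prod_(x <- rem (y k) (zs_ k)) ('X - x%:P)) (\prod_(x <- zs) ('X - x%:P)).
  apply: (pcvg_divXsubC (m := n.+1) _ _ yz).
  - by move=> k; rewrite size_prod_XsubC sr.
  - by rewrite size_prod_XsubC hs.
  - by move: hp; under eq_fun do rewrite pk; rewrite big_cons.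
have := IH _ _ sr hs hq => h.
have -> : (fun k => \sum_(x <- zs_ k) f (pair_of_cplx x)) =
   (fun k => f (pair_of_cplx (y k)) + \sum_(x <- rem (y k) (zs_ k)) f (pair_of_cplx x)).
  by apply/funext => k; rewrite (big_rem (y k)) //=; case: (hy k).
rewrite big_cons; apply: cvgD => //.
by case: yz => y1 y2; exact: continuous_seq2.
Qed.

End RootContinuity.

Section CriticalMeasurability.
Context (R : realType) d (T : measurableType d).
Variables (X : nat -> T -> R * R) (k : nat -> nat) (xi : nat -> nat -> R[i]).
Hypothesis mX : forall i, measurable_fun setT (X i).
Hypothesis hk : forall n, (k n <= n)%N.
Local Notation cpl := (@cplx_of_pair R).
Local Notation xs := (sample_roots X k xi).

Lemma crit_emp_integralE (s : seq R[i]) (f : R * R -> R) :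
  crit_emp_integral (\prod_(x <- s) ('X - x%:P)) f =
  (\sum_(z <- roots_mult (\prod_(x <- s) ('X - x%:P))^`()) f (pair_of_cplx z)) / (size s).-1%:R.
Proof. by rewrite /crit_emp_integral size_deriv_prod. Qed.

(** [roots_mult] is an arbitrary choice of an enumeration, with no measurability of its own; the
    symmetric sum of [f] over it is nevertheless continuous in the sample. *)
Lemma measurable_crit n (f : R * R -> R) : continuous f -> (0 < n)%N ->
  measurable_fun setT (fun w => crit_emp_integral (\prod_(x <- xs n w) ('X - x%:P)) f).
Proof.
move=> cf n0; set m := (n - k n)%N.
pose L (v : 'I_m * bool -> R) : seq R[i] :=
  [seq Complex (v (j, true)) (v (j, false)) | j <- enum 'I_m] ++ [seq xi n l | l <- iota 0 (k n)].
have sL v : size (L v) = n by rewrite size_cat !size_map size_iota -enumT size_enum_ord subnK.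
pose Phi v := (\sum_(z <- roots_mult (\prod_(x <- L v) ('X - x%:P))^`()) f (pair_of_cplx z)) / n.-1%:R.
pose Y (i : 'I_m * bool) (w : T) : R := if i.2 then (X i.1 w).1 else (X i.1 w).2.
have -> : (fun w => crit_emp_integral (\prod_(x <- xs n w) ('X - x%:P)) f) =
    (fun w => Phi (fun i => Y i w)).
  apply/funext => w; rewrite crit_emp_integralE size_sample_roots// /Phi.
  suff -> : \prod_(x <- xs n w) ('X - x%:P) = \prod_(x <- L (Y^~ w)) ('X - x%:P) by [].
  rewrite big_sample_roots big_cat !big_map; congr (_ * _).
  by rewrite -(big_mkord xpredT (fun j => 'X - (xi n j)%:P)) /index_iota subn0.
apply: measurable_seq_continuous.
  by move=> [j []]; rewrite /Y /=; [apply: (measurableT_comp measurable_fst)|apply: (measurableT_comp measurable_snd)].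
move=> v_ v hv; rewrite /Phi; apply: cvgMr_tmp.
apply: (cvg_sum_roots (n := n.-1)) => //.
- by move=> q; rewrite size_roots_deriv sL.
- by rewrite size_roots_deriv sL.
have hL : pcvg (fun q => (\prod_(x <- L (v_ q)) ('X - x%:P))^`()) (\prod_(x <- L v) ('X - x%:P))^`().
  apply: pcvg_deriv; rewrite /L; under eq_fun do rewrite big_cat !big_map.
  rewrite big_cat !big_map; apply: pcvgM.
    apply: (@pcvg_prod R _ _ (fun q j => Complex (v_ q (j, true)) (v_ q (j, false)))
      (fun j => Complex (v (j, true)) (v (j, false)))) => j.
    by split=> /=; exact: hv.
  by move=> i; exact: ccvg_cst.
(* Dividing by the leading coefficient [n] turns convergence of the derivatives into convergence of
   the monic products over critical points. *)
have n0' : n%:R != 0 :> R[i] by rewrite pnatr_eq0 -lt0n.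
have e u i : (\prod_(z <- roots_mult (\prod_(x <- L u) ('X - x%:P))^`()) ('X - z%:P))`_i =
    (\prod_(x <- L u) ('X - x%:P))^`()`_i * n%:R^-1.
  by rewrite {2}deriv_prod_roots sL coefZ mulrC mulKf.
move=> i; under eq_fun do rewrite e; rewrite e.
exact: (ccvgM (hL i) (ccvg_cst _)).
Qed.

End CriticalMeasurability.

(** * The support of [mu] *)

Section Support.
Context (R : realType) (mu : probability (R * R)%type R).
Local Notation cpl := (@cplx_of_pair R).

(** Points outside the support are covered by countably many null discs with rational centres. Total
    mass 1 then rules out an empty support, and a support with only one point [a] leaves no mass
    elsewhere. *)
Lemma support_dichotomy :
  (exists a0 b0, [/\ a0 != b0, in_support mu a0 & in_support mu b0]) \/
  (exists a : R * R, mu [set x | x <> a] = 0).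
Proof.
pose D (t : int * int * nat) : set (R * R) :=
  [set x | normc (cpl x - Complex (t.1.1%:~R / t.2.+1%:R) (t.1.2%:~R / t.2.+1%:R)) <= 2 / t.2.+1%:R].
have mD t : measurable (D t) by apply: measurable_disc; rewrite divr_ge0.
pose N (m : nat) : set (R * R) :=
  if unpickle m is Some t then (if mu (D t) == 0 then D t else set0) else set0.
have nN : mu.-negligible (\bigcup_m N m).
  apply: negligible_bigcup => m; rewrite /N; case: unpickle => [t|]; last exact: negligible_set0.
  case: eqP => [e|_]; last exact: negligible_set0.
  by exists (D t); split.
have inN x : ~ in_support mu (cpl x) -> (\bigcup_m N m) x.
  move=> /existsNP[r /not_implyP[r0 /negP]]; rewrite -leNgt => mu0.
  (* A disc of radius [2 / (n + 1)] containing [x] then lies in the null disc of radius [r] around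
     [x]. *)
  pose n := Num.truncn (4 / r).
  have n0 : 0 < n.+1%:R :> R by rewrite ltr0n.
  have nr : 4 / n.+1%:R <= r.
    by rewrite ler_pdivrMr// mulrC -ler_pdivrMr// ltW// truncnS_gt.
  pose t := (Num.floor (n.+1%:R * x.1), Num.floor (n.+1%:R * x.2), n).
  have close (y : R) : `|y - (Num.floor (n.+1%:R * y))%:~R / n.+1%:R| <= 1 / n.+1%:R.
    have /andP[f1 f2] := floor_itv (n.+1%:R * y).
    rewrite intrD in f2.
    rewrite ler_pdivlMr// -[X in _ * X](gtr0_norm n0) -normrM mulrBl divfK ?gt_eqF//.
    by rewrite [y * _]mulrC ger0_norm; lra.
  pose c : R[i] := Complex (t.1.1%:~R / t.2.+1%:R) (t.1.2%:~R / t.2.+1%:R).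
  have xt : normc (cpl x - c) <= 2 / n.+1%:R.
    rewrite (le_trans (normc_le_ReIm _))// Re_sub Im_sub.
    apply: (@le_trans _ _ (1 / n.+1%:R + 1 / n.+1%:R)); last by rewrite -mulrDl.
    by apply: lerD; exact: close.
  have Dt0 : mu (D t) = 0.
    apply/eqP; rewrite eq_le measure_ge0 andbT; apply: le_trans mu0.
    apply: le_measure; rewrite ?inE//; first by apply: measurable_disc; exact: ltW.
    move=> y yt; have {}yt : normc (cpl y - c) <= 2 / n.+1%:R := yt.
    rewrite /= (le_trans (normc_triangle (cpl y) c (cpl x)))//.
    rewrite [X in _ + X]normc_distC; apply: le_trans nr.
    rewrite (_ : 4 / n.+1%:R = 2 / n.+1%:R + 2 / n.+1%:R); first exact: lerD.
    by rewrite -mulrDl; congr (_ / _); ring.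
  have := pickleK t; move: (pickle t) => m hm; exists m; first exact: I.
  by rewrite /N hm Dt0 eqxx; exact: xt.
have [[a sa]|nos] := pselect (exists a : R * R, in_support mu (cpl a)); last first.
  exfalso; have : mu.-negligible setT.
    by apply: negligibleS nN => x _; apply: inN => sx; apply: nos; exists x.
  move=> /negligibleP => /(_ measurableT) mu0.
  have : (1 : \bar R)%E = 0 by rewrite -[LHS](probability_setT mu).
  by move=> /eqP; rewrite onee_eq0.
have [[b [ab sb]]|nob] := pselect (exists b : R * R, a <> b /\ in_support mu (cpl b)).
  left; exists (cpl a), (cpl b); split=> //.
  apply/eqP => -[e1 e2]; apply: ab; case: a b e1 e2 {sa sb} => a1 a2 [b1 b2] /= -> ->.
  by [].
right; exists a.
have mna : measurable [set x : R * R | x <> a].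
  have -> : [set x : R * R | x <> a] = [set x | 0 < normc (cpl x - cpl a)].
    apply/seteqP; split => x.
      move=> xa; have : cpl x - cpl a != 0.
        rewrite subr_eq0; apply/eqP => -[e1 e2]; apply: xa.
        by case: x a e1 e2 {sa nob} => x1 x2 [a1 a2] /= -> ->.
      by rewrite -normc_gt0.
    by move=> h xa; move: h; rewrite xa /mkset subrr normc0 ltxx.
  exact: measurable_disc_far.
apply/negligibleP => //; apply: negligibleS nN => x /= xa; apply: inN => sx.
by apply: nob; exists x; split=> //; exact: nesym.
Qed.

End Support.

Section Multiplicity.
Variable R : realType.
Local Notation C := R[i].

Lemma count_mem_ge (a : C) (j : nat) (s : seq C) (q : {poly C}) :
  \prod_(z <- s) ('X - z%:P) = ('X - a%:P) ^+ j * q -> (j <= count_mem a s)%N.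
Proof.
elim: j s => [//|j IH] s e.
have as_ : a \in s.
  by rewrite -root_prod_XsubC e rootM root_exp_XsubC eqxx.
have [s' ps] : exists s', perm_eq s (a :: s') by exists (rem a s); exact: perm_to_rem.
rewrite (permP ps) /= eqxx add1n ltnS; apply: IH.
have X0 : 'X - a%:P != 0 :> {poly C} by rewrite polyXsubC_eq0.
by apply: (mulfI X0); rewrite mulrA -exprS -e (perm_big _ ps) big_cons.
Qed.

End Multiplicity.

(** * Weak convergence *)

Section Assembly.
Context (R : realType) (mu : probability (R * R)%type R).
Context d (T : measurableType d) (P : probability T R).
Variables (X : nat -> T -> R * R) (k : nat -> nat) (xi : nat -> nat -> R[i]).
Hypothesis mX : forall i, measurable_fun setT (X i).
Hypothesis distX : forall i (A : set (R * R)), measurable A -> P (X i @^-1` A) = mu A.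
Hypothesis indepX : mutually_independent P X.
Hypothesis hk : forall n, (k n <= n)%N.
Hypothesis hko : ((k n)%:R / n%:R : R) @[n --> \oo] --> 0.
Local Notation cpl := (@cplx_of_pair R).
Local Notation xs := (sample_roots X k xi).
Local Notation crit := (fun n w => roots_mult (\prod_(x <- xs n w) ('X - x%:P))^`()).
Local Notation "''Em' F" := (Rintegral mu setT F) (at level 10, F at level 8).

Lemma degenerate_event (a : R * R) (f : R * R -> R) (B e : R) :
  mu [set x | x <> a] = 0 -> continuous f -> (forall z, `|f z| <= B) -> 0 < e ->
  exists n0, forall n, (n0 <= n)%N -> exists E : set T, [/\ measurable E, P E = 0 &
    forall w, ~ E w ->
    `|crit_emp_integral (\prod_(x <- xs n w) ('X - x%:P)) f - 'Em f| <= e].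
Proof.
move=> mua cf fB e0.
have B0 : 0 <= B by exact: le_trans (fB a).
have mA : measurable [set x : R * R | x <> a].
  have -> : [set x : R * R | x <> a] = ~` [set x | normc (cpl x - cpl a) <= 0].
    apply/seteqP; split => x.
      move=> xa; have : cpl x - cpl a != 0.
        rewrite subr_eq0; apply/eqP => -[e1 e2]; apply: xa.
        by case: x a e1 e2 {mua} => x1 x2 [a1 a2] /= -> ->.
      by rewrite -normc_gt0 => h /=; apply/negP; rewrite -ltNge.
    by move=> h xa; apply: h; rewrite xa /mkset subrr normc0.
  by apply: measurableC; exact: measurable_disc.
have bf : bmeas f by split; [exact: measurable_continuous2|exists B].
(* [f] and [f a] differ by at most [2 B], and only on a null set. *)
have Ef : 'Em f = f a.
  have bA : bmeas (\1_[set x : R * R | x <> a] : R * R -> R) by exact: bmeas_indic.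
  have EA : 'Em (\1_[set x : R * R | x <> a]) = 0 by rewrite (Ex_indic mu mA) mua.
  have bc : bmeas (fun=> f a : R) := @bmeas_cst _ (R * R)%type R (f a).
  have up : 'Em f <= 'Em (fun x => f a + 2 * B * \1_[set x : R * R | x <> a] x).
    apply: Ex_le => //; first by apply: bmeasD => //; exact: bmeasZ.
    move=> x; rewrite indicE; case: (boolP (x \in _)); rewrite ?notin_setE => h.
      by rewrite mulr1; have := fB x; have := fB a; rewrite !ler_norml => /andP[? ?] /andP[? ?]; lra.
    have -> : x = a by apply: contrapT => ?; exact: h.
    by rewrite mulr0 addr0.
  have lo : 'Em (fun x => f a + (- (2 * B)) * \1_[set x : R * R | x <> a] x) <= 'Em f.
    apply: Ex_le => //; first by apply: bmeasD => //; exact: bmeasZ.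
    move=> x; rewrite indicE; case: (boolP (x \in _)); rewrite ?notin_setE => h.
      by rewrite mulr1; have := fB x; have := fB a; rewrite !ler_norml => /andP[? ?] /andP[? ?]; lra.
    have -> : x = a by apply: contrapT => ?; exact: h.
    by rewrite mulr0 addr0.
  move: up lo; rewrite !ExD ?ExZ ?Ex_cst ?EA ?mulr0 ?addr0//; try exact: bmeasZ.
  by move=> h1 h2; apply/eqP; rewrite eq_le h1 h2.
(* The error will be at most [2 B k n / (n - 1)], and [n <= 2 (n - 1)]. *)
have [|n1 hn1] := @eventually_small_k R k hko (e / (4 * (B + 1))).
  by rewrite divr_gt0// mulr_gt0//; lra.
have [n2 hn2] := eventually_large_sample hk hko 1.
exists (maxn (maxn n1 n2) 2) => n; rewrite !geq_max => /andP[/andP[/hn1 kn /hn2 m1] n2'].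
exists (\bigcup_j [set w | X j w <> a]).
have mXa j : measurable [set w | X j w <> a].
  by have := mX j measurableT mA; rewrite setTI.
split.
- exact: bigcup_measurable.
- apply/negligibleP; first exact: bigcup_measurable.
  apply: negligible_bigcup => j; apply/negligibleP => //.
  by rewrite -[RHS]mua -(distX j mA).
move=> w hw; have Xa j : X j w = a by apply: contrapT => h; apply: hw; exists j.
rewrite crit_emp_integralE size_sample_roots// Ef.
set m := (n - k n)%N in m1.
set zs := roots_mult _.
have sz : size zs = n.-1 by rewrite size_roots_deriv size_sample_roots// ltnW.
(* Hence at most [(n - 1) - (m - 1) = k n] critical points differ from [a]. *)
have cz : (m.-1 <= count_mem (cpl a) zs)%N.
  pose q := \prod_(l < k n) ('X - (xi n l)%:P).
  have pE : \prod_(x <- xs n w) ('X - x%:P) = ('X - (cpl a)%:P) ^+ m * q.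
    rewrite big_sample_roots; congr (_ * _).
    by rewrite (eq_bigr (fun=> 'X - (cpl a)%:P)) ?prodr_const ?card_ord// => j _; rewrite Xa.
  have := deriv_prod_roots (xs n w); rewrite size_sample_roots// -/zs.
  rewrite {1}pE derivM deriv_exp derivXsubC mul1r => /(congr1 (fun p => n%:R^-1 *: p)).
  have n0 : n%:R != 0 :> R[i] by rewrite pnatr_eq0 -lt0n ltnW.
  rewrite scalerA mulVf// scale1r => e1.
  apply: (@count_mem_ge R (cpl a) m.-1 zs (n%:R^-1 *: (m%:R *: q + ('X - (cpl a)%:P) * q^`()))).
  rewrite -e1 -scalerAr; congr (_ *: _).
  have e2 : ('X - (cpl a)%:P) ^+ m = ('X - (cpl a)%:P) * ('X - (cpl a)%:P) ^+ m.-1.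
    by rewrite -exprS prednK.
  rewrite e2 mulrDr -scalerAr scaler_nat mulrnAl; congr (_ + _).
  by rewrite mulrAC mulrC mulrCA mulrA.
have n1' : 0 < (n.-1)%:R :> R by rewrite ltr0n -ltnS prednK// ltnW.
have -> : (\sum_(z <- zs) f (pair_of_cplx z)) / (n.-1)%:R - f a =
   (\sum_(z <- zs) (f (pair_of_cplx z) - f a)) / (n.-1)%:R.
  by rewrite sumrB sumr_cst_seq sz mulrBl [X in _ = _ - X]mulrAC divff ?gt_eqF// mul1r.
rewrite normrM normfV (gtr0_norm n1') ler_pdivrMr// (le_trans (ler_norm_sum _ _ _))//.
apply: (@le_trans _ _ (2 * B * (k n)%:R)).
  apply: (@le_trans _ _ (\sum_(z <- zs) (if z != cpl a then 2 * B else 0))).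
    apply: ler_sum => z _; case: eqP => [->|_] /=.
      by rewrite (_ : pair_of_cplx (cpl a) = a) ?subrr ?normr0//; case: (a).
    by rewrite (le_trans (ler_normB _ _))//; have := fB (pair_of_cplx z); have := fB a; lra.
  rewrite -big_mkcond big_const_seq iter_addr_0 -[leLHS]mulr_natr ler_wpM2l ?mulr_ge0// ler_nat.
  have := count_predC (pred1 (cpl a)) zs; rewrite sz => h.
  rewrite (eq_count (a2 := predC (pred1 (cpl a))))//.
  have : (m + k n = n)%N by rewrite /m subnK.
  move: h cz m1; set c1 := count_mem _ _; set c2 := count _ _; clear; lia.
have nn : n%:R = (n.-1)%:R + 1 :> R by rewrite natr1 prednK// ltnW.
have n2r : 1 <= (n.-1)%:R :> R by rewrite ler1n -ltnS prednK// ltnW.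
have h1 : (k n)%:R * (4 * (B + 1)) <= e * n%:R.
  by rewrite -ler_pdivlMr ?mulr_gt0//; [rewrite mulrAC|lra].
have k0 : 0 <= (k n)%:R :> R by [].
nra.
Qed.

Lemma lmax_event_seq (a0 b0 : R[i]) (L : seq (R[i] * R)) (e eta : R) : a0 != b0 ->
  in_support mu a0 -> in_support mu b0 -> (forall t, t \in L -> 0 < t.2) ->
  0 < e -> 0 < eta ->
  exists n0 : nat, forall n, (n0 <= n)%N -> exists E : set T,
    [/\ measurable E, (P E <= eta%:E)%E & forall w, ~ E w -> forall t, t \in L ->
    `|\sum_(z <- crit n w) lmax t.1 t.2 z - \sum_(x <- xs n w) lmax t.1 t.2 x| <= e * n%:R].
Proof.
move=> ab sa sb + e0; elim: L eta => [|t L IH] eta hL eta0.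
  exists 0%N => n _; exists set0; split=> //.
  by rewrite measure0 lee_fin ltW.
have eta2 : 0 < eta / 2 by rewrite divr_gt0.
have [|n1 hn1] := IH (eta / 2) _ eta2.
  by move=> u uL; apply: hL; rewrite inE uL orbT.
have t0 : 0 < t.2 by apply: hL; exact: mem_head.
have [n2 hn2] := lmax_event xi mX distX indepX hk hko t.1 ab sa sb t0 e0 eta2.
exists (maxn n1 n2) => n; rewrite geq_max => /andP[/hn1[E1 [mE1 PE1 h1]] /hn2[E2 [mE2 PE2 h2]]].
exists (E1 `|` E2); split; first exact: measurableU.
- apply: (le_trans (measureU2 _ mE1 mE2)).
  by rewrite [eta]splitr EFinD leeD.
- move=> w /not_orP[nE1 nE2] u; rewrite inE => /predU1P[->|uL]; first exact: h2.
  exact: h1.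
Qed.

Lemma sample_mean_event (g : R * R -> R) (e eta : R) : bmeas g -> 0 < e -> 0 < eta ->
  exists n0 : nat, forall n, (n0 <= n)%N -> exists E : set T,
    [/\ measurable E, (P E <= eta%:E)%E & forall w, ~ E w ->
    `|\sum_(j < n - k n) g (X j w) - (n - k n)%:R * 'Em g| <= e * n%:R].
Proof.
move=> bg e0 eta0.
have [K K0 hK] := sum_deviation mX distX indepX bg.
exists (Num.truncn (K / (eta * e ^+ 2))).+1 => n hn.
have n0 : 0 < n%:R :> R by rewrite ltr0n (leq_trans _ hn).
have en : 0 < e * n%:R by rewrite mulr_gt0.
have e2 : 0 < e ^+ 2 by rewrite exprn_gt0.
exists [set w | e * n%:R <= `|\sum_(j < n - k n) g (X j w) - (n - k n)%:R * 'Em g|]; split.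
- apply: measurable_set_ler => //; apply: measurableT_comp => //.
  apply: measurable_funB => //; apply: measurable_sum => j.
  by case: (bmeas_comp bg (mX j)).
- apply: (le_trans (hK _ _ en)); rewrite lee_fin ler_pdivrMr ?exprn_gt0//.
  have : K / (eta * e ^+ 2) <= n%:R.
    by rewrite ltW// (lt_le_trans (truncnS_gt _))// ler_nat.
  rewrite ler_pdivrMr ?mulr_gt0// => h.
  apply: (@le_trans _ _ (K * n%:R)); first by rewrite ler_wpM2l// ler_nat leq_subr.
  rewrite (_ : eta * (e * n%:R) ^+ 2 = n%:R * (eta * e ^+ 2) * n%:R); last by ring.
  by rewrite ler_wpM2r.
- by move=> w /negP; rewrite -ltNge => /ltW.
Qed.

End Assembly.

(** * Weak convergence when the support has two points *)

Section NonDegenerate.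
Context (R : realType) (mu : probability (R * R)%type R).
Local Notation cpl := (@cplx_of_pair R).

Lemma tight_disc (e : R) : 0 < e ->
  exists2 r : R, 0 < r & (mu [set x | (r < normc (cpl x))%R] <= e%:E)%E.
Proof.
move=> e0; pose F (m : nat) := [set x : R * R | m.+1%:R < normc (cpl x)].
have mF m : measurable (F m).
  have -> : F m = [set x | m.+1%:R < normc (cpl x - 0)].
    by apply/seteqP; split => x; rewrite /F /mkset subr0.
  exact: measurable_disc_far.
have F0 : \bigcap_m F m = set0.
  apply/seteqP; split => // x /(_ (Num.truncn (normc (cpl x))) I).
  by rewrite /F /mkset => /(lt_trans (truncnS_gt _)); rewrite ltxx.
have cF : (mu \o F) m @[m --> \oo] --> mu (\bigcap_m F m).
  apply: nonincreasing_cvg_mu => //.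
  - by apply: le_lt_trans (probability_le1 _ _) _ => //; rewrite ltry.
  - by rewrite F0.
  - move=> i j ij; apply/subsetPset => x; rewrite /F /mkset; apply: le_lt_trans.
    by rewrite ler_nat.
rewrite F0 measure0 in cF.
have /fine_cvgP[_ /cvgrPdist_lt/(_ _ e0)[m _ hm]] := cF.
exists m.+1%:R; first by rewrite ltr0n.
have := hm m (leqnn m); rewrite /= sub0r normrN => /(le_lt_trans (ler_norm _)) /ltW h.
have fm : mu (F m) \is a fin_num by exact: fin_num_measure.
have : (mu (F m) <= e%:E)%E by rewrite -(fineK fm) lee_fin.
exact.
Qed.

Definition far_ind (r : R) (z : R[i]) : R := if r < normc z then 1 else 0.

(** The bump at the origin scaled to [[0, 1]], lying between the indicators of the discs of radii
    [r] and [2 r]. Being a combination of [lmax], it can be compared between critical points and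
    roots. *)
Definition cutoff (r : R) (z : R[i]) : R := (lmax 0 (2 * r) z - lmax 0 r z) / ln 2.

Lemma ln2_gt0 : 0 < ln 2 :> R. Proof. by rewrite ln_gt0// ltr1n. Qed.

Lemma ln2_le1 : ln 2 <= 1 :> R.
Proof. by rewrite (_ : 2 = 1 + 1)// le_ln1Dx//; lra. Qed.

Lemma cutoff_bounds r z : 0 < r ->
  far_ind (2 * r) z <= 1 - cutoff r z /\ 1 - cutoff r z <= far_ind r z.
Proof.
move=> r0; have l2 := ln2_gt0.
have -> : cutoff r z = bump r (complex.Re z) (complex.Im z) / ln 2.
  by case: z => a b; rewrite /cutoff /bump /lmax !subr0.
have b0 := bump_ge0 (complex.Re z) (complex.Im z) r0.
have b1 := bump_le (complex.Re z) (complex.Im z) r0.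
have zE : cpl (complex.Re z, complex.Im z) = z by case: z {b0 b1}.
have c0 : 0 <= bump r (complex.Re z) (complex.Im z) / ln 2 by rewrite divr_ge0// ltW.
have c1 : bump r (complex.Re z) (complex.Im z) / ln 2 <= 1 by rewrite ler_pdivrMr// mul1r.
rewrite /far_ind; split; case: ifPn => h; try lra.
  by rewrite /bump zE !max_r ?subrr ?mul0r ?subr0//; lra.
rewrite -leNgt in h; rewrite /bump zE !max_l//; last lra.
by rewrite lnM ?posrE// addrK divff ?gt_eqF// subrr.
Qed.

Lemma sum_le_sum (s : seq R[i]) (F G : R[i] -> R) : (forall z, F z <= G z) ->
  \sum_(z <- s) F z <= \sum_(z <- s) G z.
Proof. by move=> h; apply: ler_sum => z _. Qed.

Lemma sum_cutoff_diff (xs zs : seq R[i]) (r D d : R) :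
  2 * D <= d * ln 2 ->
  `|\sum_(z <- zs) lmax 0 (2 * r) z - \sum_(x <- xs) lmax 0 (2 * r) x| <= D ->
  `|\sum_(z <- zs) lmax 0 r z - \sum_(x <- xs) lmax 0 r x| <= D ->
  `|\sum_(z <- zs) cutoff r z - \sum_(x <- xs) cutoff r x| <= d.
Proof.
move=> hD h1 h2; have l2 := ln2_gt0.
rewrite /cutoff -!mulr_suml -mulrBl normrM normfV (gtr0_norm l2).
rewrite ler_pdivrMr// !sumrB; apply: le_trans hD.
move: h1 h2; rewrite !ler_norml => /andP[? ?] /andP[? ?]; apply/andP; split; lra.
Qed.

(** Tightness passes from roots to critical points: there are no more critical points than roots,
    and nearly as much cutoff mass near the origin, so few can be far away. *)
Lemma far_zeros (xs zs : seq R[i]) (r d : R) : 0 < r ->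
  (size zs)%:R <= (size xs)%:R :> R ->
  `|\sum_(z <- zs) cutoff r z - \sum_(x <- xs) cutoff r x| <= d ->
  \sum_(z <- zs) far_ind (2 * r) z <= \sum_(x <- xs) far_ind r x + d.
Proof.
move=> r0 hs hd.
apply: (@le_trans _ _ (\sum_(z <- zs) (1 - cutoff r z))).
  by apply: sum_le_sum => z; case: (cutoff_bounds z r0).
have : \sum_(x <- xs) (1 - cutoff r x) <= \sum_(x <- xs) far_ind r x.
  by apply: sum_le_sum => z; case: (cutoff_bounds z r0).
rewrite !sumrB !sumr_cst_seq !mulr1.
by move: hd; rewrite ler_norml => /andP[? ?] ?; lra.
Qed.

Lemma sum_lcomb_diff (xs zs : seq R[i]) (s : seq (R * R[i] * R)) (D : R) :
  (forall t, t \in s ->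
    `|\sum_(z <- zs) lmax t.1.2 t.2 z - \sum_(x <- xs) lmax t.1.2 t.2 x| <= D) ->
  `|\sum_(z <- zs) lcomb s z - \sum_(x <- xs) lcomb s x| <= (\sum_(t <- s) `|t.1.1|) * D.
Proof.
move=> h; rewrite /lcomb exchange_big /= [X in _ - X]exchange_big /= -sumrB mulr_suml.
rewrite (le_trans (ler_norm_sum _ _ _))// big_seq [leRHS]big_seq; apply: ler_sum => t ts.
by rewrite -!mulr_sumr -mulrBr normrM ler_wpM2l// h.
Qed.

Lemma sum_approx_diff (f : R * R -> R) (B e r : R) (s : seq (R * R[i] * R)) (zs : seq R[i]) :
  (forall z, `|f z| <= B) -> (forall z, `|lcomb s (cpl z)| <= 9 * 9 * B) ->
  0 <= e ->
  (forall z : R * R, `|z.1| <= r -> `|z.2| <= r -> `|f z - lcomb s (cpl z)| <= e) ->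
  `|\sum_(z <- zs) f (pair_of_cplx z) - \sum_(z <- zs) lcomb s z| <=
    e * (size zs)%:R + (9 * 9 * B + B) * \sum_(z <- zs) far_ind r z.
Proof.
move=> fB sB e0 sf; rewrite -sumrB (le_trans (ler_norm_sum _ _ _))//.
rewrite mulr_sumr [e * _]mulrC -sumr_cst_seq -big_split /=.
apply: sum_le_sum => z.
have zE : z = cpl (pair_of_cplx z) by case: z.
rewrite /far_ind; case: ifPn => [_|].
  rewrite mulr1 (le_trans (ler_normB _ _))//.
  have := sB (pair_of_cplx z); have := fB (pair_of_cplx z); rewrite -zE; lra.
rewrite -leNgt mulr0 addr0 => hz.
have := sf (pair_of_cplx z); rewrite -zE; apply.
  exact: le_trans (normc_Re _) hz.
exact: le_trans (normc_Im _) hz.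
Qed.

(** The [3] counts the approximation of [f] by [lcomb s] at critical points and at roots, and the
    comparison of the two sums of [lcomb s]; [7 = 4 + 3] counts the far critical points and the far
    roots. *)
Lemma sum_crit_roots_diff (xs zs : seq R[i]) (f : R * R -> R) (B e r D d : R)
    (s : seq (R * R[i] * R)) :
  0 < r -> (size zs <= size xs)%N -> 0 <= e -> e * (size xs)%:R <= d ->
  (forall z, `|f z| <= B) -> (forall z, `|lcomb s (cpl z)| <= 9 * 9 * B) ->
  (forall z : R * R, `|z.1| <= 2 * r -> `|z.2| <= 2 * r -> `|f z - lcomb s (cpl z)| <= e) ->
  2 * D <= d * ln 2 -> (\sum_(t <- s) `|t.1.1|) * D <= d ->
  (forall t, t \in (0, 2 * r) :: (0, r) :: [seq (u.1.2, u.2) | u <- s] ->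
    `|\sum_(z <- zs) lmax t.1 t.2 z - \sum_(x <- xs) lmax t.1 t.2 x| <= D) ->
  \sum_(x <- xs) far_ind r x <= 3 * d ->
  `|\sum_(z <- zs) f (pair_of_cplx z) - \sum_(x <- xs) f (pair_of_cplx x)|
    <= (3 + 7 * (9 * 9 * B + B)) * d.
Proof.
move=> r0 hs e0 hd fB sB sf hD hS hL hfar.
have B0 : 0 <= B by exact: le_trans (fB (0, 0)).
have A0 : 0 <= 9 * 9 * B + B by rewrite addr_ge0// mulr_ge0.
have hs' : (size zs)%:R <= (size xs)%:R :> R by rewrite ler_nat.
have i1 := hL (0, 2 * r) (mem_head _ _).
have i2 : `|\sum_(z <- zs) lmax 0 r z - \sum_(x <- xs) lmax 0 r x| <= D.
  by apply: (hL (0, r)); rewrite !inE eqxx orbT.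
have farz := far_zeros r0 hs' (sum_cutoff_diff hD i1 i2).
have farx2 : \sum_(x <- xs) far_ind (2 * r) x <= \sum_(x <- xs) far_ind r x.
  apply: sum_le_sum => z; case: (cutoff_bounds z r0); exact: le_trans.
have FF : `|\sum_(z <- zs) lcomb s z - \sum_(x <- xs) lcomb s x| <= d.
  apply: le_trans hS; apply: sum_lcomb_diff => t ts.
  apply: (hL (t.1.2, t.2)); rewrite !inE.
  by apply/or3P; apply: Or33; apply/mapP; exists t.
have Fz := sum_approx_diff zs fB sB e0 sf; have Fx := sum_approx_diff xs fB sB e0 sf.
have ez : e * (size zs)%:R <= d by apply: le_trans hd; rewrite ler_wpM2l.
have Az : (9 * 9 * B + B) * \sum_(z <- zs) far_ind (2 * r) z <= (9 * 9 * B + B) * (4 * d).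
  by rewrite ler_wpM2l//; lra.
have Ax : (9 * 9 * B + B) * \sum_(z <- xs) far_ind (2 * r) z <= (9 * 9 * B + B) * (3 * d).
  by rewrite ler_wpM2l//; lra.
move: FF Fz Fx ez hd Az Ax; clear; set A := 9 * 9 * B + B.
rewrite !ler_norml => /andP[? ?] /andP[? ?] /andP[? ?] ? ? ? ?.
by apply/andP; split; lra.
Qed.

Context d (T : measurableType d) (P : probability T R).
Variables (X : nat -> T -> R * R) (k : nat -> nat) (xi : nat -> nat -> R[i]).
Hypothesis mX : forall i, measurable_fun setT (X i).
Hypothesis distX : forall i (A : set (R * R)), measurable A -> P (X i @^-1` A) = mu A.
Hypothesis indepX : mutually_independent P X.
Hypothesis hk : forall n, (k n <= n)%N.
Hypothesis hko : ((k n)%:R / n%:R : R) @[n --> \oo] --> 0.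
Local Notation xs := (sample_roots X k xi).
Local Notation crit := (fun n w => roots_mult (\prod_(x <- xs n w) ('X - x%:P))^`()).
Local Notation "''Em' F" := (Rintegral mu setT F) (at level 10, F at level 8).

Lemma nondegenerate_event (a0 b0 : R[i]) (f : R * R -> R) (B e eta : R) : a0 != b0 ->
  in_support mu a0 -> in_support mu b0 ->
  continuous f -> (forall z, `|f z| <= B) -> 0 < e -> 0 < eta ->
  exists n0, forall n, (n0 <= n)%N -> exists E : set T, [/\ measurable E, (P E <= eta%:E)%E &
    forall w, ~ E w ->
    `|crit_emp_integral (\prod_(x <- xs n w) ('X - x%:P)) f - 'Em f| <= e].
Proof.
move=> ab sa sb cf fB e0 eta0.
have B0 : 0 <= B by exact: le_trans (fB (0, 0)).
pose A := 9 * 9 * B + B.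
have A0 : 0 <= A by rewrite addr_ge0// mulr_ge0.
(* [3 + 7 A] for critical points against roots, [1 + 2 B] for roots against [mu], and [1] for
   replacing [n] by [n - 1]. The 2 in [e1] pays for [n <= 2 (n - 1)]. *)
pose D := 5 + 7 * A + 2 * B.
have D0 : 0 < D by rewrite /D; lra.
pose e1 := e / (2 * D).
have e10 : 0 < e1 by rewrite divr_gt0// mulr_gt0.
have [r1 r10 mur1] := tight_disc e10.
pose g1 (x : R * R) := far_ind r1 (cpl x).
have g1E : g1 = \1_[set x : R * R | r1 < normc (cpl x)].
  apply/funext => x; rewrite /g1 /far_ind indicE.
  have [h|h] := boolP (r1 < normc (cpl x)); first by rewrite mem_set.
  by rewrite memNset//=; exact/negP.
have mfar : measurable [set x : R * R | r1 < normc (cpl x)].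
  have -> : [set x : R * R | r1 < normc (cpl x)] = [set x | r1 < normc (cpl x - 0)].
    by apply/seteqP; split => x; rewrite /mkset subr0.
  by apply: measurable_disc_far; exact: ltW.
have bg1 : bmeas g1 by rewrite g1E; exact: bmeas_indic.
have c1 : 'Em g1 <= e1.
  by rewrite g1E (Ex_indic mu mfar) -lee_fin fineK ?fin_num_measure.
have bf : bmeas f by split; [exact: measurable_continuous2|exists B].
have cB : `|'Em f| <= B.
  have bc b : bmeas (fun=> b : R) := @bmeas_cst _ (R * R)%type R b.
  rewrite ler_norml; apply/andP; split.
    rewrite -[leLHS](Ex_cst mu); apply: Ex_le => // x.
    by have := fB x; rewrite ler_norml => /andP[].
  rewrite -[leRHS](Ex_cst mu); apply: Ex_le => // x.
  by have := fB x; rewrite ler_norml => /andP[].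
have [s [s0 sB sf]] := lmax_approx (2 * r1) cf fB e10.
pose Sa := \sum_(t <- s) `|t.1.1|.
have Sa0 : 0 <= Sa by apply: sumr_ge0.
have l2 := ln2_gt0; have l21 := ln2_le1.
(* Small enough both for the coefficients of [s], as [Sa e2 <= e1], and for the cutoff, as
   [2 e2 <= e1 ln 2]. *)
pose e2 := e1 * ln 2 / (2 + Sa).
have Sa2 : 0 < 2 + Sa by lra.
have e20 : 0 < e2 by rewrite divr_gt0// mulr_gt0.
have e2Sa : Sa * e2 <= e1.
  rewrite /e2 mulrA ler_pdivrMr//; have : e1 * ln 2 <= e1 by rewrite ler_piMr// ltW.
  nra.
have e2l : 2 * e2 <= e1 * ln 2.
  rewrite /e2 mulrA ler_pdivrMr//.
  have : 0 <= e1 * ln 2 by rewrite mulr_ge0// ltW.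
  nra.
pose L : seq (R[i] * R) := (0, 2 * r1) :: (0, r1) :: [seq (t.1.2, t.2) | t <- s].
have L0 t : t \in L -> 0 < t.2.
  rewrite !inE => /or3P[/eqP->|/eqP->|/mapP[u us ->]] //=; first by rewrite mulr_gt0.
  exact: s0.
have eta3 : 0 < eta / 3 by rewrite divr_gt0.
have [n1 hn1] := lmax_event_seq xi mX distX indepX hk hko ab sa sb L0 e20 eta3.
have [n2 hn2] := sample_mean_event k mX distX indepX bf e10 eta3.
have [n3 hn3] := sample_mean_event k mX distX indepX bg1 e10 eta3.
have [n4 hn4] := eventually_small_k hko e10.
pose n5 := (Num.truncn (B / e1)).+1.
exists (maxn (maxn (maxn n1 n2) (maxn n3 n4)) (maxn n5 2)) => n.
rewrite !geq_max => /andP[/andP[/andP[/hn1[E1 [mE1 PE1 h1]] /hn2[E2 [mE2 PE2 h2]]]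
  /andP[/hn3[E3 [mE3 PE3 h3]] /hn4 kn]] /andP[nn5 nn2]].
exists (E1 `|` E2 `|` E3); split.
- by apply: measurableU => //; exact: measurableU.
- apply: (le_trans (measureU2 _ (measurableU _ _ mE1 mE2) mE3)).
  have -> : eta = eta / 3 + eta / 3 + eta / 3 by field.
  rewrite 2!EFinD leeD//; apply: (le_trans (measureU2 _ mE1 mE2)).
  exact: leeD.
move=> w /not_orP[/not_orP[w1 w2] w3].
rewrite crit_emp_integralE size_sample_roots//.
have {}h1 := h1 w w1; have {}h2 := h2 w w2; have {}h3 := h3 w w3.
set zs := roots_mult _ in h1 *.
have sx : size (xs n w) = n by rewrite size_sample_roots.
have sz : size zs = n.-1 by rewrite size_roots_deriv sx// ltnW.
have n0 : 0 < n%:R :> R by rewrite ltr0n ltnW.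
have nB : B <= e1 * n%:R.
  by rewrite mulrC -ler_pdivrMr// ltW// (lt_le_trans (truncnS_gt _))// ler_nat.
have nn : n%:R = (n.-1)%:R + 1 :> R by rewrite natr1 prednK// ltnW.
have n2r : 1 <= (n.-1)%:R :> R by rewrite ler1n -ltnS prednK// ltnW.
have mk : (n - k n)%:R = n%:R - (k n)%:R :> R by rewrite natrB.
have k0 : 0 <= (k n)%:R :> R by [].
have k1 : (k n)%:R <= n%:R :> R by rewrite ler_nat.
pose fc (z : R[i]) := f (pair_of_cplx z).
have sum_xs (h : R[i] -> R) : \sum_(x <- xs n w) h x =
    \sum_(j < n - k n) h (cpl (X j w)) + \sum_(l < k n) h (xi n l).
  exact: big_sample_roots.
(* One share each for the deterministic zeros, the [mu]-mass of the far region and the deviation of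
   the sample from it. *)
have farx : \sum_(x <- xs n w) far_ind r1 x <= 3 * (e1 * n%:R).
  rewrite sum_xs.
  have u1 : \sum_(l < k n) far_ind r1 (xi n l) <= (k n)%:R.
    apply: (@le_trans _ _ (\sum_(l < k n) 1)); last by rewrite sumr_const card_ord.
    by apply: ler_sum => l _; rewrite /far_ind; case: ifP.
  have u2 : (n - k n)%:R * 'Em g1 <= e1 * n%:R.
    rewrite mulrC; apply: (@le_trans _ _ (e1 * (n - k n)%:R)); first by rewrite ler_wpM2r.
    by rewrite ler_wpM2l ?(ltW e10)// ler_nat leq_subr.
  move: h3; rewrite ler_norml => /andP[_ h3]; rewrite -/(g1 _) in h3 *.
  move: h3 u1 u2 kn; rewrite /g1; set z1 := \sum_(j < _) _; set z2 := \sum_(l < _) _; set z3 := _ * 'Em _.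
  by move=> *; lra.
have fx : `|\sum_(x <- xs n w) fc x - n%:R * 'Em f| <= e1 * n%:R + 2 * B * (e1 * n%:R).
  rewrite sum_xs.
  have -> : \sum_(j < n - k n) fc (cpl (X j w)) = \sum_(j < n - k n) f (X j w).
    by apply: eq_bigr => j _; rewrite /fc; congr f; case: (X j w).
  have u1 : `|\sum_(l < k n) fc (xi n l)| <= B * (k n)%:R.
    apply: (le_trans (ler_norm_sum _ _ _)).
    apply: (@le_trans _ _ (\sum_(l < k n) B)); last by rewrite sumr_const card_ord -[leLHS]mulr_natr.
    by apply: ler_sum => l _; exact: fB.
  have u2 : `|(k n)%:R * 'Em f| <= B * (k n)%:R.
    by rewrite normrM (ger0_norm k0) mulrC ler_wpM2r.
  have u3 : B * (k n)%:R <= B * (e1 * n%:R) by rewrite ler_wpM2l.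
  rewrite mk mulrBl in h2.
  have e3 (p q u v : R) : p + q - u = p - (u - v) + (q - v) by ring.
  rewrite (e3 _ _ _ ((k n)%:R * 'Em f)).
  rewrite (le_trans (ler_normD _ _))// lerD//.
  rewrite (le_trans (ler_normB _ _))// (_ : 2 * B * _ = B * (e1 * n%:R) + B * (e1 * n%:R)); last by ring.
  by apply: lerD; [exact: le_trans u3|exact: le_trans u3].
have diff : `|\sum_(z <- zs) fc z - \sum_(x <- xs n w) fc x| <= (3 + 7 * A) * (e1 * n%:R).
  apply: (@sum_crit_roots_diff (xs n w) zs f B e1 r1 (e2 * n%:R) (e1 * n%:R) s) => //.
  - by rewrite sx sz leq_pred.
  - exact: ltW.
  - by rewrite sx.
  - by rewrite mulrA [leRHS]mulrAC ler_wpM2r.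
  - by rewrite mulrA ler_wpM2r.
have main : `|\sum_(z <- zs) fc z - (n.-1)%:R * 'Em f| <= D * (e1 * n%:R).
  have nE : (n.-1)%:R * 'Em f = n%:R * 'Em f - 'Em f by rewrite nn; ring.
  have e3 (p q u v : R) : p - (u - v) = (p - q) + (q - u) + v by ring.
  rewrite nE (e3 _ (\sum_(x <- xs n w) fc x)).
  have -> : D * (e1 * n%:R) = (3 + 7 * A) * (e1 * n%:R) + (e1 * n%:R + 2 * B * (e1 * n%:R)) + e1 * n%:R.
    by rewrite /D; ring.
  rewrite (le_trans (ler_normD _ _))// lerD ?(le_trans cB)//.
  by rewrite (le_trans (ler_normD _ _))// lerD.
have n1' : 0 < (n.-1)%:R :> R by exact: lt_le_trans n2r.
have -> : (\sum_(z <- zs) f (pair_of_cplx z)) / (n.-1)%:R - 'Em f =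
   (\sum_(z <- zs) fc z - (n.-1)%:R * 'Em f) / (n.-1)%:R.
  by rewrite mulrBl mulrAC divff ?gt_eqF// mul1r.
rewrite normrM normfV (gtr0_norm n1') ler_pdivrMr//.
apply: (le_trans main).
have -> : D * (e1 * n%:R) = e / 2 * n%:R by rewrite /e1; field; rewrite gt_eqF.
rewrite mulrAC ler_pdivrMr// -mulrA ler_wpM2l ?(ltW e0)//.
by rewrite nn mulr_natr mulr2n lerD2l.
Qed.

End NonDegenerate.

Theorem mainTheorem1
  (R : realType)
  (mu : probability (R * R)%type R)
  (d : measure_display) (T : measurableType d) (P : probability T R)
  (X : nat -> T -> R * R)
  (k : nat -> nat)
  (xi : nat -> nat -> R[i])
  (hXmeas : forall i, measurable_fun setT (X i))
  (hXdist : forall i (A : set (R * R)), measurable A -> P (X i @^-1` A) = mu A)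
  (hXindep : mutually_independent P X)
  (hk : forall n, (k n <= n)%N)
  (hko : ((k n)%:R / n%:R : R) @[n --> \oo] --> 0)
  (f : R * R -> R)
  (hfc : continuous f)
  (hfb : exists M : R, forall z, `|f z| <= M)
  (eps : R) (heps : 0 < eps) :
  let p := fun (n : nat) (w : T) =>
    (\prod_(j < n - k n) ('X - (cplx_of_pair (X j w))%:P)) *
    (\prod_(l < k n) ('X - (xi n l)%:P)) : {poly R[i]} in
  (P [set w | (`| (crit_emp_integral (p n w) f)%:E - \int[mu]_z (f z)%:E | > eps%:E)%E ])
    @[n --> \oo] --> 0%E.
Proof.
move=> p; have [B hB] := hfb.
have B0 : 0 <= B by exact: le_trans (hB (0, 0)).
have pE n w : p n w = \prod_(x <- sample_roots X k xi n w) ('X - x%:P).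
  by rewrite big_sample_roots.
set c := Rintegral mu setT f.
have bf : bmeas f by split; [exact: measurable_continuous2|exists B].
have fint : (\int[mu]_z (f z)%:E = c%:E)%E.
  by rewrite fineK//; exact: integrable_fin_num (bmeas_integrable _ bf).
pose A n := [set w | (`| (crit_emp_integral (p n w) f)%:E - \int[mu]_z (f z)%:E | > eps%:E)%E].
change (P (A n) @[n --> \oo] --> 0%E).
have AE n : A n = [set w | eps < `|crit_emp_integral (p n w) f - c|].
  by apply/funext => w; rewrite /A /mkset fint -EFinB abse_EFin lte_fin.
(* Needed to compare [P (A n)] with the exceptional event by monotonicity of [P]; the index [n = 0]
   does not affect the limit. *)
have mA n : (0 < n)%N -> measurable (A n).
  move=> n0; rewrite AE.
  have mF : measurable_fun setT (fun w => `|crit_emp_integral (p n w) f - c|).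
    apply: measurableT_comp => //; apply: measurable_funB => //.
    under eq_fun do rewrite pE; exact: measurable_crit.
  have -> : [set w | eps < `|crit_emp_integral (p n w) f - c|] =
      ~` [set w | `|crit_emp_integral (p n w) f - c| <= eps].
    by apply/seteqP; split => w /=; [move=> h; apply/negP; rewrite -ltNge|move/negP; rewrite -ltNge].
  by apply: measurableC; exact: measurable_set_ler.
have key (eta : R) : 0 < eta -> exists n0, forall n, (n0 <= n)%N ->
    exists E : set T, [/\ measurable E, (P E <= eta%:E)%E & A n `<=` E].
  move=> eta0.
  have [[a0 [b0 [ab sa sb]]]|[a mua]] := support_dichotomy mu.
    have [n0 h] := nondegenerate_event xi hXmeas hXdist hXindep hk hko ab sa sb hfc hB heps eta0.
    exists n0 => n /h[E [mE PE hE]]; exists E; split=> // w; rewrite AE /mkset => Aw.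
    apply: contrapT => /hE; rewrite -pE => hle; by move: Aw; rewrite ltNge hle.
  have [n0 h] := degenerate_event xi hXmeas hXdist hk hko mua hfc hB heps.
  exists n0 => n /h[E [mE PE hE]]; exists E; split=> //.
    by rewrite PE lee_fin ltW.
  move=> w; rewrite AE /mkset => Aw.
  by apply: contrapT => /hE; rewrite -pE => hle; move: Aw; rewrite ltNge hle.
apply/fine_cvgP; split.
  exists 1%N => // n /= n0; apply: fin_num_measure; exact: mA.
apply/cvgrPdist_le => eta eta0; have [n0 h] := key _ eta0.
exists (maxn n0 1) => // n /=; rewrite geq_max => /andP[/h[E [mE PE AE']] n1].
rewrite sub0r normrN ger0_norm ?fine_ge0//.
rewrite -lee_fin fineK; last by apply: fin_num_measure; exact: mA.
by apply: le_trans PE; apply: le_measure; rewrite ?inE//; exact: mA.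
Qed.
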